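(* Consider the equation $$\int_0^\alpha s^{-m-1}[h(s)-rK_1]\,ds=0\qquad(\ast)$$ for $\alpha>0$, and let $$B=\frac1{\sigma^2(n-m)}\int_\alpha^\infty s^{-n-1}[h(s)-rK_1]\,ds,\qquad w_1(x)=R_h(x)\ (x>0),\qquad w_0(x)=\begin{cases}Bx^n,&x<\alpha,\\ R_h(x)-K_1,&x\ge\alpha.\end{cases}$$ Equation $(\ast)$ has a unique solution $\alpha>0$ and the functions $w_1,w_0$, with $B>0$ given by the formula above, are increasing and satisfy the HJB equation (stated in the context) if and only if $$0\le K\quad\text{and}\quad\max\{-rK_0,\,-rK\}\le h(0)<rK_1.$$
   Context: Let $b\in\mathbb R$, $\sigma\ne0$, $r>0$ be constants, $W$ a standard one-dimensional Brownian motion and, for $x>0$, let $X$ solve $dX_t=bX_t\,dt+\sqrt2\,\sigma X_t\,dW_t$, $X_0=x$. Standing assumption: $h:(0,\infty)\to\mathbb R$ is right-continuous and increasing (''increasing'' does not mean strictly increasing), $\lim_{x\to\infty}h(x)=\infty$, $\mathbb E[\int_0^\infty e^{-rt}|h(X_t)|\,dt]<\infty$ for every $x>0$; $K_1,K_0>0$, $K\in\mathbb R$. Put $h(0):=\lim_{x\downarrow0}h(x)$. The constants $m<0<n$ are $m,n=\frac1{2\sigma^2}\big[\sigma^2-b\mp\sqrt{(b-\sigma^2)^2+4\sigma^2r}\big]$, and $$R_h(x)=\frac1{\sigma^2(n-m)}\Big[x^m\int_0^xs^{-m-1}h(s)\,ds+x^n\int_x^\infty s^{-n-1}h(s)\,ds\Big]=\mathbb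 E\Big[\int_0^\infty e^{-rs}h(X_s)\,ds\Big].$$ HJB equation: the coupled quasi-variational inequalities $$\max\{\sigma^2x^2w_1''(x)+bxw_1'(x)-rw_1(x)+h(x),\ w_0(x)-w_1(x)-K_0,\ -w_1(x)-K\}=0,$$ $$\max\{\sigma^2x^2w_0''(x)+bxw_0'(x)-rw_0(x),\ w_1(x)-w_0(x)-K_1,\ -w_0(x)-K\}=0$$ on $(0,\infty)$; the solutions $w_1,w_0$ are $C^1$ as well as $C^2$ outside a finite set, and satisfy these equations in the classical sense.
   Formalization: The HJB solutions are required to be C² and to satisfy the equations outside a finite set together with the discontinuities of h, not just a finite set; if h has infinitely many jumps (e.g. h(x)=⌊x⌋), w1=R_h is C² off no finite set and the literal claim fails. *)

(* Defs.v *)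
From HB Require Import structures.
From mathcomp Require Import all_boot all_order all_algebra.
From mathcomp Require Import all_classical all_reals all_analysis.
Set Implicit Arguments.
Unset Strict Implicit.
Unset Printing Implicit Defensive.
Import Order.TTheory GRing.Theory Num.Theory.
Import numFieldNormedType.Exports.
Local Open Scope classical_set_scope.
Local Open Scope ring_scope.

Section stochastic.
Context (R : realType) (d : measure_display) (T : measurableType d).
Variable P : probability T R.
Implicit Types (F : R -> set (set T)) (W X H : R -> T -> R) (t x : R).

(* Processes are indexed by R, but only the times t >= 0 are constrained. *)

Definition filtration F : Prop :=
  (forall t, 0 <= t -> sigma_algebra setT (F t) /\ F t `<=` measurable) /\
  (forall s t, 0 <= s -> s <= t -> F s `<=` F t).

Definition adapted F X : Prop :=
  forall t, 0 <= t -> forall B, measurable B -> F t (X t @^-1` B).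

Definition continuous_paths X : Prop :=
  forall w, {within `[0, +oo[, continuous (X ^~ w)}.

(* [normal_prob] takes the standard deviation. *)
Definition brownian_motion F W : Prop :=
  [/\ filtration F, adapted F W, continuous_paths W,
      {ae P, forall w, W 0 w = 0} &
      forall s t, 0 <= s -> s < t ->
        (forall B, measurable B ->
          P ((fun w => W t w - W s w)%R @^-1` B) = normal_prob 0 (Num.sqrt (t - s)) B) /\
        (forall A B, F s A -> measurable B ->
          P (A `&` (fun w => W t w - W s w)%R @^-1` B) =
            (P A * P ((fun w => W t w - W s w)%R @^-1` B))%E)].

Definition cvg_in_prob (S : nat -> T -> R) (J : T -> R) : Prop :=
  forall e, 0 < e -> P [set w | e <= `|S N w - J w|] @[N --> \oo] --> 0%E.

(* The N-th partition of [0, t] is tau N 0 <= ... <= tau N (k N). *)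
Definition vanishing_partitions t (k : nat -> nat) (tau : nat -> nat -> R) :
    Prop :=
  (forall N, [/\ tau N 0%N = 0, tau N (k N) = t &
     forall i, (i < k N)%N -> tau N i <= tau N i.+1]) /\
  (\big[Num.max/0]_(i < k N) (tau N i.+1 - tau N i) @[N --> \oo] --> 0).

(* J is (a version of) the Ito integral of H over [0, t] with respect to the
   Brownian motion W, as the limit in probability of left-endpoint sums.  It
   is meant for continuous adapted H only: for such H these sums do converge
   to the Ito integral, whatever the partitions. *)
Definition ito_integral W H t (J : T -> R) : Prop :=
  forall k tau, vanishing_partitions t k tau ->
    cvg_in_prob (fun N w => \sum_(i < k N)
      H (tau N i) w * (W (tau N i.+1) w - W (tau N i) w)) J.

(* X is a solution in (0, oo) of
   dX_t = b X_t dt + sqrt 2 sigma X_t dW_t, X_0 = x. *)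
Definition solves_sde (b sigma : R) F W x X : Prop :=
  [/\ adapted F X, continuous_paths X,
      forall t w, 0 <= t -> 0 < X t w,
      {ae P, forall w, X 0 w = x} &
      forall t, 0 <= t -> exists J : T -> R,
        [/\ measurable_fun setT J,
            ito_integral W (fun s w => Num.sqrt 2 * sigma * X s w) t J &
            {ae P, forall w, X t w =
              x + (\int[lebesgue_measure]_(s in `[0, t]) (b * X s w)) + J w}]].

End stochastic.

Section hjb.
Context (R : realType).
Implicit Types (b sigma r : R) (h w : R -> R) (E : set R).

(* Functions on (0, oo) are functions on R whose values on (-oo, 0] are
   never used. *)

Definition increasing_pos w : Prop :=
  forall x y, 0 < x -> x <= y -> w x <= w y.

Definition C1_pos w : Prop :=
  (forall x, 0 < x -> derivable w x 1) /\
  {within `]0, +oo[, continuous (w^`())%classic}.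

Definition C2_pos_off E w : Prop :=
  (forall x, 0 < x -> ~ E x -> derivable (w^`())%classic x 1) /\
  {within `]0, +oo[ `\` E, continuous (w^`(2))%classic}.

Definition discontinuities h : set R :=
  [set x | 0 < x /\ ~ {for x, continuous h}].

(* Where w1 is in the region in which its differential equation holds, w1''
   jumps exactly where h does, so that the discontinuities of h (countably
   many for increasing h) are exempted along with a finite set.  If h has
   finitely many discontinuities, this just says "outside a finite set". *)
Definition hjb_solution b sigma r h (K1 K0 K : R) (w1 w0 : R -> R) : Prop :=
  [/\ C1_pos w1, C1_pos w0 &
    exists S : set R, finite_set S /\
      let E := S `|` discontinuities h in
      [/\ C2_pos_off E w1, C2_pos_off E w0 &
        forall x, 0 < x -> ~ E x ->
          Num.max (Num.max
            (sigma ^+ 2 * x ^+ 2 * (w1^`(2))%classic x + b * x * (w1^`())%classic x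
               - r * w1 x + h x)
            (w0 x - w1 x - K0))
            (- w1 x - K) = 0 /\
          Num.max (Num.max
            (sigma ^+ 2 * x ^+ 2 * (w0^`(2))%classic x + b * x * (w0^`())%classic x
               - r * w0 x)
            (w1 x - w0 x - K1))
            (- w0 x - K) = 0]].

Definition exp_m b sigma r : R :=
  (2 * sigma ^+ 2)^-1 * (sigma ^+ 2 - b
    - Num.sqrt ((b - sigma ^+ 2) ^+ 2 + 4 * sigma ^+ 2 * r)).

Definition exp_n b sigma r : R :=
  (2 * sigma ^+ 2)^-1 * (sigma ^+ 2 - b
    + Num.sqrt ((b - sigma ^+ 2) ^+ 2 + 4 * sigma ^+ 2 * r)).

Local Notation mu := lebesgue_measure.

Definition Rh b sigma r h (x : R) : R :=
  let m := exp_m b sigma r in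
  let n := exp_n b sigma r in
  (sigma ^+ 2 * (n - m))^-1 *
    (x `^ m * (\int[mu]_(s in `]0, x[) (s `^ (- m - 1) * h s)) +
     x `^ n * (\int[mu]_(s in `]x, +oo[) (s `^ (- n - 1) * h s))).

Definition alpha_equation b sigma r h (K1 alpha : R) : Prop :=
  \int[mu]_(s in `]0, alpha[)
    (s `^ (- exp_m b sigma r - 1) * (h s - r * K1)) = 0.

Definition coef_B b sigma r h (K1 alpha : R) : R :=
  let m := exp_m b sigma r in
  let n := exp_n b sigma r in
  (sigma ^+ 2 * (n - m))^-1 *
    (\int[mu]_(s in `]alpha, +oo[) (s `^ (- n - 1) * (h s - r * K1))).

Definition cand_w0 b sigma r h (K1 alpha x : R) : R :=
  if x < alpha then coef_B b sigma r h K1 alpha * x `^ (exp_n b sigma r)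
  else Rh b sigma r h x - K1.

(* h(0), possibly -oo *)
Definition h_at0 h : \bar R := lim ((h x)%:E @[x --> 0^'+]).

End hjb.

(* Main.v *)
Require Import Defs.
From HB Require Import structures.
From mathcomp Require Import all_boot all_order all_algebra.
From mathcomp Require Import all_classical all_reals all_analysis.
From mathcomp Require Import measurable_realfun.
From mathcomp Require Import ring lra.

(** Let [m < 0 < n] be the two exponents and [g s = h s - r * K1].  Write [int0 x]
for the integral of [s `^ (- m - 1) * g s] over [0 < s <= x], and [inty x] for
that of [s `^ (- n - 1) * g s] over [s > x].  Then [R_h - K1] is the resolvent of
[g], namely [kap * (x `^ m * int0 x + x `^ n * inty x)].

Sufficiency.  As [g] is increasing, negative near 0 and unbounded, [int0] starts
out negative, is nonpositive up to a unique zero [alpha] and increases strictly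
afterwards; at the zero [g] has become positive ([root_exists], [root_unique],
[gt0_at_root]).  At [alpha] the term with [int0] drops out of the resolvent and
of its derivative, so that [B * x `^ n] and [R_h - K1] agree there together with
their first derivatives; elsewhere the resolvent is differentiable even at the
jumps of [h], because the two halves of its kernel agree on the diagonal
([is_derive_resolvent]).  The differential parts of the equations then follow
from [resolvent_ode].  The obstacle inequalities hold because, below [alpha],
the quotient of [R_h - K1] by [x `^ n] has a positive multiple of [- int0] as its
derivative ([resolvent_le_root]), and because [g] may be replaced by its lower
bound in a kernel of mass at most [1 / r] ([resolvent_ge_root]).

Necessity.  If [h] were nowhere below [r * K1], then [int0] would be nonnegative
and nondecreasing, and [alpha / 2] would be a second zero.  Near 0, [R_h] is at
most [h d / r] plus a multiple of [x `^ n] for every [d > 0], while [w0] is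
[B * x `^ n].  The inequalities of the two equations, read at continuity points of
[h] tending to 0, bound [K] and the limit of [h] ([resolvent_le_near0],
[regular_point]).

Both directions need the integrals to converge.  In the necessity part this comes
from the data: the real-valued integral is 0 when it diverges, whereas [B] is
positive and, [alpha] being the only zero, the integral up to [alpha + 1] is not 0
([Rintegral_neq0_integrable]).  In the sufficiency part [h] is bounded below
near 0, and at infinity one has to use the finite expected cost.  That assumption
speaks of solutions of the stochastic equation, so one is constructed: geometric
Brownian motion ([gbm_solves_sde]).  Its left-endpoint sums differ from the
increment of the process minus the drift by a sum of errors that are centred given
the past and have second-order variances, and by the error of a Riemann sum
([euler_sumE], [euler_sum_L2], [cvg_exponential_riemann_sum]).  Finally, the
discounted time that it spends between [expR k] and [expR (k + 1)] is at least a
constant times [expR (- n * k)] ([occupation_ge]), so that the finite cost bounds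
the sum of the values [h (expR k) * expR (- n * k)] and with it the integral at
infinity ([gbm_integrable_at_infinity]). *)

Set Implicit Arguments.
Unset Strict Implicit.
Unset Printing Implicit Defensive.
Import Order.TTheory GRing.Theory Num.Theory.
Import numFieldNormedType.Exports.
Local Open Scope classical_set_scope.
Local Open Scope ring_scope.

(** * Gaussian integrals *)

Section normal_expectation.
Context {R : realType}.
Implicit Types (a s v : R).
Local Notation mu := (@lebesgue_measure R).
Local Open Scope ereal_scope.
Import HBNNSimple.

Let pdf_ge0 (m s x : R) : 0 <= (normal_pdf m s x)%:E.
Proof. by rewrite lee_fin normal_pdf_ge0. Qed.

Let measurable_pdf (m s : R) (D : set R) :
  measurable_fun D (fun x => (normal_pdf m s x)%:E).
Proof.
by apply/measurable_EFinP; apply: measurable_funTS; exact: measurable_normal_pdf.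
Qed.

Let integral_normal_prob_nnsfun (m s : R) (f : {nnsfun measurableTypeR R >-> R}) :
  \int[normal_prob m s]_x (f x)%:E =
  \int[mu]_x ((f x)%:E * (normal_pdf m s x)%:E).
Proof.
under [LHS]eq_integral do rewrite fimfunE -fsumEFin//.
rewrite [LHS]ge0_integral_fsum//; last 2 first.
  - by move=> r; exact/measurable_EFinP/measurableT_comp.
  - by move=> n x _; rewrite EFinM nnfun_muleindic_ge0.
under [RHS]eq_integral.
  move=> x _; rewrite fimfunE -fsumEFin// ge0_mule_fsuml; last first.
    by move=> r; rewrite EFinM nnfun_muleindic_ge0.
  over.
rewrite [RHS]ge0_integral_fsum//; last 2 first.
  - move=> r; apply: emeasurable_funM; last exact: measurable_pdf.
    by apply/measurable_EFinP; do 2 apply/measurableT_comp => //.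
  - by move=> n x _; rewrite mule_ge0// EFinM nnfun_muleindic_ge0.
apply: eq_fsbigr => r /[!inE] -[y _ yr].
have r0 : (0 <= r)%R by rewrite -yr.
rewrite integralZl_indic_nnsfun//= integral_indic// setIT.
under eq_integral do rewrite EFinM -muleA.
rewrite ge0_integralZl//.
- congr (_ * _); rewrite /normal_prob [LHS]integral_mkcond.
  by apply: eq_integral => x _; rewrite epatch_indic muleC.
- apply: emeasurable_funM; last exact: measurable_pdf.
  by apply/measurable_EFinP.
- by move=> x _; rewrite mule_ge0.
Qed.

(** The density formula passes from simple functions to nonnegative ones by
monotone convergence. *)
Lemma ge0_integral_normal_prob (m s : R) (f : measurableTypeR R -> \bar R) :
  measurable_fun setT f -> (forall x, 0 <= f x) ->
  \int[normal_prob m s]_x f x = \int[mu]_x (f x * (normal_pdf m s x)%:E).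
Proof.
move=> mf f0; pose f_ := nnsfun_approx measurableT mf.
have cf x : (f_ n x)%:E @[n --> \oo] --> f x by exact: cvg_nnsfun_approx.
transitivity (limn (fun n => \int[normal_prob m s]_x (f_ n x)%:E)).
  rewrite -monotone_convergence//.
  - by apply: eq_integral => y _; apply/esym/cvg_lim => //; exact: cf.
  - by move=> n; apply/measurable_EFinP; exact: measurable_funPT.
  - by move=> n y _; rewrite lee_fin.
  - by move=> y _ i j ij; rewrite lee_fin; exact/lefP/nd_nnsfun_approx.
under eq_fun do rewrite integral_normal_prob_nnsfun.
rewrite -monotone_convergence//; last 3 first.
- move=> n; apply: emeasurable_funM; last exact: measurable_pdf.
  by apply/measurable_EFinP; exact: measurable_funPT.
- by move=> n y _; rewrite mule_ge0// lee_fin.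
- move=> y _ i j ij; rewrite lee_wpmul2r// lee_fin.
  exact/lefP/nd_nnsfun_approx.
apply: eq_integral => y _; apply/cvg_lim => //.
by apply: cvgeZr => //; exact: cf.
Qed.

Lemma measurable_expRM (a : R) (D : set R) :
  measurable_fun D (fun v => expR (a * v)).
Proof.
by apply: measurable_funTS; apply: measurableT_comp.
Qed.

(** Completing the square: tilting a centred Gaussian density by an
exponential shifts its mean. *)
Lemma normal_mgf (a s : R) : s != 0%R ->
  \int[normal_prob 0 s]_v (expR (a * v))%:E = (expR (a ^+ 2 * s ^+ 2 / 2))%:E.
Proof.
move=> s0.
have tilt v : (expR (a * v) * normal_pdf 0 s v =
    expR (a ^+ 2 * s ^+ 2 / 2) * normal_pdf (a * s ^+ 2) s v)%R.
  rewrite !normal_pdfE//= mulrCA [RHS]mulrCA; congr (_ * _)%R.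
  rewrite /normal_fun -!expRD; congr expR.
  by field.
rewrite ge0_integral_normal_prob; last 2 first.
- by apply/measurable_EFinP; exact: measurable_expRM.
- by move=> v; rewrite lee_fin expR_ge0.
under eq_integral do rewrite -EFinM tilt EFinM.
rewrite ge0_integralZl// ?lee_fin ?expR_ge0//; last exact: measurable_pdf.
by rewrite integral_normal_pdf mule1.
Qed.

Lemma integrable_normal_expRM (a s : R) : s != 0%R ->
  (normal_prob 0 s).-integrable setT (fun v => (expR (a * v))%:E).
Proof.
move=> s0; apply/integrableP; split.
  by apply/measurable_EFinP; exact: measurable_expRM.
under eq_integral do rewrite gee0_abs ?lee_fin ?expR_ge0//.
by rewrite normal_mgf// ltry.
Qed.

Let integral_gauss_max (s : R) : s != 0%R ->
  \int[normal_prob 0 s]_v (Num.max (- v) 0)%:E =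
  \int[normal_prob 0 s]_v (Num.max v 0)%:E.
Proof.
move=> s0; pose F v := (Num.max v 0 * normal_pdf 0 s v)%R.
have cmax : continuous (fun v : R => Num.max v 0%R).
  by move=> v; apply: (@continuous_max _ _ id (cst 0%R)) => //; exact: cst_continuous.
have cF : continuous F.
  by move=> v; apply: cvgM; [exact: cmax|exact: continuous_normal_pdf].
have F0 v : (0 <= F v)%R.
  by rewrite mulr_ge0 ?normal_pdf_ge0// le_max lexx orbT.
have pdfN v : normal_pdf 0 s (- v) = normal_pdf 0 s v :> R.
  rewrite !normal_pdfE//= /normal_fun !subr0.
  by rewrite sqrrN.
rewrite !ge0_integral_normal_prob; first last.
- by move=> v; rewrite lee_fin le_max lexx orbT.
- apply/measurable_EFinP; apply: continuous_measurable_fun => v.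
  apply: (@continuous_comp _ _ _ (fun v : R => (- v)%R) (fun v : R => Num.max v 0%R)) => //.
    exact: opp_continuous.
  exact: cmax.
- by move=> v; rewrite lee_fin le_max lexx orbT.
- by apply/measurable_EFinP; exact: continuous_measurable_fun.
transitivity (\int[mu]_(v in `]-oo, (- 0)%R]) (F (- v)%R)%:E).
  rewrite [RHS]integral_mkcond; apply: eq_integral => v _.
  rewrite patchE -EFinM; case: ifPn => [_|]; first by rewrite /F pdfN.
  rewrite notin_setE/= in_itv/= oppr0 => /negP; rewrite -ltNge => v0.
  by rewrite (max_r (_ : - v <= 0)%R) ?mul0r// oppr_le0 ltW.
rewrite (@ge0_integration_by_substitutionNy _ (F \o -%R)%R 0%R).
- rewrite [LHS]integral_mkcond; apply: eq_integral => v _.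
  rewrite patchE -EFinM; case: ifPn => [_|]; first by rewrite /= opprK.
  rewrite notin_setE/= in_itv/= andbT => /negP; rewrite -ltNge => v0.
  by rewrite (max_r (_ : v <= 0)%R) ?mul0r// ltW.
- apply: continuous_subspaceT => v.
  by apply: (@continuous_comp _ _ _ (fun v : R => (- v)%R) F) => //;
    [exact: opp_continuous|exact: cF].
- by move=> v _; exact: F0.
Qed.

(** Integrable because [max v 0 <= expR v], and of mean zero because the density
is even. *)
Lemma normal_mean0 (s : R) : s != 0%R ->
  (normal_prob 0 s).-integrable setT (EFin : R -> \bar R) /\
  \int[normal_prob 0 s]_v v%:E = 0.
Proof.
move=> s0.
have posE : (EFin : R -> \bar R)^\+ = fun v => (Num.max v 0)%:E.
  by apply/funext => v; rewrite funeposE EFin_max.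
have negE : (EFin : R -> \bar R)^\- = fun v => (Num.max (- v) 0)%:E.
  by apply/funext => v; rewrite funenegE EFin_max.
have fin : \int[normal_prob 0 s]_v (Num.max v 0)%:E < +oo.
  apply: (@le_lt_trans _ _ (\int[normal_prob 0 s]_v (expR (1 * v))%:E)); last first.
    by rewrite normal_mgf// ltry.
  apply: ge0_le_integral => //.
  - by move=> v _; rewrite lee_fin le_max lexx orbT.
  - by apply/measurable_EFinP; apply: measurable_maxr.
  - by apply/measurable_EFinP; exact: measurable_expRM.
  - move=> v _; rewrite lee_fin mul1r ge_max expR_ge0 andbT.
    by rewrite (le_trans _ (expR_ge1Dx v))// lerDr.
have e : \int[normal_prob 0 s]_v v%:E = 0.
  rewrite integralE posE negE integral_gauss_max// subee//.
  rewrite ge0_fin_numE//; apply: integral_ge0 => v _.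
  by rewrite lee_fin le_max lexx orbT.
split => //; apply/integrableP; split; first exact/measurable_EFinP.
under eq_integral do rewrite -[(`| _%:E |)]/((abse \o EFin) _) fune_abse posE negE.
rewrite ge0_integralD//.
- by rewrite integral_gauss_max// lte_add_pinfty.
- by move=> v _; rewrite lee_fin le_max lexx orbT.
- by apply/measurable_EFinP; apply: measurable_maxr.
- by move=> v _; rewrite lee_fin le_max lexx orbT.
- by apply/measurable_EFinP; apply: measurable_maxr.
Qed.

End normal_expectation.

(** * The error of one Euler step *)

Section exponential_bounds.
Context {R : realType}.
Implicit Types (u : R).

Lemma expRB1_le u : expR u - 1 <= u * expR u.
Proof.
have := expR_ge1Dx (- u); rewrite expRN -(ler_pM2r (expR_gt0 u)).
by rewrite mulVf ?gt_eqF ?expR_gt0//; lra.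
Qed.

Lemma norm_expRB1 u : `|expR u - 1| <= `|u| * expR `|u|.
Proof.
have [u0|u0] := leP 0 u.
  rewrite (ger0_norm u0) ger0_norm ?expRB1_le// subr_ge0.
  by rewrite -[leLHS]expR0 ler_expR.
have h1 := expR_ge1Dx u.
have h2 : expR u <= 1 by rewrite -[leRHS]expR0 ler_expR ltW.
rewrite (ltr0_norm u0) ler0_norm ?subr_le0// (le_trans (_ : _ <= - u))//.
  by lra.
by rewrite ler_peMr ?oppr_ge0 ?(ltW u0)// -[leLHS]expR0 ler_expR oppr_ge0 ltW.
Qed.

Lemma norm_expRB1Bx u : `|expR u - 1 - u| <= u ^+ 2 * expR `|u|.
Proof.
have h1 := expR_ge1Dx u; have h2 := expRB1_le u.
rewrite ger0_norm; last by lra.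
apply: (@le_trans _ _ (u * (expR u - 1))); first by lra.
rewrite (le_trans (ler_norm _))// normrM -[u ^+ 2]real_normK ?num_real//.
by rewrite expr2 -mulrA ler_wpM2l// norm_expRB1.
Qed.

Lemma expR_norm_le u : expR `|u| <= expR u + expR (- u).
Proof.
by case: (ger0P u) => _; rewrite ?lerDl ?lerDr expR_ge0.
Qed.

Lemma exp4_le_expR u : u ^+ 4 <= 24 * expR `|u|.
Proof.
have := expR_ge1Dxn 3 (normr_ge0 u).
rewrite -normrX ger0_norm; last by rewrite exprn_even_ge0.
by rewrite (_ : 4`!%:R = 24 :> R)//; lra.
Qed.

End exponential_bounds.

(** The error of one step of the Euler scheme for a geometric Brownian motion
with drift [b] and volatility [c], when the Brownian increment is [v] and the
time step [e]: what the stochastic integral earns minus the exact compensated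
increment.  Both are centred, and they agree to first order in [v]. *)
Definition euler_error {R : realType} (b c e v : R) : R :=
  c * v - (expR ((b - c ^+ 2 / 2) * e + c * v) - expR (b * e)).

Section euler_error.
Context {R : realType}.
Variables (b c : R).
Local Notation m := (b - c ^+ 2 / 2).
Implicit Types (e t v : R).

Let euler_errorE e v :
  euler_error b c e v = c * v - expR (m * e) * expR (c * v) + expR (b * e).
Proof. by rewrite /euler_error expRD opprB addrCA addrC. Qed.

Lemma measurable_euler_error e (D : set R) :
  measurable_fun D (euler_error b c e).
Proof.
rewrite (funext (euler_errorE e)); apply: measurable_funD => //.
apply: measurable_funB; apply: measurable_funM => //.
exact: measurable_expRM.
Qed.

Let norm_le_expR e t z : 0 < e -> e <= t ->
  (expR (z * e) - 1) ^+ 2 <= e ^+ 2 * (`|z| * expR (`|z| * t)) ^+ 2.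
Proof.
move=> e0 et.
rewrite -[leLHS]real_normK ?num_real// -exprMn ler_sqr ?nnegrE//; last first.
  by rewrite !mulr_ge0// ?expR_ge0// ltW.
rewrite (le_trans (norm_expRB1 _))// normrM (gtr0_norm e0) [leRHS]mulrA.
rewrite [e * _]mulrC ler_wpM2l ?mulr_ge0 ?(ltW e0)//.
by rewrite ler_expR ler_wpM2l.
Qed.

(** The error is a term of second order in [v] plus two terms of first order in
[e].  Since [v] is typically of size [sqrt e], its fourth power is exchanged for
[e ^+ 2] times an exponential in [v / sqrt e], whose mean does not depend on
[e]. *)
Lemma euler_error_le t e k v : 0 < e -> e <= t ->
  k = (Num.sqrt e)^-1 + 2 * `|c| ->
  euler_error b c e v ^+ 2 <=
  3 * e ^+ 2 * (24 * c ^+ 4 * (expR (k * v) + expR ((- k) * v)) +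
  (`|m| * expR (`|m| * t)) ^+ 2 * expR (2 * c * v) +
  (`|b| * expR (`|b| * t)) ^+ 2).
Proof.
move=> e0 et kE.
have se0 : 0 < Num.sqrt e by rewrite sqrtr_gt0.
have se2 : Num.sqrt e ^+ 2 = e by rewrite sqr_sqrtr// ltW.
pose A := c * v + 1 - expR (c * v).
pose B := expR (c * v) * (1 - expR (m * e)).
pose C := expR (b * e) - 1.
have -> : euler_error b c e v = A + B + C by rewrite euler_errorE /A /B /C; ring.
have h3 : (A + B + C) ^+ 2 <= 3 * (A ^+ 2 + B ^+ 2 + C ^+ 2).
  rewrite -subr_ge0.
  have -> : 3 * (A ^+ 2 + B ^+ 2 + C ^+ 2) - (A + B + C) ^+ 2 =
    (A - B) ^+ 2 + (B - C) ^+ 2 + (A - C) ^+ 2 by ring.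
  by rewrite !addr_ge0// sqr_ge0.
apply: (le_trans h3); rewrite -mulrA ler_pM2l//.
have -> : e ^+ 2 * (24 * c ^+ 4 * (expR (k * v) + expR (- k * v)) +
    (`|m| * expR (`|m| * t)) ^+ 2 * expR (2 * c * v) +
    (`|b| * expR (`|b| * t)) ^+ 2) =
    c ^+ 4 * e ^+ 2 * 24 * (expR (k * v) + expR (- k * v)) +
    e ^+ 2 * (`|m| * expR (`|m| * t)) ^+ 2 * expR (2 * c * v) +
    e ^+ 2 * (`|b| * expR (`|b| * t)) ^+ 2 by ring.
rewrite !lerD//; last by exact: norm_le_expR.
- rewrite (_ : A = - (expR (c * v) - 1 - c * v)); last by rewrite /A; ring.
  rewrite sqrrN -[leLHS]real_normK ?num_real//.
  pose q := v / Num.sqrt e.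
  apply: (@le_trans _ _ (((c * v) ^+ 2 * expR `|c * v|) ^+ 2)).
    rewrite ler_sqr ?nnegrE ?norm_expRB1Bx//.
    by rewrite mulr_ge0 ?expR_ge0 ?sqr_ge0.
  have -> : ((c * v) ^+ 2 * expR `|c * v|) ^+ 2 =
      c ^+ 4 * e ^+ 2 * (q ^+ 4 * expR (2 * `|c * v|)).
    rewrite -se2 expRM_natl /q; field; exact: lt0r_neq0.
  have ce : 0 <= c ^+ 4 * e ^+ 2.
    by apply: mulr_ge0; [exact: exprn_even_ge0|exact: sqr_ge0].
  rewrite -[leRHS]mulrA ler_wpM2l//.
  apply: (@le_trans _ _ (24 * expR `|q| * expR (2 * `|c * v|))).
    by rewrite ler_wpM2r ?expR_ge0// exp4_le_expR.
  rewrite -mulrA ler_wpM2l// -expRD.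
  have -> : `|q| + 2 * `|c * v| = `|k * v|.
    rewrite /q kE !normrM (gtr0_norm (_ : 0 < (Num.sqrt e)^-1)) ?invr_gt0//.
    rewrite [ `|_ + _|]ger0_norm; first by ring.
    by rewrite addr_ge0// ?mulr_ge0// invr_ge0 ltW.
  by rewrite mulNr expR_norm_le.
- have -> : expR (2 * c * v) = expR (c * v) ^+ 2 by rewrite -mulrA expRM_natl.
  rewrite /B exprMn mulrC ler_wpM2r ?sqr_ge0//.
  by rewrite -sqrrN opprB norm_le_expR.
Qed.

Lemma euler_error_mean0 e : 0 < e ->
  let N := normal_prob 0 (Num.sqrt e) in
  N.-integrable setT (EFin \o euler_error b c e) /\
  (\int[N]_v (euler_error b c e v)%:E = 0)%E.
Proof.
move=> e0 N.
have se0 : Num.sqrt e != 0 by rewrite gt_eqF// sqrtr_gt0.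
have [i1 i2] := normal_mean0 se0.
have i3 := integrable_normal_expRM c se0.
have j1 : N.-integrable setT (fun v => (c * v)%:E).
  by under eq_fun do rewrite EFinM; exact: integrableZl.
have j2 : N.-integrable setT (fun v => (expR (m * e) * expR (c * v))%:E).
  by under eq_fun do rewrite EFinM; exact: integrableZl.
have j3 : N.-integrable setT (cst (expR (b * e))%:E).
  exact: finite_measure_integrable_cst.
have -> : EFin \o euler_error b c e = (fun v => ((c * v)%:E -
   (expR (m * e) * expR (c * v))%:E) + (expR (b * e))%:E)%E.
  by apply/funext => v; rewrite /= euler_errorE EFinD EFinB.
have j4 := integrableB measurableT j1 j2.
split; first exact: integrableD.
under eq_integral do rewrite euler_errorE EFinD EFinB.
have NT : (\int[N]_v (expR (b * e))%:E = (expR (b * e))%:E)%E.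
  rewrite integral_cst//; set p := (X in (_ * X)%E).
  by rewrite (_ : p = 1%E) ?mule1//; exact: (probability_setT N).
rewrite integralD// integralB// NT.
under eq_integral do rewrite EFinM.
rewrite integralZl// i2 mule0.
under eq_integral do rewrite EFinM.
rewrite integralZl// normal_mgf// sqr_sqrtr ?ltW// -EFinM -!EFinD -expRD.
congr EFin; apply/eqP; rewrite add0r addrC subr_eq0; apply/eqP; congr expR.
by field.
Qed.

(** The mean square error of a step is of second order, so that the errors of
[k] steps of length [t / k] still vanish together. *)
Lemma euler_error_sqr t : exists C, 0 <= C /\ forall e, 0 < e -> e <= t ->
  (\int[normal_prob 0 (Num.sqrt e)]_v ((euler_error b c e v) ^+ 2)%:E
    <= (C * e ^+ 2)%:E)%E.
Proof.
have [t0|t0] := leP t 0.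
  by exists 0; split => // e e0 et; move: (lt_le_trans e0 et); rewrite ltNge t0.
pose A2 := (`|m| * expR (`|m| * t)) ^+ 2.
pose B2 := (`|b| * expR (`|b| * t)) ^+ 2.
pose C1 := expR ((1 + 2 * `|c| * Num.sqrt t) ^+ 2 / 2).
exists (3 * (48 * c ^+ 4 * C1 + A2 * expR (2 * c ^+ 2 * t) + B2)).
have C10 : 0 <= C1 := expR_ge0 _.
have c4 : 0 <= c ^+ 4 by rewrite exprn_even_ge0.
have A20 : 0 <= A2 := sqr_ge0 _.
have B20 : 0 <= B2 := sqr_ge0 _.
split.
  apply: mulr_ge0 => //; do 2 apply: addr_ge0 => //.
    by do 2 apply: mulr_ge0 => //.
  by apply: mulr_ge0 => //; exact: expR_ge0.
move=> e e0 et.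
have se0 : Num.sqrt e != 0 by rewrite gt_eqF// sqrtr_gt0.
have se2 : Num.sqrt e ^+ 2 = e by rewrite sqr_sqrtr// ltW.
pose k := (Num.sqrt e)^-1 + 2 * `|c|.
have k2 : k ^+ 2 * e <= (1 + 2 * `|c| * Num.sqrt t) ^+ 2.
  rewrite -se2 -exprMn /k mulrDl mulVf// ler_sqr ?nnegrE.
  - by rewrite lerD2l ler_wpM2l ?mulr_ge0// ler_wsqrtr.
  - by rewrite addr_ge0 ?mulr_ge0 ?sqrtr_ge0.
  - by rewrite addr_ge0 ?mulr_ge0 ?sqrtr_ge0.
have mN a : measurable_fun setT (fun v : R => (expR (a * v))%:E).
  by apply/measurable_EFinP; exact: measurable_expRM.
have mZ z a : measurable_fun setT (fun v : R => z%:E * (expR (a * v))%:E)%E.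
  by apply: emeasurable_funM => //; exact: mN.
have E0 a v : (0 <= (expR (a * v))%:E)%E by rewrite lee_fin expR_ge0.
have e20 := sqr_ge0 e.
have p1 : 0 <= 3 * e ^+ 2 * (24 * c ^+ 4) by do 2 apply: mulr_ge0 => //.
have p2 : 0 <= 3 * e ^+ 2 * A2 by do 2 apply: mulr_ge0 => //.
have p3 : 0 <= 3 * e ^+ 2 * B2 by do 2 apply: mulr_ge0 => //.
apply: (@le_trans _ _ (\int[normal_prob 0 (Num.sqrt e)]_v
  ((3 * e ^+ 2 * (24 * c ^+ 4))%:E * (expR (k * v))%:E +
   ((3 * e ^+ 2 * (24 * c ^+ 4))%:E * (expR ((- k) * v))%:E +
  ((3 * e ^+ 2 * A2)%:E * (expR (2 * c * v))%:E + (3 * e ^+ 2 * B2)%:E))))%E).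
  apply: ge0_le_integral => //.
  - by move=> v _; rewrite lee_fin sqr_ge0.
  - apply/measurable_EFinP; apply: measurable_funX.
    exact: measurable_euler_error.
  - apply: emeasurable_funD; first exact: mZ.
    apply: emeasurable_funD; first exact: mZ.
    by apply: emeasurable_funD => //; exact: mZ.
  - move=> v _; rewrite -!EFinM -!EFinD lee_fin.
    apply: (le_trans (@euler_error_le t e k v e0 et erefl)).
    by rewrite le_eqVlt; apply/orP; left; apply/eqP; rewrite /A2 /B2; ring.
rewrite ge0_integralD//; last 4 first.
- by move=> v _; rewrite mule_ge0// ?lee_fin.
- exact: mZ.
- move=> v _; rewrite -!EFinM -!EFinD lee_fin.
  by do 2? apply: addr_ge0 => //; apply: mulr_ge0 => //; exact: expR_ge0.
- apply: emeasurable_funD; first exact: mZ.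
  by apply: emeasurable_funD => //; exact: mZ.
rewrite ge0_integralD//; last 4 first.
- by move=> v _; rewrite mule_ge0// ?lee_fin.
- exact: mZ.
- move=> v _; rewrite -!EFinM -!EFinD lee_fin.
  by do 1? apply: addr_ge0 => //; apply: mulr_ge0 => //; exact: expR_ge0.
- by apply: emeasurable_funD => //; exact: mZ.
rewrite ge0_integralD//; last 2 first.
- by move=> v _; rewrite mule_ge0// ?lee_fin.
- exact: mZ.
have NT z : (\int[normal_prob 0 (Num.sqrt e)]_v z%:E = z%:E)%E.
  rewrite integral_cst//; set p := (X in (_ * X)%E).
  by rewrite (_ : p = 1%E) ?mule1//; exact: (probability_setT (normal_prob 0 _)).
rewrite NT !ge0_integralZl//; try exact: mN.
rewrite !normal_mgf// sqrrN.
rewrite -!EFinM -!EFinD lee_fin se2.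
have l1 : expR (k ^+ 2 * e / 2) <= C1 by rewrite ler_expR ler_wpM2r.
have l2 : expR ((2 * c) ^+ 2 * e / 2) <= expR (2 * c ^+ 2 * t).
  rewrite ler_expR (_ : (2 * c) ^+ 2 * e / 2 = 2 * c ^+ 2 * e); last by field.
  by rewrite ler_wpM2l//; apply: mulr_ge0 => //; exact: sqr_ge0.
have m1 := ler_wpM2l p1 l1; have m2 := ler_wpM2l p2 l2.
lra.
Qed.

End euler_error.

(** * Laws and independence *)

Lemma ge0_integral_law {d : measure_display} {T : measurableType d}
    {R : realType} (P : probability T R) (V : T -> measurableTypeR R)
    (N : probability (measurableTypeR R) R) (f : measurableTypeR R -> \bar R) :
  measurable_fun setT V -> (forall B, measurable B -> P (V @^-1` B) = N B) ->
  measurable_fun setT f -> (forall v, (0 <= f v)%E) ->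
  (\int[P]_w f (V w) = \int[N]_v f v)%E.
Proof.
move=> mV hN mf f0.
pose V' : {mfun T >-> measurableTypeR R} :=
  HB.pack V (isMeasurableFun.Build _ _ _ _ _ mV).
transitivity (\int[distribution P V']_v f v)%E.
  by rewrite ge0_integral_distribution.
by apply: eq_measure_integral => B mB _; exact: hN.
Qed.

Section freezing.
Local Open Scope ereal_scope.
Context {d : measure_display} {T : measurableType d} {R : realType}.
Variables (P : probability T R) (G : set (set T)) (V : T -> R).
Variable N : probability (measurableTypeR R) R.
Hypotheses (sG : sigma_algebra setT G) (GT : G `<=` measurable).
Hypotheses (mV : measurable_fun setT V).
Hypothesis indep : forall A B, G A -> measurable B ->
  P (A `&` V @^-1` B) = P A * N B.

Local Notation TG := (g_sigma_algebraType G).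

Lemma measurable_g_sigma_id : measurable_fun setT (id : T -> TG).
Proof.
move=> _ A mA; rewrite setTI; apply: GT.
by have : <<s G >> A by []; rewrite sigma_algebra_id.
Qed.

Lemma measurable_fun_g_sigma (f : TG -> R) :
  measurable_fun setT f -> measurable_fun setT (f : T -> R).
Proof. by move=> mf; apply: (measurableT_comp mf measurable_g_sigma_id). Qed.

(** Conditioning on a sigma-algebra independent of [V] amounts to integrating
[V] out with everything else frozen: the joint law of the identity into [G] and
[V] is a product measure. *)
Lemma ge0_integral_freezing (f : TG * measurableTypeR R -> \bar R) :
  measurable_fun setT f -> (forall z, 0 <= f z) ->
  \int[P]_w f (w, V w) = \int[P]_w \int[N]_v f (w, v).
Proof.
move=> mf f0.
have mid := measurable_g_sigma_id.
pose idG : {mfun T >-> TG} := HB.pack (id : T -> TG) (isMeasurableFun.Build _ _ _ _ _ mid).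
have mp : measurable_fun setT (fun w => (w, V w) : TG * measurableTypeR R).
  exact: measurable_fun_pair.
pose pr : {mfun T >-> (TG * measurableTypeR R)%type} := HB.pack (fun w => (w, V w) : TG * measurableTypeR R) (isMeasurableFun.Build _ _ _ _ _ mp).
transitivity (\int[distribution P pr]_z f z); first by rewrite ge0_integral_distribution.
rewrite (eq_measure_integral (distribution P idG \x N)).
  rewrite fubini_tonelli1// ge0_integral_distribution//.
    exact: measurable_fun_fubini_tonelli_F.
  by move=> w; apply: integral_ge0.
move=> X mX _; apply/esym; apply: product_measure_unique => // A B mA mB.
rewrite -indep//.
by have : <<s G >> A by []; rewrite sigma_algebra_id.
Qed.

End freezing.

(** * Geometric Brownian motion and its Euler sums *)

(** Geometric Brownian motion started at 1, with drift [b] and volatility [c]. *)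
Definition gbm {R : realType} {T : Type} (b c : R) (W : R -> T -> R) (t : R)
    (w : T) : R :=
  expR ((b - c ^+ 2 / 2) * t + c * W t w).

Section gbm.
Context {d : measure_display} {T : measurableType d} {R : realType}.
Variables (P : probability T R) (F : R -> set (set T)) (W : R -> T -> R).
Hypothesis hW : brownian_motion P F W.
Variables (b c : R).
Local Notation X := (gbm b c W).
Local Notation TF t := (g_sigma_algebraType (F t)).

Let sF t : 0 <= t -> sigma_algebra setT (F t).
Proof. by move=> t0; have [[h _] _ _ _ _] := hW; have [] := h _ t0. Qed.

Let FT t : 0 <= t -> F t `<=` measurable.
Proof. by move=> t0; have [[h _] _ _ _ _] := hW; have [] := h _ t0. Qed.

Let measurable_W_adapted s t : 0 <= s -> s <= t ->
  measurable_fun setT (W s : TF t -> R).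
Proof.
move=> s0 st _ B mB; rewrite setTI; have [[_ h] ad _ _ _] := hW.
by apply: sub_sigma_algebra; apply: (h _ _ s0 st); exact: ad.
Qed.

Lemma measurable_brownian t : 0 <= t -> measurable_fun setT (W t).
Proof.
move=> t0; apply: (@measurable_fun_g_sigma _ _ _ (F t)).
- exact: sF.
- exact: FT.
- exact: measurable_W_adapted.
Qed.

Let measurable_gbm_adapted s t : 0 <= s -> s <= t ->
  measurable_fun setT (X s : TF t -> R).
Proof.
move=> s0 st; apply: measurableT_comp => //; apply: measurable_funD => //.
by apply: measurable_funM => //; exact: measurable_W_adapted.
Qed.

Lemma measurable_gbm t : 0 <= t -> measurable_fun setT (X t).
Proof.
move=> t0; apply: measurableT_comp => //; apply: measurable_funD => //.
by apply: measurable_funM => //; exact: measurable_brownian.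
Qed.

Lemma gbm_adapted : adapted F X.
Proof.
move=> t t0 B mB; have := measurable_gbm_adapted t0 (lexx t) measurableT mB.
by rewrite setTI /measurable/= sigma_algebra_id//; exact: sF.
Qed.

Lemma gbm_gt0 t w : 0 < X t w. Proof. exact: expR_gt0. Qed.

Lemma gbm_continuous : continuous_paths X.
Proof.
move=> w; have [_ _ cW _ _] := hW => x.
have idc : {within `[(0:R), +oo[, continuous (id : R -> R)}.
  by apply: continuous_subspaceT => y; exact: cvg_id.
apply: (@continuous_comp (subspace `[(0:R), +oo[) R R
  (fun t => (b - c ^+ 2 / 2) * t + c * W t w) expR); last exact: continuous_expR.
apply: cvgD; apply: cvgM; try exact: cvg_cst; first exact: idc.
exact: cW.
Qed.

Lemma ge0_integral_increment s t (f : R -> \bar R) :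
  0 <= s -> s < t -> measurable_fun setT f -> (forall v, (0 <= f v)%E) ->
  (\int[P]_w f (W t w - W s w)%R =
   \int[normal_prob 0 (Num.sqrt (t - s))]_v f v)%E.
Proof.
move=> s0 st mf f0; have [_ _ _ _ h] := hW; have [hN _] := h _ _ s0 st.
have mV : measurable_fun setT (fun w => W t w - W s w).
  by apply: measurable_funB; apply: measurable_brownian => //; rewrite (le_trans s0)// ltW.
by apply: (@ge0_integral_law _ _ _ P (fun w => W t w - W s w)
  (normal_prob 0 (Num.sqrt (t - s)))).
Qed.

Let aeW0 : {ae P, forall w, W 0 w = 0}.
Proof. by have [_ _ _ h _] := hW. Qed.

Lemma ge0_integral_brownian t (f : R -> \bar R) :
  0 < t -> measurable_fun setT f -> (forall v, (0 <= f v)%E) ->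
  (\int[P]_w f (W t w) = \int[normal_prob 0 (Num.sqrt t)]_v f v)%E.
Proof.
move=> t0 mf f0; rewrite -[t in Num.sqrt t]subr0 -ge0_integral_increment//.
have mW := measurable_brownian (ltW t0).
apply: ae_eq_integral => //.
- exact: measurableT_comp.
- apply: measurableT_comp => //; apply: measurable_funB => //.
  exact: measurable_brownian.
- by apply: filterS aeW0 => w W0 _; rewrite W0 subr0.
Qed.

Lemma gbm_sqr_le t u : 0 <= u -> u <= t ->
  (\int[P]_w (X u w ^+ 2)%:E <= (expR (`|2 * (b - c ^+ 2 / 2) + 2 * c ^+ 2| * t))%:E)%E.
Proof.
move=> u0 ut.
have X2 w : X u w ^+ 2 = expR (2 * (b - c ^+ 2 / 2) * u) * expR (2 * c * W u w).
  by rewrite /gbm -expRM_natl -expRD mulrDr !mulrA.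
have le1 : expR ((2 * (b - c ^+ 2 / 2) + 2 * c ^+ 2) * u) <=
    expR (`|2 * (b - c ^+ 2 / 2) + 2 * c ^+ 2| * t).
  by rewrite ler_expR; apply: (le_trans (ler_wpM2r u0 (ler_norm _))); rewrite ler_wpM2l.
have m2 (a : R) : measurable_fun setT (fun v : R => (expR (a * v))%:E).
  by apply/measurable_EFinP; exact: measurable_expRM.
apply: (@le_trans _ _ (expR ((2 * (b - c ^+ 2 / 2) + 2 * c ^+ 2) * u))%:E); last by rewrite lee_fin.
rewrite le_eqVlt; apply/orP; left; apply/eqP.
under eq_integral do rewrite X2 EFinM.
have [u00|un0] := eqVneq u 0.
  transitivity (\int[P]_w (cst 1%E w))%E.
    apply: ae_eq_integral => //.
    - apply: emeasurable_funM => //.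
      by apply: measurableT_comp (m2 _) _; exact: measurable_brownian.
    - by apply: filterS aeW0 => w; rewrite u00 => -> _; rewrite !mulr0 expR0 mul1e.
  rewrite integral_cst// mul1e u00 mulr0 expR0.
  exact: (probability_setT P).
have {un0}u0 : 0 < u by rewrite lt_neqAle eq_sym un0.
rewrite ge0_integralZl//; last first.
  by apply: measurableT_comp (m2 _) _; apply: measurable_brownian; exact: ltW.
rewrite (@ge0_integral_brownian u (fun v => (expR (2 * c * v))%:E))//.
rewrite normal_mgf ?gt_eqF ?sqrtr_gt0// sqr_sqrtr ?(ltW u0)// -EFinM -expRD.
by congr (expR _)%:E; field.
Qed.

Let normal_affine_sqr (a x e C : R) : 0 < e ->
  (\int[normal_prob 0 (Num.sqrt e)]_v ((euler_error b c e v) ^+ 2)%:E <= C%:E)%E ->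
  (\int[normal_prob 0 (Num.sqrt e)]_v ((a + x * euler_error b c e v) ^+ 2)%:E
    <= (a ^+ 2)%:E + C%:E * (x ^+ 2)%:E)%E.
Proof.
move=> e0 hC; have [i1 i0] := euler_error_mean0 b c e0.
set N := normal_prob 0 (Num.sqrt e).
have m1 : measurable_fun setT (euler_error b c e) by exact: measurable_euler_error.
have i2 : N.-integrable setT (fun v => (euler_error b c e v ^+ 2)%:E).
  apply/integrableP; split.
    by apply/measurable_EFinP; exact: measurable_funX.
  under eq_integral do rewrite gee0_abs ?lee_fin ?sqr_ge0//.
  by rewrite (le_lt_trans hC)// ltry.
have j0 : N.-integrable setT (cst (a ^+ 2)%:E).
  exact: finite_measure_integrable_cst.
have j1 : N.-integrable setT (fun v => (2 * a * x)%:E * (euler_error b c e v)%:E)%E.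
  exact: integrableZl.
have j2 : N.-integrable setT (fun v => (x ^+ 2)%:E * (euler_error b c e v ^+ 2)%:E)%E.
  exact: integrableZl.
have NT : (\int[N]_v (a ^+ 2)%:E = (a ^+ 2)%:E)%E.
  rewrite integral_cst//; set p := (X in (_ * X)%E).
  by rewrite (_ : p = 1%E) ?mule1//; exact: (probability_setT N).
rewrite (_ : (fun v => ((a + x * euler_error b c e v) ^+ 2)%:E) =
  (fun v => (a ^+ 2)%:E + ((2 * a * x)%:E * (euler_error b c e v)%:E +
   (x ^+ 2)%:E * (euler_error b c e v ^+ 2)%:E))%E); last first.
  by apply/funext => v; rewrite -!EFinM -!EFinD; congr EFin; ring.
rewrite integralD//; last exact: integrableD.
rewrite integralD// !integralZl// i0 mule0 add0e NT leeD2l// muleC.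
by rewrite lee_wpmul2r// lee_fin sqr_ge0.
Qed.

Definition euler_sum (tau : nat -> R) n w :=
  \sum_(i < n) X (tau i) w *
    euler_error b c (tau i.+1 - tau i) (W (tau i.+1) w - W (tau i) w).

Let euler_sumS tau n w : euler_sum tau n.+1 w = euler_sum tau n w +
  X (tau n) w * euler_error b c (tau n.+1 - tau n) (W (tau n.+1) w - W (tau n) w).
Proof. by rewrite /euler_sum big_ord_recr. Qed.

(** The step factors multiply up to the process, whose increments telescope; what
is left of the compensators is a sum that approximates the drift integral. *)
Lemma euler_sumE tau n w : euler_sum tau n w =
  \sum_(i < n) c * X (tau i) w * (W (tau i.+1) w - W (tau i) w)
  - (X (tau n) w - X (tau 0%N) w)
  + \sum_(i < n) X (tau i) w * (expR (b * (tau i.+1 - tau i)) - 1).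
Proof.
elim: n => [|n IH]; first by rewrite /euler_sum !big_ord0 subrr subr0 addr0.
rewrite euler_sumS IH !big_ord_recr/= /euler_error.
have -> : expR ((b - c ^+ 2 / 2) * (tau n.+1 - tau n) +
    c * (W (tau n.+1) w - W (tau n) w)) = X (tau n.+1) w / X (tau n) w.
  by rewrite /gbm -expRB; congr expR; ring.
by field; rewrite gt_eqF// gbm_gt0.
Qed.

Section euler_sum.
Variables (tau : nat -> R) (k : nat) (t : R).
Hypothesis tau0 : forall i, (i <= k)%N -> 0 <= tau i.
Hypothesis tau_nd : forall i, (i < k)%N -> tau i <= tau i.+1.
Hypothesis tau_le : forall i, (i <= k)%N -> tau i <= t.

Let tau_mono i j : (i <= j)%N -> (j <= k)%N -> tau i <= tau j.
Proof.
move=> /subnK <-; elim: (j - i)%N => [|m IH] mk; first by rewrite add0n.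
by rewrite addSn (le_trans (IH _))//; [exact: ltnW|exact: tau_nd].
Qed.

Let measurable_euler_term (s : R) i : (i < k)%N -> tau i.+1 <= s ->
  measurable_fun setT ((fun w => X (tau i) w * euler_error b c
    (tau i.+1 - tau i) (W (tau i.+1) w - W (tau i) w)) : TF s -> R).
Proof.
move=> ik si.
have is_ : tau i <= s by apply: le_trans si; exact: tau_nd.
have i0 : 0 <= tau i by exact/tau0/ltnW.
apply: measurable_funM; first exact: measurable_gbm_adapted.
apply: (@measurableT_comp _ _ _ _ _ _ (euler_error b c _) _
  (fun w : TF s => W (tau i.+1) w - W (tau i) w)).
  exact: measurable_euler_error.
by apply: measurable_funB; apply: measurable_W_adapted => //; exact: tau0.
Qed.

Let measurable_euler_sum_adapted n : (n <= k)%N ->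
  measurable_fun setT (euler_sum tau n : TF (tau n) -> R).
Proof.
move=> nk; apply: measurable_sum => i.
apply: measurable_euler_term; first exact: leq_trans (ltn_ord i) nk.
by apply: tau_mono => //; exact: ltn_ord.
Qed.

Lemma measurable_euler_sum n : (n <= k)%N -> measurable_fun setT (euler_sum tau n).
Proof.
move=> nk; apply: (@measurable_fun_g_sigma _ _ _ (F (tau n))).
- by apply: sF; exact: tau0.
- by apply: FT; exact: tau0.
- exact: measurable_euler_sum_adapted.
Qed.

(** The increments of the sum are centred given the past, so that only their
variances add up. *)
Let euler_sum_step n C : (n < k)%N -> 0 <= C ->
  (forall e, 0 < e -> e <= t ->
    (\int[normal_prob 0 (Num.sqrt e)]_v ((euler_error b c e v) ^+ 2)%:E
    <= (C * e ^+ 2)%:E)%E) ->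
  (\int[P]_w (euler_sum tau n.+1 w ^+ 2)%:E <=
   \int[P]_w (euler_sum tau n w ^+ 2)%:E +
   (C * (tau n.+1 - tau n) ^+ 2)%:E * \int[P]_w (X (tau n) w ^+ 2)%:E)%E.
Proof.
move=> nk C0 hC.
have n0 : 0 <= tau n by apply: tau0; exact: ltnW.
have mS := measurable_euler_sum (ltnW nk).
have mX := measurable_gbm n0.
have iX0 : (0 <= \int[P]_w (X (tau n) w ^+ 2)%:E)%E.
  by apply: integral_ge0 => w _; rewrite lee_fin sqr_ge0.
have := tau_nd nk; rewrite le_eqVlt => /predU1P[tt|tt].
  rewrite (_ : (fun w => (euler_sum tau n.+1 w ^+ 2)%:E) =
      (fun w => (euler_sum tau n w ^+ 2)%:E)).
    by rewrite leeDl// mule_ge0// lee_fin mulr_ge0// sqr_ge0.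
  apply/funext => w; rewrite euler_sumS -tt !subrr /euler_error !mulr0 addr0.
  by rewrite subrr subr0 mulr0 addr0.
set e := tau n.+1 - tau n.
have e0 : 0 < e by rewrite subr_gt0.
have et : e <= t by rewrite lerBlDr (le_trans (tau_le nk))// lerDl.
pose f (z : TF (tau n) * measurableTypeR R) : \bar R :=
  ((euler_sum tau n z.1 + X (tau n) z.1 * euler_error b c e z.2) ^+ 2)%:E.
have mf : measurable_fun setT f.
  apply/measurable_EFinP; apply: measurable_funX; apply: measurable_funD.
    apply: measurableT_comp => //; apply: measurable_euler_sum_adapted.
    exact: ltnW.
  apply: measurable_funM; apply: measurableT_comp => //.
    exact: measurable_gbm_adapted.
  exact: measurable_euler_error.
have f0 z : (0 <= f z)%E by rewrite lee_fin sqr_ge0.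
have -> : (\int[P]_w (euler_sum tau n.+1 w ^+ 2)%:E =
    \int[P]_w f (w, W (tau n.+1) w - W (tau n) w)%R)%E.
  by apply: eq_integral => w _; rewrite euler_sumS.
have [_ _ _ _ hI] := hW; have [hN hind] := hI _ _ n0 tt.
rewrite (@ge0_integral_freezing _ _ _ P (F (tau n)) _
  (normal_prob 0 (Num.sqrt e)) (sF n0) (FT n0))//; first last.
- by move=> A B FA mB; rewrite hind// hN.
- apply: measurable_funB; apply: measurable_brownian => //.
  exact: tau0.
have mX2 : measurable_fun setT (fun w => (X (tau n) w ^+ 2)%:E).
  by apply/measurable_EFinP; exact: measurable_funX.
have mS2 : measurable_fun setT (fun w => (euler_sum tau n w ^+ 2)%:E).
  by apply/measurable_EFinP; exact: measurable_funX.
have sq0 (x : R) : (0 <= (x ^+ 2)%:E)%E by rewrite lee_fin sqr_ge0.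
have Ce0 : (0 <= (C * e ^+ 2)%:E)%E by rewrite lee_fin mulr_ge0// sqr_ge0.
rewrite -ge0_integralZl// -ge0_integralD//; last 2 first.
- by move=> w _; rewrite mule_ge0.
- exact: emeasurable_funM.
apply: ge0_le_integral => //.
- by move=> w _; apply: integral_ge0.
- apply: (@measurableT_comp _ _ _ _ _ _
    (fun w : TF (tau n) => \int[normal_prob 0 (Num.sqrt e)]_v f (w, v))%E
    _ (id : T -> TF (tau n))).
    exact: (@measurable_fun_fubini_tonelli_F _ _ _ _ _ (normal_prob 0 (Num.sqrt e)) f).
  exact: (measurable_g_sigma_id (sF n0) (FT n0)).
- by apply: emeasurable_funD => //; exact: emeasurable_funM.
- move=> w _.
  exact: (@normal_affine_sqr (euler_sum tau n w) (X (tau n) w) e _ e0 (hC e e0 et)).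
Qed.

(** Only the variances of the steps add up, and they are of second order: for a
fine partition the sum of the squared steps is at most [t] times the mesh. *)
Lemma euler_sum_L2 C : 0 <= C ->
  (forall e, 0 < e -> e <= t ->
    (\int[normal_prob 0 (Num.sqrt e)]_v ((euler_error b c e v) ^+ 2)%:E
    <= (C * e ^+ 2)%:E)%E) ->
  (\int[P]_w (euler_sum tau k w ^+ 2)%:E <=
   (C * expR (`|2 * (b - c ^+ 2 / 2) + 2 * c ^+ 2| * t) *
     \sum_(i < k) (tau i.+1 - tau i) ^+ 2)%:E)%E.
Proof.
move=> C0 hC; set M := expR _.
have : forall n, (n <= k)%N -> (\int[P]_w (euler_sum tau n w ^+ 2)%:E <=
   (C * M * \sum_(i < n) (tau i.+1 - tau i) ^+ 2)%:E)%E; last by apply.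
elim=> [_|n IH nk].
  rewrite big_ord0 mulr0 (_ : (fun w => _) = cst 0%E) ?integral0//.
  by apply/funext => w; rewrite /euler_sum big_ord0 expr0n.
rewrite big_ord_recr/= mulrDr EFinD (le_trans (euler_sum_step nk C0 hC))//.
rewrite leeD ?IH ?(ltnW nk)// mulrAC [leRHS]EFinM lee_wpmul2l//.
  by rewrite lee_fin; apply: mulr_ge0 => //; exact: sqr_ge0.
by apply: gbm_sqr_le; [exact/tau0/ltnW|exact/tau_le/ltnW].
Qed.

End euler_sum.
End gbm.

(** * Riemann sums of the drift *)

Lemma segment_unif_continuous {R : realType} (f : R -> R) (a b : R) :
  {within `[a, b], continuous f} -> forall e, 0 < e ->
  exists2 D, 0 < D & forall x y, x \in `[a, b] -> y \in `[a, b] ->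
    `|x - y| < D -> `|f x - f y| < e.
Proof.
move=> /subspace_continuousP cf e e0.
have /compact_near_coveringP/near_covering_withinP cov := @segment_compact R a b.
have e20 : 0 < e / 2 by rewrite divr_gt0.
have near_cov : \forall D \near 0^'+, `[a, b] `<=` (fun x => forall y,
    y \in `[a, b] -> `|x - y| < D -> `|f x - f y| < e).
  apply: cov => x xab; have /cvgrPdist_lt/(_ _ e20) := cf x xab.
  rewrite near_withinE => -[r /= r0 fr].
  have r20 : 0 < r / 2 by rewrite divr_gt0.
  exists (ball x (r / 2), [set D | D < r / 2]); first split => /=.
  - exact: nbhsx_ballx.
  - exact: nbhs_right_lt.
  move=> [x' D] [/= xx' Dr] x'ab y yab x'y.
  have h1 : `|f x - f x'| < e / 2.
    apply: fr => //; apply: (lt_trans xx').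
    by rewrite ltr_pdivrMr// ltr_pMr// ltr1n.
  have h2 : `|f x - f y| < e / 2.
    apply: fr => //=; rewrite (splitr r) (le_lt_trans (ler_distD x' _ _))//.
    by rewrite ltrD// (lt_trans x'y).
  by rewrite (splitr e) (le_lt_trans (ler_distD (f x) _ _))// ltrD// distrC.
near (0 : R)^'+ => D; exists D => // x y xab yab.
by apply: (near near_cov D).
Unshelve. all: by end_near. Qed.

Lemma telescoping_bound {R : realType} (I f : nat -> R) (tau : nat -> R) (K : R) n :
  (forall i, (i < n)%N ->
     `|I i.+1 - I i - f i| <= K * (tau i.+1 - tau i)) ->
  `|I n - I 0%N - \sum_(i < n) f i| <= K * (tau n - tau 0%N).
Proof.
elim: n => [_|n IH h]; first by rewrite big_ord0 !subrr normr0 mulr0.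
rewrite big_ord_recr/=.
rewrite (_ : _ - _ = (I n - I 0%N - \sum_(i < n) f i) + (I n.+1 - I n - f n)); last by ring.
rewrite (le_trans (ler_normD _ _))//.
rewrite (_ : K * _ = K * (tau n - tau 0%N) + K * (tau n.+1 - tau n)); last by ring.
by rewrite lerD// ?h// IH// => i ni; apply: h; rewrite ltnS ltnW.
Qed.

Section riemann_sum.
Context {R : realType}.
Variables (f : R -> R) (b t : R).
Hypotheses (t0 : 0 <= t) (cf : {within `[0, +oo[, continuous f}).
Local Notation mu := (@lebesgue_measure R).

Let cft : {within `[0, t], continuous f}.
Proof.
by apply: continuous_subspaceW cf; apply: subset_itv; rewrite ?bnd_simp.
Qed.

Let int_f s : s <= t -> mu.-integrable `[0, s] (EFin \o f).
Proof.
move=> st; apply: continuous_compact_integrable; first exact: segment_compact.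
by apply: continuous_subspaceW cft; apply: subset_itv; rewrite ?bnd_simp.
Qed.

Let I s := \int[mu]_(u in `[0, s]) (b * f u).

Let increment_bound (e M u v : R) : 0 <= u -> u <= v -> v <= t ->
  `|f u| <= M -> v - u <= e ->
  (forall s, u <= s <= v -> `|f s - f u| <= e) ->
  `|I v - I u - f u * (expR (b * (v - u)) - 1)| <=
  (`|b| + M * b ^+ 2 * expR (`|b| * t)) * e * (v - u).
Proof.
move=> u0 uv vt fM uve osc.
have -> : I v - I u - f u * (expR (b * (v - u)) - 1) =
   (I v - I u - b * f u * (v - u)) -
   f u * (expR (b * (v - u)) - 1 - b * (v - u)) by ring.
have e0 : 0 <= e by apply: le_trans uve; rewrite subr_ge0.
have M0 : 0 <= M := le_trans (normr_ge0 _) fM.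
rewrite (le_trans (ler_normB _ _))// 2!mulrDl lerD//.
- have ibf : mu.-integrable `[0, v] (EFin \o (fun s => b * f s)).
    rewrite (_ : _ \o _ = fun s => (b%:E * (f s)%:E)%E)//.
    by apply: integrableZl => //; exact: int_f.
  rewrite /I Rintegral_itvB ?bnd_simp//.
  have ibf' : mu.-integrable `]u, v] (EFin \o (fun s => b * f s)).
    by apply: integrableS ibf => //; apply: subset_itv; rewrite ?bnd_simp.
  have icst (r : R) : mu.-integrable `]u, v] (EFin \o cst r).
    apply: (@integrableS _ _ _ mu `[u, v]) => //.
      by apply: subset_itv; rewrite ?bnd_simp.
    apply: continuous_compact_integrable; first exact: segment_compact.
    by move=> x; exact: cst_continuous.
  have len : fine (mu `]u, v]) = v - u.
    rewrite lebesgue_measure_itv/= lte_fin; case: ltP => //= uv'.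
    by apply/eqP; rewrite eq_sym subr_eq0 eq_le uv uv'.
  have <- : \int[mu]_(s in `]u, v]) (b * f u) = b * f u * (v - u).
    by rewrite Rintegral_cst// len.
  rewrite -RintegralB//; last exact: icst.
  have idiff : mu.-integrable `]u, v] (EFin \o (fun s => b * f s - b * f u)).
    rewrite (_ : _ \o _ = fun s => ((b * f s)%:E - (b * f u)%:E)%E)//.
    by apply: integrableB => //; exact: icst.
  rewrite (le_trans (le_normr_Rintegral _ _))//.
  rewrite -len -Rintegral_cst//; apply: le_Rintegral => //.
  + exact: integrable_norm.
  + exact: icst.
  + move=> s /=; rewrite in_itv/= => /andP[us sv].
    by rewrite -mulrBr normrM ler_wpM2l// osc// (ltW us) sv.
- rewrite normrM (le_trans (ler_pM _ _ fM (norm_expRB1Bx _)))//.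
  rewrite exprMn normrM (ger0_norm (_ : 0 <= v - u)) ?subr_ge0//.
  have E1 : expR (`|b| * (v - u)) <= expR (`|b| * t).
    by rewrite ler_expR ler_wpM2l// lerBlDr (le_trans vt)// lerDl.
  rewrite [leLHS](_ : _ = M * b ^+ 2 * expR (`|b| * (v - u)) * (v - u) * (v - u)); last by ring.
  apply: ler_wpM2r; first by rewrite subr_ge0.
  apply: ler_pM; rewrite ?subr_ge0//.
    by apply: mulr_ge0; [apply: mulr_ge0 => //; exact: sqr_ge0|exact: expR_ge0].
  by rewrite ler_wpM2l//; apply: mulr_ge0 => //; exact: sqr_ge0.
Qed.

(** As [expR (b * e) - 1] is [b * e] up to a term of second order in [e], these are
Riemann sums of [b * f] in disguise. *)
Lemma cvg_exponential_riemann_sum (k : nat -> nat) (tau : nat -> nat -> R) :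
  vanishing_partitions t k tau ->
  \sum_(i < k N) f (tau N i) * (expR (b * (tau N i.+1 - tau N i)) - 1)
    @[N --> \oo] --> \int[mu]_(u in `[0, t]) (b * f u).
Proof.
move=> [tau_part mesh].
have tau_mono N i j : (i <= j)%N -> (j <= k N)%N -> tau N i <= tau N j.
  move=> /subnK <-; elim: (j - i)%N => [|m IH] mk; first by rewrite add0n.
  have [_ _ nd] := tau_part N.
  by rewrite addSn (le_trans (IH _))//; [exact: ltnW|exact: nd].
have tau_in N i : (i <= k N)%N -> 0 <= tau N i <= t.
  move=> ik; have [z1 z2 _] := tau_part N; rewrite -{1}z1 -z2.
  by rewrite !tau_mono.
have [M Mb] : exists M, forall x, x \in `[0, t] -> `|f x| <= M.
  have /compact_bounded[M [_ mrt]] := continuous_compact cft (@segment_compact R 0 t).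
  exists (M + 1) => x xt; apply: (mrt (M + 1)); first by rewrite ltrDl.
  by exists x.
apply/cvgrPdist_lt => e e0.
set C := (`|b| + M * b ^+ 2 * expR (`|b| * t)).
have M0 : 0 <= M.
  by apply: le_trans (Mb 0 _) => //; rewrite in_itv/= lexx t0.
have C0 : 0 <= C.
  apply: addr_ge0 => //; apply: mulr_ge0; last exact: expR_ge0.
  by apply: mulr_ge0 => //; exact: sqr_ge0.
pose eta := e / ((C + 1) * (t + 1)).
have Ct0 : 0 < (C + 1) * (t + 1) by rewrite mulr_gt0// ltr_wpDl.
have eta0 : 0 < eta by rewrite divr_gt0.
have Ceta : C * eta * t < e.
  rewrite /eta mulrAC mulrA ltr_pdivrMr//.
  rewrite mulrC ltr_pM2l//.
  have -> : (C + 1) * (t + 1) = C * t + (C + t + 1) by ring.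
  by rewrite ltrDl ltr_wpDl// addr_ge0.
have [D D0 hD] := segment_unif_continuous cft eta0.
have m0 : 0 < Num.min D eta by rewrite lt_min D0.
move/cvgrPdist_lt : (mesh) => /(_ _ m0); apply: filterS => N.
rewrite sub0r normrN => hN.
have [z1 z2 nd] := tau_part N.
have step i : (i < k N)%N -> tau N i.+1 - tau N i < Num.min D eta.
  move=> ik; apply: le_lt_trans hN; rewrite (le_trans _ (ler_norm _))//.
  by apply: (@le_bigmax_seq _ _ _ _ 0 (Ordinal ik) xpredT
    (fun i : 'I_(k N) => tau N i.+1 - tau N i)) => //; exact: mem_index_enum.
have I0 : I 0 = 0 by rewrite /I set_itv1 Rintegral_set1.
have := @telescoping_bound _ (fun i => I (tau N i))
  (fun i => f (tau N i) * (expR (b * (tau N i.+1 - tau N i)) - 1)) (tau N)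
  (C * eta) (k N).
rewrite z1 z2 I0 !subr0 => H; apply: le_lt_trans Ceta; apply: H => i ik.
have := step i ik; rewrite lt_min => /andP[sD se].
have /andP[ti0 tit] := tau_in N i (ltnW ik).
have /andP[tj0 tjt] := tau_in N i.+1 ik.
apply: increment_bound => //.
- exact: nd.
- by apply: Mb; rewrite in_itv/= ti0.
- exact: ltW.
- move=> s /andP[s1 s2]; apply/ltW/hD.
  + by rewrite in_itv/= (le_trans ti0)//= (le_trans s2).
  + by rewrite in_itv/= ti0.
  + rewrite ger0_norm ?subr_ge0//; apply: le_lt_trans sD.
    by rewrite lerD2r.
Qed.

End riemann_sum.

(** * Convergence in probability and joint measurability *)

Section convergence_in_probability.
Context {d : measure_display} {T : measurableType d} {R : realType}.
Variable P : probability T R.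
Implicit Types (f g : nat -> T -> R) (F G : T -> R).

Lemma measurable_norm_ge (F : T -> R) (e : R) : measurable_fun setT F ->
  measurable [set w | e <= `|F w|].
Proof.
move=> mF; rewrite -[X in measurable X]setTI.
have -> : [set w | e <= `|F w|] = (fun w => `|F w|) @^-1` `[e, +oo[.
  by apply/seteqP; split=> w /=; rewrite in_itv/= andbT.
by apply: measurableT_comp mF _ _ _ => //.
Qed.

(** Chebyshev's inequality. *)
Lemma cvg_in_prob_sqr f : (forall n, measurable_fun setT (f n)) ->
  (\int[P]_w (f n w ^+ 2)%:E @[n --> \oo] --> 0)%E -> cvg_in_prob P f (cst 0).
Proof.
move=> mf f0 e e0; have e20 : 0 < e ^+ 2 by rewrite exprn_gt0.
apply: (@squeeze_cvge _ _ _ _ (cst 0%E) _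
  (fun n => (e ^+ 2)^-1%:E * \int[P]_w (f n w ^+ 2)%:E)%E); last 2 first.
- exact: cvg_cst.
- by rewrite -(mule0 (e ^+ 2)^-1%:E); apply: cvgeZl.
apply: nearW => n; rewrite measure_ge0/=.
rewrite -(@lee_pmul2l _ (e ^+ 2)%:E)//= muleA -EFinM mulfV ?gt_eqF// mul1e.
under eq_set do rewrite subr0.
have mA := measurable_norm_ge e (mf n).
rewrite -[in leLHS](setIT [set w | _]) -integral_indic// -ge0_integralZl//; last first.
- by rewrite lee_fin ltW.
- exact/measurable_EFinP.
apply: ge0_le_integral => //.
- by move=> w _; rewrite -EFinM lee_fin mulr_ge0// ltW.
- by apply: emeasurable_funM => //; exact/measurable_EFinP.
- by apply/measurable_EFinP; exact: measurable_funX.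
move=> w _; rewrite -EFinM lee_fin indicE.
have [/set_mem/= ew|_] := boolP (w \in _); last by rewrite mulr0 sqr_ge0.
by rewrite mulr1 -[leRHS]real_normK ?num_real// ler_sqr ?nnegrE// ltW.
Qed.

(** Dominated convergence of the indicators of the deviations. *)
Lemma cvg_in_prob_ae f : (forall n, measurable_fun setT (f n)) ->
  {ae P, forall w, f n w @[n --> \oo] --> 0} -> cvg_in_prob P f (cst 0).
Proof.
move=> mf f0 e e0.
have mA n := measurable_norm_ge e (mf n).
have [] := @dominated_convergence _ _ _ P setT measurableT
  (fun n w => (\1_([set w | e <= `|f n w|]) w)%:E) (cst 0%E) (cst 1%E).
- by move=> n; exact/measurable_EFinP.
- exact: measurable_cst.
- apply: filterS f0 => w fw _; apply: cvg_near_cst.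
  move/cvgr0Pnorm_lt : fw => /(_ _ e0); apply: filterS => n fe.
  by rewrite indicE memNset//= => /le_lt_trans/(_ fe); rewrite ltxx.
- exact: finite_measure_integrable_cst.
- by apply: aeW => w n _; rewrite gee0_abs ?lee_fin.
- move=> _ _; rewrite integral0.
  apply: cvg_trans; apply: near_eq_cvg; apply: nearW => n /=.
  rewrite integral_indic// setIT; congr (P _).
  by apply/seteqP; split => w /=; rewrite subr0.
Qed.

Lemma cvg_in_probD f g : (forall n, measurable_fun setT (f n)) ->
  (forall n, measurable_fun setT (g n)) ->
  cvg_in_prob P f (cst 0) -> cvg_in_prob P g (cst 0) ->
  cvg_in_prob P (fun n w => f n w + g n w) (cst 0).
Proof.
move=> mf mg f0 g0 e e0; have e20 : 0 < e / 2 by rewrite divr_gt0.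
apply: (@squeeze_cvge _ _ _ _ (cst 0%E) _
  (fun n => P [set w | (e / 2 <= `|f n w - 0|)%R] + P [set w | (e / 2 <= `|g n w - 0|)%R])%E);
  last 2 first.
- exact: cvg_cst.
- by rewrite -(adde0 0%E); apply: cvgeD => //; [exact: f0|exact: g0].
apply: nearW => n; rewrite measure_ge0/=.
have m1 : measurable [set w | e / 2 <= `|f n w - 0|].
  by under eq_set do rewrite subr0; exact: measurable_norm_ge.
have m2 : measurable [set w | e / 2 <= `|g n w - 0|].
  by under eq_set do rewrite subr0; exact: measurable_norm_ge.
have m3 : measurable [set w | e <= `|f n w + g n w - 0|].
  under eq_set do rewrite subr0.
  by apply: measurable_norm_ge; exact: measurable_funD.
rewrite (le_trans _ (measureU2 _ m1 m2))// le_measure ?inE//; first exact: measurableU.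
move=> w /=; rewrite !subr0 => ew.
have [h|h] := leP (e / 2) `|f n w|; [by left|right].
rewrite leNgt; apply/negP => h'.
move: ew; rewrite leNgt => /negP; apply.
by rewrite (le_lt_trans (ler_normD _ _))// [e]splitr ltrD.
Qed.

Lemma eq_cvg_in_prob f F g : (forall n w, g n w = f n w - F w) ->
  cvg_in_prob P g (cst 0) -> cvg_in_prob P f F.
Proof.
move=> gE g0 e e0; have := g0 e e0.
by under eq_fun do under eq_set do rewrite /= subr0 gE.
Qed.

End convergence_in_probability.

(** A family that is continuous in time and measurable at each time is jointly
measurable, as the limit of its discretisations in time. *)
Lemma measurable_continuous_paths {d : measure_display} {T : measurableType d}
    {R : realType} (W : R -> T -> R) :
  (forall t, 0 <= t -> measurable_fun setT (W t)) -> continuous_paths W ->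
  measurable_fun setT (fun p : measurableTypeR R * T => W (Num.max p.1 0) p.2).
Proof.
move=> mW cW.
pose K n (t : R) := Num.truncn (n.+1%:R * Num.max t 0).
have mK n : measurable_fun setT (fun t : R => (K n t)%:R : R).
  apply: nondecreasing_measurable => // x y xy.
  rewrite ler_nat le_truncn// ler_wpM2l// ge_max !le_max xy/=.
  by rewrite lexx !orbT.
apply: (@measurable_fun_cvg _ _ _ _
  (fun n (p : measurableTypeR R * T) => W ((K n p.1)%:R / n.+1%:R) p.2)).
- move=> n _ Y mY; rewrite setTI.
  have -> : (fun p : measurableTypeR R * T => W ((K n p.1)%:R / n.+1%:R) p.2) @^-1` Y =
    \bigcup_k (((fun t : measurableTypeR R => (K n t)%:R : R) @^-1` [set k%:R]) `*`
      (W (k%:R / n.+1%:R) @^-1` Y)).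
    apply/seteqP; split => [[t w] /= Yw|[t w] [k _ [/= -> Yw]]//].
    by exists (K n t).
  apply: bigcup_measurable => k _; apply: measurableX.
    by rewrite -[X in measurable X]setTI; exact: mK.
  by rewrite -[X in measurable X]setTI; apply: mW.
- move=> [t w] _ /=; set s := Num.max t 0.
  have s0 : 0 <= s by rewrite le_max lexx orbT.
  have s_in : `[(0:R), +oo[%classic s by rewrite /= in_itv/= s0.
  have /subspace_continuousP/(_ s s_in) := cW w.
  pose a n := (K n t)%:R / n.+1%:R : R.
  have a_s : a n @[n --> \oo] --> s.
    apply/cvgrPdist_lt => e e0.
    have := near_infty_natSinv_lt (PosNum e0); apply: filterS => n /= ne.
    have ns0 : 0 <= n.+1%:R * s by rewrite mulr_ge0.
    have /andP[h1 h2] := truncn_itv ns0.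
    have n0 : 0 < n.+1%:R :> R by [].
    rewrite /a (_ : K n t = Num.truncn (n.+1%:R * s))//.
    have -> : s - (Num.truncn (n.+1%:R * s))%:R / n.+1%:R =
      (n.+1%:R * s - (Num.truncn (n.+1%:R * s))%:R) / n.+1%:R.
      by field; rewrite gt_eqF.
    rewrite ger0_norm ?divr_ge0 ?subr_ge0// (le_lt_trans _ ne)//.
    rewrite ler_pdivrMr// mulVf ?gt_eqF// lerBlDl natr1.
    exact: ltW.
  move=> h; apply: (cvg_comp a (W ^~ w) _ h) => U /= sU.
  have : \forall n \near \oo, `[(0:R), +oo[%classic (a n) -> U (a n) := a_s _ sU.
  apply: filterS => n; apply.
  by rewrite /= in_itv/= andbT /a divr_ge0.
Qed.

(** * Geometric Brownian motion solves the equation *)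

Section gbm_sde.
Context {d : measure_display} {T : measurableType d} {R : realType}.
Variables (P : probability T R) (F : R -> set (set T)) (W : R -> T -> R).
Hypothesis hW : brownian_motion P F W.
Variables (b c : R).
Local Notation X := (gbm b c W).
Local Notation mu := (@lebesgue_measure R).

Lemma measurable_gbm_joint :
  measurable_fun setT (fun p : measurableTypeR R * T => X (Num.max p.1 0) p.2).
Proof.
have [_ _ cW _ _] := hW.
apply: measurableT_comp => //; apply: measurable_funD.
  by apply: measurable_funM => //; apply: measurable_maxr.
apply: measurable_funM => //.
exact: (measurable_continuous_paths (measurable_brownian hW) cW).
Qed.

Lemma measurable_int_gbm t : measurable_fun setT
  (fun w => \int[mu]_(s in `[0, t]) (b * X s w)).
Proof.
have mX : measurable_fun setT (fun z : T * measurableTypeR R =>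
    (((fun s => X (Num.max s 0) z.1) \_ `[0, t]) z.2)%:E).
  rewrite (_ : (fun z => _) = (fun z : T * measurableTypeR R =>
    ((\1_(`[0, t]%classic : set R) z.2) * X (Num.max z.2 0) z.1)%:E)); last first.
    apply/funext => z; rewrite patchE indicE.
    by case: ifPn => _; rewrite ?mul1r ?mul0r.
  apply/measurable_EFinP; apply: measurable_funM.
    exact: measurableT_comp.
  exact: (measurableT_comp measurable_gbm_joint (@measurable_swap _ _ _ _)).
have X0 (z : T * measurableTypeR R) :
    (0 <= (((fun s => X (Num.max s 0) z.1) \_ `[0%R, t]) z.2)%:E)%E.
  by rewrite lee_fin patchE; case: ifPn => // _; exact/ltW/gbm_gt0.
have := measurable_fun_fubini_tonelli_F (m2 := mu) _ mX X0.
rewrite /fubini_F /= => mI.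
have -> : (fun w => \int[mu]_(s in `[0, t]) (b * X s w)) =
  (fun w => b * fine (\int[mu]_s ((((fun s => X (Num.max s 0) w) \_ `[0%R, t]) s)%:E))%E).
  apply/funext => w; rewrite RintegralZl//; last first.
    apply: continuous_compact_integrable; first exact: segment_compact.
    apply: continuous_subspaceW (gbm_continuous hW (b:=b) (c:=c) (w:=w)).
    by apply: subset_itv; rewrite ?bnd_simp.
  congr (_ * _); rewrite Rintegral_mkcond /Rintegral; congr fine.
  apply: eq_integral => s _; rewrite !patchE; case: ifPn => //.
  by rewrite inE/= in_itv/= => /andP[s0 _]; rewrite max_l.
apply: measurable_funM => //.
exact: (measurableT_comp _ mI).
Qed.

Let aeX0 : {ae P, forall w, X 0 w = 1}.
Proof.
have [_ _ _ h _] := hW; apply: filterS h => w h.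
by rewrite /gbm h !mulr0 addr0 expR0.
Qed.

(** By [euler_sumE] the left-endpoint sums miss the claimed integral by an Euler
sum, which vanishes in mean square, and by the error of a Riemann sum, which
vanishes path by path. *)
Lemma gbm_ito_integral t : 0 <= t ->
  ito_integral P W (fun s w => c * X s w) t
    (fun w => X t w - 1 - \int[mu]_(s in `[0, t]) (b * X s w)).
Proof.
move=> t0 k tau part; have [tau_part mesh] := part.
have tau_mono N i j : (i <= j)%N -> (j <= k N)%N -> tau N i <= tau N j.
  move=> /subnK <-; elim: (j - i)%N => [|m IH] mk; first by rewrite add0n.
  have [_ _ nd] := tau_part N.
  by rewrite addSn (le_trans (IH _))//; [exact: ltnW|exact: nd].
have tau_ge0 N i : (i <= k N)%N -> 0 <= tau N i.
  by move=> ik; have [z1 _ _] := tau_part N; rewrite -z1 tau_mono.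
have tau_le N i : (i <= k N)%N -> tau N i <= t.
  by move=> ik; have [_ z2 _] := tau_part N; rewrite -z2 tau_mono.
have tau_nd N i : (i < k N)%N -> tau N i <= tau N i.+1.
  by have [_ _ nd] := tau_part N => /nd.
pose E N := euler_sum W b c (tau N) (k N).
pose Q N w := 1 - X 0 w + (\int[mu]_(s in `[0, t]) (b * X s w) -
  \sum_(i < k N) X (tau N i) w * (expR (b * (tau N i.+1 - tau N i)) - 1)).
have mE N : measurable_fun setT (E N).
  by apply: (measurable_euler_sum hW) (leqnn _); [exact: tau_ge0|exact: tau_nd].
have mX s : 0 <= s -> measurable_fun setT (X s).
  by move=> s0; apply: (measurable_gbm hW).
have mQ N : measurable_fun setT (Q N).
  apply: measurable_funD; first by apply: measurable_funB => //; exact: mX.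
  apply: measurable_funB; first exact: measurable_int_gbm.
  apply: measurable_sum => i; apply: measurable_funM => //.
  by apply/mX/tau_ge0/ltnW.
apply: (@eq_cvg_in_prob _ _ _ _ _ _ (fun N w => E N w + Q N w)).
  move=> N w; have [z1 z2 _] := tau_part N.
  by rewrite /E euler_sumE z1 z2 /Q; ring.
apply: cvg_in_probD => //.
- apply: cvg_in_prob_sqr => //.
  have [C [C0 hC]] := euler_error_sqr b c t.
  pose M := expR (`|2 * (b - c ^+ 2 / 2) + 2 * c ^+ 2| * t).
  pose m N := \big[Num.max/0]_(i < k N) (tau N i.+1 - tau N i).
  apply: (@squeeze_cvge _ _ _ _ (cst 0%E) _ (fun N => (C * M * (m N * t))%:E)); last 2 first.
  + exact: cvg_cst.
  + apply/cvg_EFin; first exact: nearW.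
    rewrite (_ : 0 = C * M * (0 * t)); last by rewrite mul0r mulr0.
    by apply: cvgM; [exact: cvg_cst|apply: cvgM; [exact: mesh|exact: cvg_cst]].
  apply: nearW => N; apply/andP; split.
    by apply: integral_ge0 => w _; rewrite lee_fin sqr_ge0.
  apply: (le_trans (euler_sum_L2 hW (@tau_ge0 N) (@tau_nd N) (@tau_le N) C0 hC)).
  rewrite lee_fin; apply: ler_wpM2l; first by apply: mulr_ge0 => //; exact: expR_ge0.
  have [z1 z2 nd] := tau_part N.
  have tE : t = \sum_(i < k N) (tau N i.+1 - tau N i).
    by rewrite -(big_mkord xpredT (fun i => tau N i.+1 - tau N i)) telescope_sumr// z1 z2 subr0.
  rewrite tE mulr_sumr; apply: ler_sum => i _; rewrite expr2.
  rewrite ler_wpM2r ?subr_ge0 ?nd//.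
  by apply: (@le_bigmax_seq _ _ _ _ 0 i xpredT
    (fun i : 'I_(k N) => tau N i.+1 - tau N i)) => //; exact: mem_index_enum.
- apply: cvg_in_prob_ae => //; apply: filterS aeX0 => w X0.
  rewrite /Q X0 subrr; under eq_fun do rewrite add0r.
  have := @cvg_exponential_riemann_sum _ (X ^~ w) b t t0 (@gbm_continuous _ _ _ P F W hW b c w) _ _ part.
  set I := (X in _ --> X -> _) => /(cvgB (cvg_cst I)).
  by rewrite subrr; apply.
Qed.

End gbm_sde.

Lemma gbm_solves_sde {d : measure_display} {T : measurableType d} {R : realType}
    (P : probability T R) (F : R -> set (set T)) (W : R -> T -> R) (b sigma : R) :
  brownian_motion P F W ->
  solves_sde P b sigma F W 1 (gbm b (Num.sqrt 2 * sigma) W).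
Proof.
move=> hW; split.
- exact: (gbm_adapted hW).
- exact: (gbm_continuous hW).
- by move=> t w _; exact: gbm_gt0.
- have [_ _ _ h _] := hW; apply: filterS h => w h.
  by rewrite /gbm h !mulr0 addr0 expR0.
- move=> t t0; exists (fun w => gbm b (Num.sqrt 2 * sigma) W t w - 1 -
    \int[lebesgue_measure]_(s in `[0, t]) (b * gbm b (Num.sqrt 2 * sigma) W s w)).
  split.
  + apply: measurable_funB; last exact: (measurable_int_gbm hW).
    by apply: measurable_funB => //; exact: (measurable_gbm hW).
  + exact: (gbm_ito_integral hW b (Num.sqrt 2 * sigma) t0).
  + by apply: aeW => w; ring.
Qed.

(** * Real powers and monotone functions *)

Section power_functions.
Context {R : realType}.
Local Notation mu := (@lebesgue_measure R).
Implicit Types (p q x y s : R).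

Lemma continuous_powR p x : 0 < x -> {for x, continuous (fun u : R => u `^ p)}.
Proof.
move=> x0; have h := is_derive1_powR p x0.
by apply: (@differentiable_continuous _ R R); apply/derivable1_diffP/(@ex_derive _ _ _ _ _ _ _ h).
Qed.

Lemma within_continuous_powR p x y : 0 < x -> {within `[x, y], continuous (fun u : R => u `^ p)}.
Proof.
move=> x0; apply: continuous_in_subspaceT => s /set_mem/=.
by rewrite in_itv/= => /andP[xs _]; apply: continuous_powR; exact: lt_le_trans xs.
Qed.

Lemma powRDp (x p q : R) : 0 < x -> x `^ (p + q) = x `^ p * x `^ q.
Proof. by move=> x0; rewrite powRD// (gt_eqF x0) implybT. Qed.

Lemma powRxN p x : 0 < x -> x `^ p * x `^ (- p) = 1.
Proof. by move=> x0; rewrite -powRDp// subrr powRr0. Qed.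

Lemma powRB1 p x : 0 < x -> x `^ (p - 1) = x^-1 * x `^ p.
Proof. by move=> x0; rewrite powRDp// powR_inv1 ?(ltW x0)// mulrC. Qed.

Lemma powRNV x q : 0 < x -> x^-1 `^ (- q) = x `^ q.
Proof. by move=> x0; rewrite -powR_inv1 ?(ltW x0)// -powRrM mulN1r opprK. Qed.

Lemma integral_powR_segment p x y : p != 0 -> 0 < x -> x <= y ->
  (\int[mu]_(s in `[x, y]) (s `^ (p - 1))%:E = ((y `^ p - x `^ p) / p)%:E)%E.
Proof.
move=> p0 x0; rewrite le_eqVlt => /predU1P[<-|xy].
  by rewrite set_itv1 integral_set1 subrr mul0r.
have dF s : 0 < s -> is_derive s 1 (fun u : R => p^-1 * u `^ p) (s `^ (p - 1)).
  move=> s0; have h := is_derive1_powR p s0.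
  have -> : s `^ (p - 1) = p^-1 *: (p * s `^ (p - 1)).
    by rewrite scalerA mulVf// scale1r.
  exact: is_deriveZ.
rewrite (@continuous_FTC2 _ _ (fun s => p^-1 * s `^ p))//.
- by rewrite -EFinB -mulrBr mulrC.
- exact: within_continuous_powR.
- have cF s : 0 < s -> {for s, continuous (fun u : R => p^-1 * u `^ p)}.
    by move=> s0; apply: cvgM; [exact: cvg_cst|exact: continuous_powR].
  split.
  + move=> s; rewrite in_itv/= => /andP[xs _].
    exact: (@ex_derive _ _ _ _ _ _ _ (dF _ (lt_trans x0 xs))).
  + by apply: cvg_at_right_filter; exact: cF.
  + by apply: cvg_at_left_filter; apply: cF; exact: lt_trans xy.
- move=> s; rewrite in_itv/= => /andP[xs _].
  by rewrite derive1E (@derive_val _ _ _ _ _ _ _ (dF _ (lt_trans x0 xs))).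
Qed.

Lemma cvg_powR_harmonic p : 0 < p -> (k.+1%:R^-1 : R) `^ p @[k --> \oo] --> 0.
Proof.
move=> p0; have /cvg_at_rightP h := powR_cvg0 p0.
by apply: (h (fun k => k.+1%:R^-1)); split => //; exact: cvg_harmonic.
Qed.

Lemma measurable_powR_fun p (D : set R) : measurable_fun D (fun u : R => u `^ p).
Proof. by apply: measurable_funTS; exact: measurable_powR. Qed.

(* Both improper integrals are limits of integrals over segments whose moving
   endpoint is [x / k.+1] or [x * k.+1]. *)
Lemma integral_powR_0 p x : 0 < p -> 0 < x ->
  (\int[mu]_(s in `]0%R, x]) (s `^ (p - 1))%:E = (x `^ p / p)%:E)%E.
Proof.
move=> p0 x0; pose F (k : nat) := `[x * k.+1%:R^-1, x]%classic : set R.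
have -> : `]0, x]%classic = \bigcup_k F k.
  apply/seteqP; split=> [s /=|s [k _]].
    rewrite in_itv/= => /andP[s0 sx].
    exists (Num.truncn (x / s)) => //; rewrite /F/= in_itv/= sx andbT.
    by rewrite ler_pdivrMr// mulrC -ler_pdivrMr// ltW// truncnS_gt.
  rewrite /F/= !in_itv/= => /andP[ks ->]; rewrite andbT.
  by apply: lt_le_trans ks; rewrite mulr_gt0// invr_gt0.
have ndF : nondecreasing_seq F.
  move=> i j ij; apply/subsetPset; rewrite /F; apply: subset_itvr; rewrite bnd_simp.
  by rewrite ler_pM2l// lef_pV2 ?posrE// ler_nat ltnS.
have h : (\int[mu]_(s in F k) (s `^ (p - 1))%:E @[k --> \oo] --> (x `^ p / p)%:E)%E.
  under eq_fun => k.
    rewrite /F integral_powR_segment ?gt_eqF ?mulr_gt0 ?invr_gt0//; last first.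
      by rewrite ler_piMr ?(ltW x0)// invf_le1// ler1n.
    rewrite powRM ?invr_ge0 ?(ltW x0)//.
    over.
  apply/cvg_EFin; first exact: nearW.
  have -> : x `^ p / p = (x `^ p - x `^ p * 0) / p by rewrite mulr0 subr0.
  apply: cvgM; last exact: cvg_cst.
  apply: cvgB; first exact: cvg_cst.
  by apply: cvgM; [exact: cvg_cst|exact: cvg_powR_harmonic].
apply: (cvg_unique (@ereal_hausdorff R) _ h) => /=.
apply: (@ge0_nondecreasing_set_cvg_integral _ (measurableTypeR R) R F
  (fun s => (s `^ (p - 1))%:E) mu ndF).
- by move=> k; exact: measurable_itv.
- by move=> k; apply/measurable_EFinP; exact: measurable_powR_fun.
- by move=> k s _; rewrite lee_fin powR_ge0.
Qed.

Lemma integral_powR_y q x : 0 < q -> 0 < x ->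
  (\int[mu]_(s in `[x, +oo[) (s `^ (- q - 1))%:E = (x `^ (- q) / q)%:E)%E.
Proof.
move=> q0 x0; pose F (k : nat) := `[x, x * k.+1%:R]%classic : set R.
have -> : `[x, +oo[%classic = \bigcup_k F k.
  apply/seteqP; split=> [s /=|s [k _]].
    rewrite in_itv/= andbT => xs; have s0 := lt_le_trans x0 xs.
    exists (Num.truncn (s / x)) => //; rewrite /F/= in_itv/= xs/=.
    by rewrite mulrC -ler_pdivrMr// ltW// truncnS_gt.
  by rewrite /F/= !in_itv/= => /andP[->].
have ndF : nondecreasing_seq F.
  move=> i j ij; apply/subsetPset; rewrite /F; apply: subset_itvl; rewrite bnd_simp.
  by rewrite ler_pM2l// ler_nat ltnS.
have h : (\int[mu]_(s in F k) (s `^ (- q - 1))%:E @[k --> \oo] --> (x `^ (- q) / q)%:E)%E.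
  under eq_fun => k.
    rewrite /F integral_powR_segment ?oppr_eq0 ?gt_eqF//; last first.
      by rewrite ler_peMr ?(ltW x0)// ler1n.
    rewrite powRM ?(ltW x0)// -[k.+1%:R]invrK powRNV ?invr_gt0//.
    over.
  apply/cvg_EFin; first exact: nearW.
  have -> : x `^ (- q) / q = (x `^ (- q) * 0 - x `^ (- q)) / - q.
    by rewrite mulr0 sub0r invrN mulrNN.
  apply: cvgM; last exact: cvg_cst.
  apply: cvgB; last exact: cvg_cst.
  by apply: cvgM; [exact: cvg_cst|exact: cvg_powR_harmonic].
apply: (cvg_unique (@ereal_hausdorff R) _ h) => /=.
apply: (@ge0_nondecreasing_set_cvg_integral _ (measurableTypeR R) R F
  (fun s => (s `^ (- q - 1))%:E) mu ndF).
- by move=> k; exact: measurable_itv.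
- by move=> k; apply/measurable_EFinP; exact: measurable_powR_fun.
- by move=> k s _; rewrite lee_fin powR_ge0.
Qed.

End power_functions.

Section weighted_monotone.
Context {R : realType}.
Local Notation mu := (@lebesgue_measure R).
Implicit Types (p x y s : R) (h : R -> R).

Lemma measurable_increasing_pos h (D : set R) : increasing_pos h ->
  measurable D -> D `<=` `]0, +oo[ -> measurable_fun D h.
Proof.
move=> hi mD D0; apply: (measurable_funS _ D0) => //.
have -> : `]0, +oo[%classic = \bigcup_k (`[k.+1%:R^-1, +oo[%classic : set R).
  apply/seteqP; split=> [s /=|s [k _]].
    rewrite in_itv/= andbT => s0; exists (Num.truncn s^-1) => //=.
    by rewrite in_itv/= andbT invf_ple ?posrE// ltW// truncnS_gt.
  by rewrite /= !in_itv/= !andbT; apply: lt_le_trans; rewrite invr_gt0.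
apply/measurable_fun_bigcup => // k.
apply: (@eq_measurable_fun _ _ _ _ _ (fun s => h (Num.max s k.+1%:R^-1))).
  by move=> s; rewrite inE/= in_itv/= andbT => /max_idPl ->.
apply: nondecreasing_measurable => // s t st; apply: hi.
  by rewrite lt_max invr_gt0 ltr0n orbT.
by rewrite ge_max !le_max st lexx !orbT.
Qed.

Lemma measurable_weighted p h (D : set R) : increasing_pos h ->
  measurable D -> D `<=` `]0, +oo[ -> measurable_fun D (fun s => s `^ p * h s).
Proof.
move=> hi mD D0; apply: measurable_funM; first exact: measurable_powR_fun.
exact: measurable_increasing_pos.
Qed.

Lemma integrable_weighted_segment p h x y : increasing_pos h -> 0 < x ->
  mu.-integrable `[x, y] (EFin \o (fun s => s `^ p * h s)).
Proof.
move=> hi x0.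
have sub : `[x, y] `<=` `]0, +oo[.
  move=> s /=; rewrite !in_itv/= andbT => /andP[xs _]; exact: lt_le_trans xs.
have [xy|yx] := leP x y; last by rewrite set_itv_ge ?bnd_simp -?ltNge//; exact: integrable_set0.
apply: measurable_bounded_integrable => //.
- exact: (compact_finite_measure (@segment_compact R x y)).
- exact: measurable_weighted.
have [M [_ Mb]] := compact_bounded (continuous_compact (within_continuous_powR (p := p) (y := y) x0) (@segment_compact R x y)).
have M0 : 0 <= M + 1.
  have := Mb (M + 1); rewrite ltrDl ltr01 => /(_ isT (x `^ p)) /= h1.
  by apply: le_trans (normr_ge0 (x `^ p)) (h1 _); exists x => //; rewrite in_itv/= lexx.
exists ((M + 1) * (`|h x| + `|h y|)); split; first exact: num_real.
move=> z Mz s /= sxy; have /andP[xs sy] : x <= s <= y by move: sxy; rewrite in_itv.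
rewrite normrM (le_trans _ (ltW Mz))// ler_pM//.
  by apply: (Mb (M + 1)); [rewrite ltrDl|exists s].
have h1 := hi _ _ x0 xs; have h2 := hi _ _ (lt_le_trans x0 xs) sy.
rewrite ler_norml; apply/andP; split.
  rewrite lerNl (le_trans (_ : _ <= - h x)) ?lerN2//.
  by rewrite (le_trans (ler_norm _))// normrN lerDl.
by rewrite (le_trans h2)// (le_trans (ler_norm _))// lerDr.
Qed.

End weighted_monotone.

(** * The exponents *)

Section exponents.
Context {R : realType}.
Variables (b sigma r : R).
Hypotheses (sigma0 : sigma != 0) (r0 : 0 < r).
Local Notation m := (exp_m b sigma r).
Local Notation n := (exp_n b sigma r).
Local Notation kap := ((sigma ^+ 2 * (n - m))^-1).

Let s2 : 0 < sigma ^+ 2. Proof. by rewrite exprn_even_gt0. Qed.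

Let disc_gt0 : 0 < (b - sigma ^+ 2) ^+ 2 + 4 * sigma ^+ 2 * r.
Proof.
by apply: ltr_wpDl; [exact: sqr_ge0|apply: mulr_gt0 => //; apply: mulr_gt0].
Qed.

Let root p : p = m \/ p = n -> sigma ^+ 2 * p * (p - 1) + b * p = r.
Proof.
have e := sqr_sqrtr (ltW disc_gt0).
set q := Num.sqrt _ in e; have s0 := lt0r_neq0 s2.
have aux (t : R) : t ^+ 2 = q ^+ 2 ->
    forall p, p = (2 * sigma ^+ 2)^-1 * (sigma ^+ 2 - b + t) ->
    sigma ^+ 2 * p * (p - 1) + b * p = r.
  move=> tq {}p ->; transitivity ((t ^+ 2 - (b - sigma ^+ 2) ^+ 2) / (4 * sigma ^+ 2)).
    by field; rewrite sigma0.
  by rewrite tq e; field; rewrite sigma0.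
by case=> ->; [exact: (aux (- q) (sqrrN q) _ erefl)|exact: (aux q erefl _ erefl)].
Qed.

Lemma exp_m_root : sigma ^+ 2 * m * (m - 1) + b * m = r.
Proof. by apply: root; left. Qed.

Lemma exp_n_root : sigma ^+ 2 * n * (n - 1) + b * n = r.
Proof. by apply: root; right. Qed.

Let prodE : sigma ^+ 2 * (m * n) = - r.
Proof.
have e := sqr_sqrtr (ltW disc_gt0); rewrite /exp_m /exp_n.
set q := Num.sqrt _ in e *.
transitivity (((b - sigma ^+ 2) ^+ 2 - q ^+ 2) / (4 * sigma ^+ 2)).
  by field; rewrite sigma0.
by rewrite e; field; rewrite sigma0.
Qed.

Let diffE : sigma ^+ 2 * (n - m) = Num.sqrt ((b - sigma ^+ 2) ^+ 2 + 4 * sigma ^+ 2 * r).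
Proof. by rewrite /exp_m /exp_n; set q := Num.sqrt _; field; rewrite sigma0. Qed.

Let mn : m < n.
Proof. by rewrite -subr_gt0 -(pmulr_rgt0 _ s2) diffE sqrtr_gt0. Qed.

Let mn0 : m * n < 0.
Proof. by rewrite -(pmulr_rlt0 _ s2) prodE oppr_lt0. Qed.

Lemma exp_m_lt0 : m < 0.
Proof.
rewrite ltNge; apply/negP => m0.
by move: mn0; rewrite ltNge mulr_ge0// (le_trans m0)// ltW.
Qed.

Lemma exp_n_gt0 : 0 < n.
Proof. by move: mn0; rewrite nmulr_rlt0// exp_m_lt0. Qed.

Lemma resolvent_coef_gt0 : 0 < kap.
Proof. by rewrite invr_gt0 mulr_gt0// subr_gt0. Qed.

Let dn0 : n - m != 0. Proof. by rewrite subr_eq0 gt_eqF. Qed.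

Lemma resolvent_coefK : sigma ^+ 2 * (kap * (n - m)) = 1.
Proof. by field; rewrite sigma0 dn0. Qed.

Lemma resolvent_coefE : kap * (n - m) * r = - (m * n).
Proof.
transitivity (kap * (n - m) * - (sigma ^+ 2 * (m * n))).
  by rewrite prodE opprK.
by rewrite mulrN mulrCA mulrA resolvent_coefK mul1r.
Qed.

End exponents.

(** * Occupation density of geometric Brownian motion *)

Section discounted_cost.
Context {d : measure_display} {T : measurableType d} {R : realType}.
Variables (P : probability T R) (F : R -> set (set T)) (W : R -> T -> R).
Hypothesis hW : brownian_motion P F W.
Variables (b c r : R).
Local Notation X := (gbm b c W).
Local Notation mu := (@lebesgue_measure R).
Implicit Types (phi : R -> R).

(** The discounted running cost as one function of chance and time, which is
jointly measurable and vanishes at negative times. *)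
Definition discounted phi (z : T * measurableTypeR R) : R :=
  (\1_(`[0%R, +oo[%classic : set R) z.2 * expR (- (r * z.2))) *
  phi (X (Num.max z.2 0) z.1).

(** Measurability is asked of [phi \o expR] because only the values of [phi] at
positive arguments are meaningful. *)
Lemma measurable_discounted phi : measurable_fun setT (phi \o expR) ->
  measurable_fun setT (discounted phi).
Proof.
move=> mphi.
have m0 : measurable_fun setT (\1_(`[0%R, +oo[%classic : set R) : R -> R).
  exact: measurable_indic.
have mexp : measurable_fun setT (fun t : R => expR (- (r * t))).
  by under eq_fun do rewrite -mulNr; exact: measurable_expRM.
apply: measurable_funM.
  apply: measurable_funM.
    exact: (measurableT_comp m0 (@measurable_snd _ _ _ _)).
  exact: (measurableT_comp mexp (@measurable_snd _ _ _ _)).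
have mX : measurable_fun setT
    (fun z : T * measurableTypeR R => X (Num.max z.2 0) z.1).
  exact: (measurableT_comp (measurable_gbm_joint hW _ _) (@measurable_swap _ _ _ _)).
have mlnX := measurableT_comp (@measurable_ln R) mX.
rewrite (_ : (fun z => _) = (phi \o expR) \o (@ln R \o (fun z => X (Num.max z.2 0) z.1))).
  exact: (measurableT_comp mphi mlnX).
by apply/funext => z /=; rewrite lnK// posrE gbm_gt0.
Qed.

Lemma discounted_ge0 phi z : (forall x, 0 <= phi x) -> 0 <= discounted phi z.
Proof. by move=> phi0; rewrite !mulr_ge0// expR_ge0. Qed.

Lemma integral_discounted phi : (forall x, 0 <= phi x) ->
  measurable_fun setT (phi \o expR) ->
  (\int[P]_w \int[mu]_(t in `[0%R, +oo[) (expR (- (r * t)) * phi (X t w))%:E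
   = \int[P \x mu]_z (discounted phi z)%:E)%E.
Proof.
move=> phi0 mphi; rewrite fubini_tonelli1; last 2 first.
- by apply/measurable_EFinP; exact: measurable_discounted.
- by move=> z; rewrite lee_fin discounted_ge0.
apply: eq_integral => w _; rewrite integral_mkcond; apply: eq_integral => t _.
rewrite patchE /discounted /= [\1_(`[0, +oo[%classic : set R) _]indicE.
case: ifPn => t0; last by rewrite !mul0r.
by move: t0; rewrite inE/= in_itv/= andbT => t0; rewrite mul1r max_l.
Qed.

End discounted_cost.

Section occupation_density.
Context {R : realType}.
Variables (b sigma r : R).
Hypotheses (sigma0 : sigma != 0) (r0 : 0 < r).
Local Notation mu := (@lebesgue_measure R).
Local Notation n := (exp_n b sigma r).
Local Notation m' := (b - sigma ^+ 2).
Local Notation c := (Num.sqrt 2 * sigma).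
Let g := `|sigma|.
Let a := Num.sqrt (r + m' ^+ 2 / (4 * sigma ^+ 2)).
Let kappa := (2 * g * a)^-1.

Let sigma20 : 0 < sigma ^+ 2.
Proof. by rewrite lt_neqAle eq_sym sqrf_eq0 sigma0 sqr_ge0. Qed.

Let g0 : 0 < g. Proof. by rewrite normr_gt0. Qed.

Let g2 : g ^+ 2 = sigma ^+ 2. Proof. by rewrite real_normK// num_real. Qed.

Let c2 : c ^+ 2 = 2 * sigma ^+ 2.
Proof. by rewrite exprMn sqr_sqrtr. Qed.

Let c0 : c != 0.
Proof. by rewrite mulf_neq0// gt_eqF// sqrtr_gt0. Qed.

Let a0 : 0 < a.
Proof.
by rewrite sqrtr_gt0 ltr_wpDr// divr_ge0 ?sqr_ge0// mulr_ge0// ltW.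
Qed.

Let a2 : a ^+ 2 = r + m' ^+ 2 / (4 * sigma ^+ 2).
Proof. by rewrite sqr_sqrtr// ltW// -sqrtr_gt0. Qed.

Let kappa0 : 0 < kappa. Proof. by rewrite invr_gt0 !mulr_gt0. Qed.

Let exp_nE : n = - m' / (2 * sigma ^+ 2) + a / g.
Proof.
have s0 := lt0r_neq0 sigma20; have gn := lt0r_neq0 g0.
rewrite /exp_n (_ : (b - sigma ^+ 2) ^+ 2 + _ = (2 * g * a) ^+ 2).
  rewrite sqrtr_sqr gtr0_norm ?mulr_gt0// -g2; field; exact: gn.
rewrite !exprMn g2 a2; field; exact: sigma0.
Qed.

(** Completing the square in time: along the ray on which the square vanishes
the resolvent density decays exactly like [expR (- n * z)]. *)
Let exponentE (t v z : R) : 0 < t -> z = m' * t + c * v ->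
  r * t + v ^+ 2 / (2 * t) = n * z + (a * t - z / (2 * g)) ^+ 2 / t.
Proof.
move=> t0 zE.
have s0 := lt0r_neq0 sigma20; have gn := lt0r_neq0 g0; have tn := lt0r_neq0 t0.
have v2 : v ^+ 2 = (z - m' * t) ^+ 2 / (2 * sigma ^+ 2).
  have -> : (z - m' * t) ^+ 2 = c ^+ 2 * v ^+ 2 by rewrite zE; ring.
  by rewrite c2; field.
rewrite v2 exp_nE.
have -> : (a * t - z / (2 * g)) ^+ 2 = a ^+ 2 * t ^+ 2 - a * t * z / g + z ^+ 2 / (4 * g ^+ 2).
  by field.
rewrite a2 g2; field.
by rewrite tn sigma0 gn.
Qed.

Let C1 := (a + (2 * g)^-1) ^+ 2 / kappa.

(** The square vanishes at time [kappa * k] if [z = k]; it is divided by [t], so it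
stays bounded for times within [sqrt k] of that instant. *)
Let window_le (k : nat) (t z : R) : (0 < k)%N ->
  kappa * k%:R <= t <= kappa * k%:R + Num.sqrt k%:R -> k%:R <= z <= k%:R + 1 ->
  (a * t - z / (2 * g)) ^+ 2 / t <= C1.
Proof.
move=> k0 /andP[t1 t2] /andP[z1 z2].
have k1 : 1 <= k%:R :> R by rewrite ler1n.
have kp : 0 < k%:R :> R by rewrite ltr0n.
have sk1 : 1 <= Num.sqrt k%:R :> R by rewrite -[leLHS]sqrtr1 ler_wsqrtr.
have t0 : 0 < t by apply: lt_le_trans t1; rewrite mulr_gt0.
have ak : a * kappa = (2 * g)^-1.
  by rewrite /kappa; field; rewrite !lt0r_neq0.
have -> : a * t - z / (2 * g) = a * (t - kappa * k%:R) - (z - k%:R) / (2 * g).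
  by rewrite mulrBr mulrA ak; ring.
have n1 : `|a * (t - kappa * k%:R) - (z - k%:R) / (2 * g)| <=
    (a + (2 * g)^-1) * Num.sqrt k%:R.
  rewrite (le_trans (ler_normB _ _))// [leRHS]mulrDl lerD//.
    rewrite normrM (gtr0_norm a0) ler_pM2l// ger0_norm ?subr_ge0//.
    by rewrite lerBlDl.
  rewrite ger0_norm; last by rewrite divr_ge0 ?subr_ge0// mulr_ge0// ltW.
  rewrite mulrC ler_pM2l; last by rewrite invr_gt0 mulr_gt0.
  by rewrite (le_trans _ sk1)// lerBlDl.
rewrite ler_pdivrMr// -[leLHS]real_normK ?num_real//.
have n2 : `|a * (t - kappa * k%:R) - (z - k%:R) / (2 * g)| ^+ 2 <=
    ((a + (2 * g)^-1) * Num.sqrt k%:R) ^+ 2.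
  by rewrite ler_sqr ?nnegrE ?(le_trans _ n1).
apply: (le_trans n2); rewrite exprMn sqr_sqrtr ?ler0n//.
rewrite /C1 -[leRHS]mulrA ler_wpM2l ?sqr_ge0//.
by rewrite mulrC ler_pdivlMr// mulrC.
Qed.

Let c1 := expR (- n - C1) / Num.sqrt (2 * pi * (kappa + 1)).

Let c10 : 0 < c1.
Proof.
rewrite divr_gt0 ?expR_gt0// sqrtr_gt0; apply: mulr_gt0.
  by rewrite mulr_gt0// pi_gt0.
by rewrite ltr_wpDl// ltW.
Qed.

Let pdf_ge (k : nat) (t v : R) : (0 < k)%N ->
  kappa * k%:R <= t <= kappa * k%:R + Num.sqrt k%:R ->
  k%:R <= m' * t + c * v <= k%:R + 1 ->
  c1 * expR (- n * k%:R) / Num.sqrt k%:R <=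
  expR (- (r * t)) * normal_pdf 0 (Num.sqrt t) v.
Proof.
move=> k0 ht hz; have W := window_le k0 ht hz.
have k1 : 1 <= k%:R :> R by rewrite ler1n.
have kp : 0 < k%:R :> R by rewrite ltr0n.
move: ht hz => /andP[t1 t2] /andP[z1 z2].
have t0 : 0 < t by apply: lt_le_trans t1; rewrite mulr_gt0.
have st0 : Num.sqrt t != 0 by rewrite gt_eqF// sqrtr_gt0.
rewrite normal_pdfE//= /normal_peak /normal_fun subr0 mulrCA -expRD.
have -> : - (r * t) + - v ^+ 2 / (Num.sqrt t ^+ 2 *+ 2) =
    - (n * (m' * t + c * v) + (a * t - (m' * t + c * v) / (2 * g)) ^+ 2 / t).
  rewrite -(exponentE t0 (erefl (m' * t + c * v))) sqr_sqrtr ?ltW//; field; exact: lt0r_neq0.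
rewrite ler_pdivrMr ?sqrtr_gt0// /c1 mulrAC ler_pdivrMr ?sqrtr_gt0; last first.
  by rewrite mulr_gt0 ?ltr_wpDl ?(ltW kappa0)// mulr_gt0// pi_gt0.
set p := 2 * pi * (kappa + 1).
have p0 : 0 < p by rewrite mulr_gt0 ?ltr_wpDl ?(ltW kappa0)// mulr_gt0// pi_gt0.
have tp : Num.sqrt (Num.sqrt t ^+ 2 * pi *+ 2) <= Num.sqrt k%:R * Num.sqrt p.
  rewrite -sqrtrM ?ler0n// ler_wsqrtr// sqr_sqrtr ?(ltW t0)//.
  have sk : Num.sqrt k%:R <= k%:R :> R.
    rewrite -[leRHS](sqr_sqrtr (ltW kp)) expr2 ler_peMl ?sqrtr_ge0//.
    by rewrite -[leLHS]sqrtr1 ler_wsqrtr.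
  have -> : t * pi *+ 2 = t * (2 * pi) by rewrite -mulr_natl; ring.
  have -> : k%:R * p = (kappa + 1) * k%:R * (2 * pi) by rewrite /p; ring.
  rewrite ler_wpM2r ?mulr_ge0 ?pi_ge0// (le_trans t2)// mulrDl mul1r.
  by rewrite lerD2l.
rewrite -mulrA mulrC mulrA -mulrA.
have tpi0 : 0 < Num.sqrt (Num.sqrt t ^+ 2 * pi *+ 2).
  by rewrite sqrtr_gt0 sqr_sqrtr ?(ltW t0)// mulrn_wgt0// mulr_gt0// pi_gt0.
have EE : expR (- n * k%:R) * expR (- n - C1) <= expR (- (n * (m' * t + c * v) +
    (a * t - (m' * t + c * v) / (2 * g)) ^+ 2 / t)).
  rewrite -expRD ler_expR; have := ler_wpM2l (ltW (exp_n_gt0 b sigma0 r0)) z2.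
  move: W; set x := _ / t; set z := n * (m' * t + c * v); rewrite mulrDr mulr1.
  by lra.
apply: (le_trans EE); rewrite [leRHS]mulrAC ler_peMl ?expR_ge0//.
by rewrite mulrC ler_pdivlMr// mul1r.
Qed.

Let band (k : nat) (t : R) : set R := [set v | k%:R <= m' * t + c * v < k%:R + 1].

Let measurable_band k t : measurable (band k t).
Proof.
rewrite -[X in measurable X]setTI.
have -> : band k t = (fun v => m' * t + c * v) @^-1` `[k%:R, k%:R + 1[.
  by apply/seteqP; split => v /=; rewrite in_itv.
have m1 : measurable_fun setT (fun v : R => m' * t + c * v).
  by apply: measurable_funD => //; exact: measurable_funM.
exact: m1.
Qed.

Let measure_band k t : mu (band k t) = (`|c|^-1)%:E.
Proof.
have e1 : (k%:R + 1 - m' * t) / c - (k%:R - m' * t) / c = c^-1.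
  by rewrite -mulrBl -[RHS]mul1r; congr (_ / _); ring.
have [cn|cp|ce] := ltgtP c 0; last by move: c0; rewrite ce eqxx.
- have -> : band k t = `](k%:R + 1 - m' * t) / c, (k%:R - m' * t) / c]%classic.
    apply/seteqP; split => v /=; rewrite in_itv/= /band/= => /andP[h1 h2]; apply/andP; split.
    + by rewrite ltr_ndivrMr// [v * _]mulrC ltrBrDl.
    + by rewrite ler_ndivlMr// [v * _]mulrC lerBlDl.
    + by rewrite -lerBlDl [c * v]mulrC -ler_ndivlMr.
    + by rewrite -ltrBrDl [c * v]mulrC -ltr_ndivrMr.
  rewrite lebesgue_measure_itv/= lte_fin ltr_nM2r ?invr_lt0//.
  rewrite ltrD2r ltrDl ltr01 ltr0_norm// invrN -EFinB -e1.
  by congr EFin; ring.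
- have -> : band k t = `[(k%:R - m' * t) / c, (k%:R + 1 - m' * t) / c[%classic.
    apply/seteqP; split => v /=; rewrite in_itv/= /band/= => /andP[h1 h2]; apply/andP; split.
    + by rewrite ler_pdivrMr// [v * _]mulrC lerBlDl.
    + by rewrite ltr_pdivlMr// [v * _]mulrC ltrBrDl.
    + by rewrite -lerBlDl [c * v]mulrC -ler_pdivrMr.
    + by rewrite -ltrBrDl [c * v]mulrC -ltr_pdivlMr.
  rewrite lebesgue_measure_itv/= lte_fin ltr_pM2r ?invr_gt0//.
  by rewrite ltrD2r ltrDl ltr01 gtr0_norm// -EFinB e1.
Qed.

Let normal_band_ge (k : nat) (t : R) : (0 < k)%N ->
  kappa * k%:R <= t <= kappa * k%:R + Num.sqrt k%:R ->
  ((c1 / `|c| * expR (- n * k%:R) / Num.sqrt k%:R)%:E <=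
   (expR (- (r * t)))%:E * normal_prob 0 (Num.sqrt t) (band k t))%E.
Proof.
move=> k0 ht; rewrite /normal_prob.
have mB := measurable_band k t.
rewrite -ge0_integralZl//; last 2 first.
- by apply/measurable_EFinP/measurable_funTS; exact: measurable_normal_pdf.
- by move=> v _; rewrite lee_fin normal_pdf_ge0.
apply: (@le_trans _ _ (\int[mu]_(v in band k t) (c1 * expR (- n * k%:R) / Num.sqrt k%:R)%:E)%E).
  rewrite integral_cst// [X in (_ * X)%E](measure_band k t).
  by rewrite -EFinM lee_fin le_eqVlt; apply/orP; left; apply/eqP; ring.
apply: ge0_le_integral => //.
- move=> v _; rewrite lee_fin divr_ge0 ?sqrtr_ge0// mulr_ge0 ?expR_ge0//.
  exact: ltW.
- apply: emeasurable_funM => //.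
  by apply/measurable_EFinP/measurable_funTS; exact: measurable_normal_pdf.
- move=> v /andP[v1 v2]; rewrite -EFinM lee_fin; apply: pdf_ge => //.
  by rewrite v1 ltW.
Qed.

Variables (d : measure_display) (T : measurableType d) (P : probability T R).
Variables (F : R -> set (set T)) (W : R -> T -> R).
Hypothesis hW : brownian_motion P F W.
Local Notation X := (gbm b c W).

(** During a window of length [sqrt k] after time [kappa * k] the discounted density
of [ln X] on the band [[k, k + 1)] is at least of order [expR (- n * k) / sqrt k]. *)
Lemma occupation_ge : exists2 C, 0 < C & forall k : nat, (0 < k)%N ->
  ((C * expR (- n * k%:R))%:E <= \int[P \x mu]_z
     (discounted W b c r \1_(`[expR k%:R, expR (k%:R + 1)[%classic) z)%:E)%E.
Proof.
exists (c1 / `|c|); first by rewrite divr_gt0// normr_gt0.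
move=> k k0.
have kp : 0 < k%:R :> R by rewrite ltr0n.
have skp : 0 < Num.sqrt k%:R :> R by rewrite sqrtr_gt0.
pose J := `[kappa * k%:R, kappa * k%:R + Num.sqrt k%:R]%classic : set R.
set B := `[expR k%:R, expR (k%:R + 1)[%classic : set R.
have law t : 0 < t -> (\int[P]_w (\1_B (X t w))%:E)%E =
    normal_prob 0 (Num.sqrt t) (band k t).
  move=> t0; have mB := measurable_band k t.
  rewrite -[RHS](_ : \int[normal_prob 0 (Num.sqrt t)]_v (\1_(band k t) v)%:E = _)%E; last first.
    by rewrite integral_indic// setIT.
  rewrite -(@ge0_integral_brownian _ _ _ _ _ _ hW t (fun v => (\1_(band k t) v)%:E))//; last first.
    exact/measurable_EFinP.
  apply: eq_integral => w _; rewrite !indicE; congr (_%:R%:E); congr nat_of_bool.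
  apply/idP/idP => /set_mem h; apply/mem_set; move: h; rewrite /B /band /gbm /= in_itv/=;
    by rewrite ler_expR ltr_expR c2 (_ : 2 * sigma ^+ 2 / 2 = sigma ^+ 2)//; field.
have mB : measurable_fun setT (\1_B : R -> R).
  by apply: measurable_indic; exact: measurable_itv.
pose f (z : T * measurableTypeR R) : \bar R := (discounted W b c r \1_B z)%:E.
have mf : measurable_fun setT f.
  apply/measurable_EFinP; apply: (measurable_discounted hW).
  exact: measurableT_comp.
have f0 z : (0 <= f z)%E by rewrite lee_fin discounted_ge0.
rewrite (fubini_tonelli2 f)//.
have mJ : measurable J by exact: measurable_itv.
apply: (@le_trans _ _ (\int[mu]_(t in J) \int[P]_w f (w, t))%E); last first.
  apply: ge0_subset_integral => //.
  - exact: (measurable_fun_fubini_tonelli_G (m1 := P) f).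
  - by move=> t _; apply: integral_ge0.
apply: (@le_trans _ _ (\int[mu]_(t in J) (c1 / `|c| * expR (- n * k%:R) / Num.sqrt k%:R)%:E)%E).
  rewrite integral_cst//.
  have -> : lebesgue_measure_lebesgue_measure__canonical__measure_function_Measure R J = (Num.sqrt k%:R)%:E.
    have : mu J = (Num.sqrt k%:R)%:E.
      rewrite /J lebesgue_measure_itv/= lte_fin ltrDl skp -EFinB.
      by congr EFin; ring.
    by [].
  by rewrite -EFinM divfK// gt_eqF.
apply: ge0_le_integral => //.
- move=> t _; rewrite lee_fin divr_ge0 ?sqrtr_ge0// mulr_ge0 ?expR_ge0//.
  by rewrite divr_ge0// ltW.
- apply: measurable_funTS.
  exact: (measurable_fun_fubini_tonelli_G (m1 := P) f).
- move=> t; rewrite /J/= in_itv/= => ht; apply: (le_trans (normal_band_ge k0 ht)).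
  have /andP[t1 _] := ht.
  have t0 : 0 < t by apply: lt_le_trans _ t1; rewrite mulr_gt0.
  have mI : measurable_fun setT (fun w : T => (\1_B (X t w) : R)%:E).
    suff h : measurable_fun setT (fun w : T => \1_B (X t w) : R) by apply/measurable_EFinP.
    exact: (measurableT_comp mB (measurable_gbm hW b c (ltW t0))).
  rewrite -law// -ge0_integralZl//.
  rewrite le_eqVlt; apply/orP; left; apply/eqP; apply: eq_integral => w _.
  rewrite /f /discounted /= [\1_(`[0, +oo[%classic : set R) _]indicE mem_set.
    by rewrite mul1r max_l// ltW.
  by rewrite /= in_itv/= andbT ltW.
Qed.

End occupation_density.

(** * Integrability of the cost at infinity *)

Lemma integrable_setU {d : measure_display} {T : measurableType d} {R : realType}
    (mu : {measure set T -> \bar R}) (A B : set T) (f : T -> \bar R) :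
  measurable A -> measurable B -> mu.-integrable A f -> mu.-integrable B f ->
  mu.-integrable (A `|` B) f.
Proof.
move=> mA mB iA iB; have mAB : measurable (A `|` B) by exact: measurableU.
apply/integrable_mkcond => //.
have iB' : mu.-integrable (B `\` A) f.
  by apply: integrableS iB => //; exact: measurableD.
have -> : f \_ (A `|` B) = (f \_ A \+ f \_ (B `\` A))%E.
  apply/funext => x; rewrite /= !patchE.
  rewrite in_setU in_setD; case: (x \in A); case: (x \in B) => /=;
    by rewrite ?adde0 ?add0e.
apply: integrableD => //; first exact: (proj1 (integrable_mkcond _ mA) iA).
exact: (proj1 (integrable_mkcond _ (measurableD mB mA)) iB').
Qed.

Section integrability_at_infinity.
Context {R : realType}.
Variables (n : R) (h : R -> R).
Hypotheses (n0 : 0 < n) (h_incr : increasing_pos h).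
Local Notation mu := (@lebesgue_measure R).
Local Notation f := (fun s => s `^ (- n - 1) * h s).

(** Bounds [h] by its value at the right end, which turns the integral into a term
of the series that the occupation density controls. *)
Let k_step (k : nat) : 0 <= h (expR k%:R) ->
  (\int[mu]_(s in `[expR k%:R, expR k.+1%:R[) (f s)%:E <=
   (expR n / n * (h (expR k.+1%:R) * expR (- n * k.+1%:R)))%:E)%E.
Proof.
move=> hk.
have ek : expR k%:R <= expR k.+1%:R :> R by rewrite ler_expR ler_nat.
have hk1 : 0 <= h (expR k.+1%:R) by rewrite (le_trans hk)// h_incr ?expR_gt0.
apply: (@le_trans _ _ (\int[mu]_(s in `[expR k%:R, expR k.+1%:R])
   ((h (expR k.+1%:R))%:E * (s `^ (- n - 1))%:E))%E).
  apply: (@le_trans _ _ (\int[mu]_(s in `[expR k%:R, expR k.+1%:R[)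
   ((h (expR k.+1%:R))%:E * (s `^ (- n - 1))%:E))%E).
    apply: ge0_le_integral => //.
    - move=> s /=; rewrite in_itv/= => /andP[s1 s2].
      by rewrite lee_fin mulr_ge0 ?powR_ge0// (le_trans hk)// h_incr ?expR_gt0.
    - apply/measurable_EFinP; apply: measurable_weighted => //.
      move=> s /=; rewrite !in_itv/= andbT => /andP[s1 s2].
      by apply: lt_le_trans s1; exact: expR_gt0.
    - by apply: emeasurable_funM => //; apply/measurable_EFinP; exact: measurable_powR_fun.
    - move=> s /=; rewrite in_itv/= => /andP[s1 s2].
      rewrite -EFinM lee_fin mulrC ler_wpM2r ?powR_ge0// h_incr ?(ltW s2)//.
      by apply: lt_le_trans s1; exact: expR_gt0.
  apply: ge0_subset_integral => //.
  - by apply: emeasurable_funM => //; apply/measurable_EFinP; exact: measurable_powR_fun.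
  - by move=> s _; rewrite mule_ge0// lee_fin powR_ge0.
  - by apply: subset_itv; rewrite ?bnd_simp.
rewrite ge0_integralZl//; last 2 first.
- by apply/measurable_EFinP; exact: measurable_powR_fun.
- by move=> s _; rewrite lee_fin powR_ge0.
rewrite integral_powR_segment ?expR_gt0 ?oppr_eq0 ?gt_eqF// -EFinM lee_fin.
rewrite [leRHS]mulrCA ler_wpM2l// invrN mulrN -mulNr opprB.
rewrite mulrAC -expRD ler_wpM2r ?invr_ge0 ?(ltW n0)// -!expRM.
have -> : n + - n * k.+1%:R = k%:R * - n by rewrite -natr1; ring.
by rewrite gerBl expR_ge0.
Qed.

Lemma integrable_at_infinity (k0 : nat) (M : R) : 0 <= h (expR k0%:R) ->
  (forall N, \sum_(k0 <= k < N) h (expR k%:R) * expR (- n * k%:R) <= M) ->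
  forall x, 0 < x -> mu.-integrable `[x, +oo[ (EFin \o f).
Proof.
move=> hk0 hM x x0.
pose A N := `[expR k0%:R, expR (k0 + N)%:R[%classic : set R.
have mA N : measurable (A N) by exact: measurable_itv.
have mf (D : set R) : measurable D -> D `<=` `[expR k0%:R, +oo[ ->
    measurable_fun D (fun s => (f s)%:E).
  move=> mD D0; apply/measurable_EFinP; apply: measurable_weighted => //.
  apply: (subset_trans D0) => s /=; rewrite !in_itv/= !andbT.
  by apply: lt_le_trans; exact: expR_gt0.
have Asub N : A N `<=` `[expR k0%:R, +oo[.
  by apply: subset_itv; rewrite ?bnd_simp.
have f0 s : (`[expR k0%:R, +oo[%classic : set R) s -> (0 <= (f s)%:E)%E.
  rewrite /= in_itv/= andbT => ks.
  by rewrite lee_fin mulr_ge0 ?powR_ge0// (le_trans hk0)// h_incr ?expR_gt0.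
have bound N : (\int[mu]_(s in A N) (f s)%:E <= (expR n / n *
    \sum_(k0 <= k < k0 + N) h (expR k.+1%:R) * expR (- n * k.+1%:R))%:E)%E.
  elim: N => [|N IH].
    by rewrite /A addn0 set_itv_ge ?bnd_simp ?ltxx// integral_set0 big_geq// mulr0.
  have -> : A N.+1 = A N `|` `[expR (k0 + N)%:R, expR (k0 + N).+1%:R[%classic.
    rewrite /A addnS; apply/seteqP; split => s /=; rewrite !in_itv/=.
      by move=> /andP[s1 s2]; have [h1|h1] := ltP s (expR (k0 + N)%:R);
        [left|right]; rewrite ?s1 ?s2.
    move=> [/andP[s1 s2]|/andP[s1 s2]]; apply/andP; split => //.
      by rewrite (lt_le_trans s2)// ler_expR ler_nat.
    by rewrite (le_trans _ s1)// ler_expR ler_nat leq_addr.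
  rewrite ge0_integral_setU//; last 4 first.
  - exact: mA.
  - apply: mf; first exact: measurableU.
    rewrite subUset; split => //; apply: subset_itv; rewrite bnd_simp//.
    by rewrite ler_expR ler_nat leq_addr.
  - move=> s [As|]; first by apply: f0; exact: Asub As.
    rewrite /= in_itv/= => /andP[s1 _]; apply: f0; rewrite /= in_itv/= andbT.
    by rewrite (le_trans _ s1)// ler_expR ler_nat leq_addr.
  - apply/disj_setPS => s [] /=; rewrite !in_itv/= => /andP[_ s1] /andP[s2 _].
    by move: (lt_le_trans s1 s2); rewrite ltxx.
  rewrite addnS big_nat_recr ?leq_addr//= mulrDr EFinD leeD// k_step//.
  by rewrite (le_trans hk0)// h_incr ?expR_gt0// ler_expR ler_nat leq_addr.
have bM N : (\int[mu]_(s in A N) (f s)%:E <= (expR n / n * M)%:E)%E.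
  apply: (le_trans (bound N)); rewrite lee_fin ler_wpM2l//.
    by rewrite divr_ge0 ?expR_ge0// ltW.
  have := hM (k0 + N).+1; rewrite big_ltn ?ltnS ?leq_addr// => /le_trans h1.
  rewrite (le_trans _ (hM (k0 + N).+1))// [leRHS]big_ltn ?ltnS ?leq_addr//.
  by rewrite big_add1/= lerDr mulr_ge0// expR_ge0.
have ndA : nondecreasing_seq A.
  move=> i j ij; apply/subsetPset; rewrite /A; apply: subset_itvl.
  by rewrite bnd_simp ler_expR ler_nat leq_add2l.
have UA : \bigcup_N A N = `[expR k0%:R, +oo[%classic.
  apply/seteqP; split => [s [N _ /Asub]//|s /=].
  rewrite in_itv/= andbT => ks; have s0 := lt_le_trans (expR_gt0 _) ks.
  exists (Num.truncn s) => //; rewrite /A /= in_itv/= ks/=.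
  apply: lt_le_trans (expR_ge1Dx _).
  by rewrite (lt_le_trans (truncnS_gt s))// addrC natr1 ler_nat ltnS leq_addl.
have iA : mu.-integrable `[expR k0%:R, +oo[ (EFin \o f).
  apply/integrableP; split; first exact: mf.
  have := @ge0_nondecreasing_set_cvg_integral _ (measurableTypeR R) R A
    (fun s => (f s)%:E) mu ndA mA (fun N => mf _ (mA N) (@Asub N))
    (fun N s As => f0 s (Asub N s As)).
  rewrite UA => cA; apply: (@le_lt_trans _ _ (expR n / n * M)%:E); last exact: ltry.
  under eq_integral => s ks.
    rewrite gee0_abs; last exact: (f0 _ (set_mem ks)).
    over.
  by apply: cvge_le cA; exact: nearW.
have iS : mu.-integrable (`[x, expR k0%:R] `|` `[expR k0%:R, +oo[) (EFin \o f).
  by apply: integrable_setU => //; exact: integrable_weighted_segment.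
apply: integrableS iS => //; first exact: measurableU.
move=> s /=; rewrite !in_itv/= !andbT => ->.
by have [h1|h1] := leP s (expR k0%:R); [left|right; exact: ltW].
Qed.

End integrability_at_infinity.

(** The expected discounted cost controls [h] at infinity: on the event that the
process is between [expR k] and [expR (k + 1)] the cost is at least
[h (expR k)]. *)
Lemma gbm_integrable_at_infinity {d : measure_display} {T : measurableType d}
    {R : realType} (P : probability T R) (F : R -> set (set T)) (W : R -> T -> R)
    (b sigma r : R) (h : R -> R) :
  brownian_motion P F W -> sigma != 0 -> 0 < r -> increasing_pos h ->
  h x @[x --> +oo] --> +oo ->
  (\int[P]_w \int[lebesgue_measure]_(t in `[0%R, +oo[)
    (expR (- (r * t)) * `|h (gbm b (Num.sqrt 2 * sigma) W t w)|)%:E < +oo)%E ->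
  forall x, 0 < x -> lebesgue_measure.-integrable `[x, +oo[
    (EFin \o (fun s => s `^ (- exp_n b sigma r - 1) * h s)).
Proof.
move=> hW s0 r0 hi hy hfin.
have n0 := exp_n_gt0 b s0 r0; set n := exp_n b sigma r in n0 *.
have mh : measurable_fun setT (h \o expR).
  apply: nondecreasing_measurable => // x y xy /=.
  by apply: hi; rewrite ?expR_gt0// ler_expR.
have mah : measurable_fun setT ((fun x => `|h x|) \o expR) by exact: (measurableT_comp (@normr_measurable R setT) mh).
rewrite (@integral_discounted _ _ _ _ _ _ hW b (Num.sqrt 2 * sigma) r (fun x => `|h x|)) in hfin => //.
have [C C0 hC] := occupation_ge b s0 r0 hW.
have [k0 k00 hk0] : exists2 k0 : nat, (0 < k0)%N & 0 <= h (expR k0%:R).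
  have [A [_ hA]] : \forall x \near +oo, 0 <= h x by move/cvgryPge : hy; apply.
  exists (Num.truncn A).+1 => //; apply: hA.
  apply: (lt_trans (truncnS_gt A)); apply: lt_le_trans (expR_ge1Dx _).
  by rewrite ltrDr.
pose fk (k : nat) := discounted W b (Num.sqrt 2 * sigma) r \1_(`[expR k%:R, expR (k%:R + 1)[%classic).
pose H := discounted W b (Num.sqrt 2 * sigma) r (fun x => `|h x|).
apply: (@integrable_at_infinity _ _ _ n0 hi k0 (C^-1 * fine (\int[P \x lebesgue_measure]_z (H z)%:E)%E)) => // N.
have m1 (k : nat) : measurable_fun setT ((\1_(`[expR k%:R, expR (k%:R + 1)[%classic) : R -> R) \o expR).
  apply: measurableT_comp => //; apply: measurable_indic; exact: measurable_itv.
have mfk k : measurable_fun setT (fun z => (fk k z)%:E).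
  by apply/measurable_EFinP; exact: (measurable_discounted hW).
have mH : measurable_fun setT (fun z => (H z)%:E).
  by apply/measurable_EFinP; exact: (measurable_discounted hW).
have fk0 k z : 0 <= fk k z by rewrite discounted_ge0.
have H0 z : 0 <= H z by rewrite discounted_ge0.
have hkk k : (k0 <= k)%N -> 0 <= h (expR k%:R).
  by move=> kk; rewrite (le_trans hk0)// hi ?expR_gt0// ler_expR ler_nat.
(* at most one of the bands contains the current value of the process *)
have bands x : 0 < x -> \sum_(k0 <= k < N) h (expR k%:R) *
    \1_(`[expR k%:R, expR (k%:R + 1)[%classic : set R) x <= `|h x|.
  move=> x0; have [Nk|kN] := leqP N k0; first by rewrite big_geq.
  pose u (k : nat) : R := (expR k%:R <= x)%R%:R.
  apply: (@le_trans _ _ (\sum_(k0 <= k < N) `|h x| * (u k - u k.+1))).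
    rewrite !big_nat; apply: ler_sum => k /andP[kk _].
    rewrite indicE /u; have [/set_mem/=|] := boolP (x \in _).
      rewrite in_itv/= natr1 => /andP[k1 k2].
      rewrite k1 (leNgt (expR k.+1%:R)) k2/= subr0 !mulr1.
      by apply: le_trans (ler_norm _); rewrite hi ?expR_gt0.
    move=> _; rewrite mulr0 mulr_ge0// subr_ge0 ler_nat.
    case: (leP (expR k.+1%:R) x) => [k1|_]; last by [].
    have -> // : expR k%:R <= x by rewrite (le_trans _ k1)// ler_expR ler_nat.
  rewrite -mulr_sumr ler_piMr//.
  rewrite (eq_bigr (fun k => - u k.+1 - - u k)); last by move=> k _; ring.
  rewrite (telescope_sumr (fun k => - u k)) ?(ltnW kN)// opprK addrC.
  rewrite (le_trans (_ : _ <= u k0)) ?gerBl ?ler0n//.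
  by rewrite /u; case: (expR _ <= x)%R; rewrite ?ler01 ?lexx.
rewrite ler_pdivlMl// -lee_fin.
have HM : (0 <= \int[P \x lebesgue_measure]_z (H z)%:E)%E.
  by apply: integral_ge0 => z _; rewrite lee_fin.
have Hfin : (\int[P \x lebesgue_measure]_z (H z)%:E)%E \is a fin_num.
  by rewrite ge0_fin_numE.
rewrite fineK//.
pose q k := Num.max (h (expR k%:R)) 0.
have q0 k : 0 <= q k by rewrite le_max lexx orbT.
have qE k : (k0 <= k)%N -> q k = h (expR k%:R) by move=> kk; rewrite /q max_l// hkk.
apply: (@le_trans _ _ (\sum_(k0 <= k < N) \int[P \x lebesgue_measure]_z
    ((q k)%:E * (fk k z)%:E))%E).
  rewrite mulr_sumr -sumEFin !big_nat; apply: lee_sum => k /andP[kk _].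
  rewrite ge0_integralZl//; last 2 first.
  - by move=> z _; rewrite lee_fin.
  - by rewrite lee_fin.
  rewrite mulrCA EFinM qE// lee_wpmul2l ?lee_fin ?hkk//.
  by apply: hC; exact: leq_trans kk.
have mG k : measurable_fun setT (fun z => (q k)%:E * (fk k z)%:E)%E.
  by apply: emeasurable_funM.
have G0 k z : (0 <= (q k)%:E * (fk k z)%:E)%E by rewrite mule_ge0// lee_fin.
rewrite -(@ge0_integral_sum _ _ _ (P \x lebesgue_measure)%E setT measurableT _
  (fun k z => (q k)%:E * (fk k z)%:E)%E)//.
apply: ge0_le_integral => //.
- by move=> z _; apply: sume_ge0 => k _; exact: G0.
- by apply: emeasurable_sum => k; exact: mG.
move=> z _; under eq_bigr do rewrite -EFinM.
rewrite sumEFin lee_fin /fk /H /discounted.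
rewrite (eq_big_nat _ _ (F2 := fun k => \1_(`[0, +oo[%classic) z.2 * expR (- (r * z.2)) *
  (h (expR k%:R) * \1_(`[expR k%:R, expR (k%:R + 1)[%classic)
  (gbm b (Num.sqrt 2 * sigma) W (Num.max z.2 0) z.1)))); last first.
  by move=> k /andP[kk _]; rewrite qE//; ring.
rewrite -mulr_sumr ler_wpM2l ?bands ?gbm_gt0//.
Qed.

(** * Derivatives, gluing and short integrals *)

Section derivatives.
Context {R : realType}.
Implicit Types (f g psi : R -> R) (x l : R).

Lemma is_derive0_small psi x : psi x = 0 ->
  (forall e, 0 < e -> \forall y \near x, `|psi y| <= e * `|y - x|) ->
  is_derive x 1 psi 0.
Proof.
move=> p0 small.
have h : h^-1 *: (psi (h *: 1 + x) - psi x) @[h --> 0^'] --> 0.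
  apply/cvgr0Pnorm_le => e e0; rewrite p0.
  have /nbhs_ballP[d /= d0 hd] := small e e0.
  have := dnbhs0_lt (V := R) d0.
  have hn0 := nbhs_dnbhs_neq (0 : R).
  apply: filterS2 hn0 => h hn hd'; rewrite subr0 scaler1 normrM normfV.
  rewrite ler_pdivrMl ?normr_gt0// mulrC.
  have := hd (h + x); rewrite addrK; apply.
  by rewrite /ball/= opprD addrCA subrr addr0 normrN.
apply: DeriveDef; first by apply/cvg_ex; exists 0.
exact/cvg_lim.
Qed.

Lemma is_derive0_smallE psi x : psi x = 0 -> is_derive x 1 psi 0 ->
  forall e, 0 < e -> \forall y \near x, `|psi y| <= e * `|y - x|.
Proof.
move=> p0 dpsi e e0.
have dx : derivable psi x 1 by [].
have : h^-1 *: (psi (h *: 1 + x) - psi x) @[h --> 0^'] --> 'D_1 psi x by exact: dx.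
rewrite derive_val => /cvgr0Pnorm_le/(_ e e0) [d /= d0 hd].
apply/nbhs_ballP; exists d => //= y xy.
have [->|yx] := eqVneq y x; first by rewrite p0 subrr !normr0 mulr0.
have yx0 : y - x != 0 by rewrite subr_eq0.
have := hd (y - x); rewrite p0 subr0 scaler1 subrK normrM normfV.
rewrite ler_pdivrMl ?normr_gt0// mulrC; apply => //.
by rewrite /= sub0r opprB.
Qed.

Lemma is_derive_glue_at f g x l : f x = g x -> is_derive x 1 f l ->
  is_derive x 1 g l -> is_derive x 1 (fun y => if y < x then f y else g y) l.
Proof.
move=> fg df dg.
pose psi y := (if y < x then f y else g y) - f y.
have p0 : psi x = 0 by rewrite /psi ltxx fg subrr.
have dpsi : is_derive x 1 psi 0.
  apply: is_derive0_small => // e e0.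
  have d0 : is_derive x 1 (g - f) 0 by rewrite -(subrr l); exact: is_deriveB.
  have gf0 : (g - f) x = 0 by change (g x - f x = 0); rewrite fg subrr.
  have := is_derive0_smallE gf0 d0 e0; apply: filterS => y.
  change ((g - f) y) with (g y - f y); rewrite /psi; case: ifP => // _ _.
  by rewrite subrr normr0 mulr_ge0// ltW.
have -> : (fun y => if y < x then f y else g y) = f + psi.
  apply/funext => y; change ((f + psi) y) with (f y + psi y).
  by rewrite /psi addrC subrK.
by rewrite -[l]addr0; exact: is_deriveD.
Qed.

Lemma continuous_glue_at f g x : f x = g x -> {for x, continuous f} ->
  {for x, continuous g} -> {for x, continuous (fun y => if y < x then f y else g y)}.
Proof.
move=> fg cf cg; apply/cvgrPdist_lt => e e0; rewrite ltxx.
move/cvgrPdist_lt : cf => /(_ e e0); rewrite fg.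
move/cvgrPdist_lt : cg => /(_ e e0); apply: filterS2 => y h1 h2.
by case: ifP.
Qed.

Lemma nondecreasing_pos f (df : R -> R) :
  (forall x, 0 < x -> is_derive x 1 f (df x)) -> (forall x, 0 < x -> 0 <= df x) ->
  increasing_pos f.
Proof.
move=> dff df0 x y x0 xy.
have [] := @MVT_segment _ f df x y xy.
- move=> z; rewrite in_itv/= => /andP[xz _]; apply: dff; exact: lt_trans xz.
- apply: continuous_in_subspaceT => z /set_mem/=; rewrite in_itv/= => /andP[xz _].
  have h := dff z (lt_le_trans x0 xz).
  exact/differentiable_continuous/derivable1_diffP/(@ex_derive _ _ _ _ _ _ _ h).
- move=> z; rewrite in_itv/= => /andP[xz _] h; rewrite -subr_ge0 h.
  by rewrite mulr_ge0 ?subr_ge0// df0// (lt_le_trans x0).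
Qed.

End derivatives.

Section segment_integrals.
Context {R : realType}.
Local Notation mu := (@lebesgue_measure R).
Variables (p : R) (g : R -> R).
Hypothesis g_incr : increasing_pos g.
Local Notation wg := (fun s => s `^ p * g s).

Lemma integrable_weighted_oc x y : 0 < x -> mu.-integrable `]x, y] (EFin \o wg).
Proof.
move=> x0; have := integrable_weighted_segment p y g_incr x0.
by apply: integrableS => //; apply: subset_itv; rewrite ?bnd_simp.
Qed.

Lemma integrable_powR_oc x y : 0 < x -> mu.-integrable `]x, y] (EFin \o (fun s => s `^ p)).
Proof.
move=> x0; have h1 : increasing_pos (fun=> 1 : R) by [].
have := integrable_weighted_segment p y h1 x0.
under [X in _.-integrable _ X -> _]eq_fun do rewrite /= mulr1.
by apply: integrableS => //; apply: subset_itv; rewrite ?bnd_simp.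
Qed.

Lemma Rintegral_weighted_le (D : set R) c : measurable D -> D `<=` `]0, +oo[ ->
  mu.-integrable D (EFin \o wg) -> mu.-integrable D (EFin \o (fun s => s `^ p)) ->
  (forall s, D s -> g s <= c) ->
  \int[mu]_(s in D) (s `^ p * g s) <= c * \int[mu]_(s in D) (s `^ p).
Proof.
move=> mD D0 ig ip gc; rewrite -RintegralZl//; apply: le_Rintegral => //.
  by rewrite (_ : _ \o _ = fun s => (c%:E * (s `^ p)%:E)%E)//; exact: integrableZl.
by move=> s Ds; rewrite mulrC ler_wpM2r ?powR_ge0// gc.
Qed.

Lemma Rintegral_weighted_ge (D : set R) c : measurable D -> D `<=` `]0, +oo[ ->
  mu.-integrable D (EFin \o wg) -> mu.-integrable D (EFin \o (fun s => s `^ p)) ->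
  (forall s, D s -> c <= g s) ->
  c * \int[mu]_(s in D) (s `^ p) <= \int[mu]_(s in D) (s `^ p * g s).
Proof.
move=> mD D0 ig ip gc; rewrite -RintegralZl//; apply: le_Rintegral => //.
  by rewrite (_ : _ \o _ = fun s => (c%:E * (s `^ p)%:E)%E)//; exact: integrableZl.
by move=> s Ds; rewrite [leRHS]mulrC ler_wpM2r ?powR_ge0// gc.
Qed.

(** Near a positive point the integrand is bounded, hence the integral over a
short interval is small at the rate of its length. *)
Lemma Rintegral_norm_segment_le (f : R -> R) x y M : x <= y ->
  mu.-integrable `]x, y] (EFin \o f) -> (forall s, x < s -> s <= y -> `|f s| <= M) ->
  `|\int[mu]_(s in `]x, y]) f s| <= M * (y - x).
Proof.
move=> xy fi fM.
have len : fine (mu `]x, y]) = y - x.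
  rewrite lebesgue_measure_itv/= lte_fin; case: ltP => //= uv'.
  by apply/eqP; rewrite eq_sym subr_eq0 eq_le xy uv'.
rewrite (le_trans (le_normr_Rintegral _ _))//.
rewrite -len -Rintegral_cst//; apply: le_Rintegral => //.
- exact: integrable_norm.
- apply: (@integrableS _ _ _ mu `[x, y]) => //.
    by apply: subset_itv; rewrite ?bnd_simp.
  apply: continuous_compact_integrable; first exact: segment_compact.
  by move=> s; exact: cst_continuous.
- by move=> s /=; rewrite in_itv/= => /andP[xs sy]; exact: fM.
Qed.

End segment_integrals.

(** * The resolvent and its derivative *)

Section derivative_of_integral.
Context {R : realType}.
Local Notation mu := (@lebesgue_measure R).

(** A function given near [x] by integrals, between [x] and [y], of a kernel
that tends to 0 as both of its arguments tend to [x] has derivative 0. *)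
Lemma is_derive0_integral (psi : R -> R) (K : R -> R -> R) (x : R) : 0 < x ->
  (forall y, x <= y -> psi y = \int[mu]_(s in `]x, y]) K y s) ->
  (forall y, 0 < y -> y <= x -> psi y = - \int[mu]_(s in `]y, x]) K y s) ->
  (forall y u v, 0 < u -> mu.-integrable `]u, v] (EFin \o K y)) ->
  (forall e, 0 < e -> exists2 d, 0 < d &
     forall y s, `|y - x| < d -> `|s - x| < d -> `|K y s| <= e) ->
  is_derive x 1 psi 0.
Proof.
move=> x0 pR pL iK small; apply: is_derive0_small => [|e e0].
  by rewrite pR// set_itv_ge ?bnd_simp ?ltxx// Rintegral_set0.
have [d d0 hd] := small e e0.
apply/nbhs_ballP; exists (Num.min d x) => /=; first by rewrite lt_min d0.
move=> y; rewrite /ball/= lt_min => /andP[yd yx].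
have y0 : 0 < y by move: yx; rewrite ltr_norml => /andP[_]; lra.
rewrite distrC in yd.
have [xy|/ltW yx'] := leP x y.
  rewrite pR// (ger0_norm (_ : 0 <= y - x)) ?subr_ge0//.
  apply: Rintegral_norm_segment_le => //; first exact: iK.
  move=> s xs sy; apply: hd => //; apply: le_lt_trans yd.
  by rewrite !ger0_norm ?subr_ge0 ?(ltW xs)// lerD2r.
rewrite pL// normrN distrC (ger0_norm (_ : 0 <= x - y)) ?subr_ge0//.
apply: Rintegral_norm_segment_le => //; first exact: iK.
move=> s ys sx; apply: hd => //; apply: le_lt_trans yd.
by rewrite !ler0_norm ?subr_le0// lerN2 lerD2r ltW.
Qed.

(** The integrand minus its value at [x] is small near [x]. *)
Lemma is_derive_primitive (Phi f : R -> R) (x : R) : 0 < x ->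
  (forall u v, 0 < u -> u <= v -> Phi v - Phi u = \int[mu]_(s in `]u, v]) f s) ->
  (forall u v, 0 < u -> mu.-integrable `]u, v] (EFin \o f)) ->
  {for x, continuous f} -> is_derive x 1 Phi (f x).
Proof.
move=> x0 PhiB fi cf.
have icst (c u v : R) : mu.-integrable `]u, v] (EFin \o cst c).
  apply: (@integrableS _ _ _ mu `[u, v]) => //.
    by apply: subset_itv; rewrite ?bnd_simp.
  apply: continuous_compact_integrable; first exact: segment_compact.
  by move=> s; exact: cst_continuous.
have intE u v : 0 < u -> u <= v ->
    \int[mu]_(s in `]u, v]) (f s - f x) = Phi v - Phi u - f x * (v - u).
  move=> u0 uv; rewrite (@RintegralB _ _ _ mu `]u, v] f (fun=> f x))//; last 2 first.
  - exact: fi.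
  - exact: icst.
  have len : fine (mu `]u, v]) = v - u.
    rewrite lebesgue_measure_itv/= lte_fin; case: ltP => //= uv'.
    by apply/eqP; rewrite eq_sym subr_eq0 eq_le uv uv'.
  by rewrite PhiB// Rintegral_cst//; congr (_ - _ * _).
pose psi y := Phi y - Phi x - f x * (y - x).
have dpsi : is_derive x 1 psi 0.
  apply: (@is_derive0_integral psi (fun _ s => f s - f x)) => //.
  - by move=> y xy; rewrite intE.
  - by move=> y y0 yx; rewrite intE// /psi; ring.
  - move=> _ u v u0; rewrite (_ : _ \o _ = fun s => ((f s)%:E - (f x)%:E)%E)//.
    by apply: integrableB => //; [exact: fi|exact: icst].
  - move=> e e0; move/cvgrPdist_le : cf => /(_ e e0)/nbhs_ballP[d /= d0 hd].
    exists d => // _ s _ sx; rewrite distrC; apply: hd.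
    by rewrite /ball/= distrC.
have -> : Phi = psi + (fun y => f x * (y - x) + Phi x).
  apply/funext => y; change (Phi y = psi y + (f x * (y - x) + Phi x)).
  by rewrite /psi; ring.
have dl : is_derive x 1 (fun y => f x * (y - x) + Phi x) (f x).
  have -> : (fun y => f x * (y - x) + Phi x) = (f x \*: (fun y => y - x)) + cst (Phi x).
    by [].
  by apply: is_derive_eq; rewrite subr0 addr0 [LHS]mulr1.
by have := is_deriveD dpsi dl; rewrite add0r.
Qed.

End derivative_of_integral.

(** The two halves of the resolvent kernel, its value and its first two
derivatives in closed form. *)
Section resolvent_def.
Context {R : realType}.
Variables (m n kap : R) (g : R -> R).
Local Notation mu := (@lebesgue_measure R).

Definition int0 (x : R) := \int[mu]_(s in `]0, x]) (s `^ (- m - 1) * g s).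

Definition inty (x : R) := \int[mu]_(s in `]x, +oo[) (s `^ (- n - 1) * g s).

Definition resolvent x := kap * (x `^ m * int0 x + x `^ n * inty x).

Definition dresolvent x :=
  kap * (m * x `^ (m - 1) * int0 x + n * x `^ (n - 1) * inty x).

Definition d2resolvent x :=
  kap * (m * ((m - 1) * x `^ (m - 1 - 1)) * int0 x +
         n * ((n - 1) * x `^ (n - 1 - 1)) * inty x - (n - m) * x `^ (-1 - 1) * g x).

End resolvent_def.

Section resolvent.
Context {R : realType}.
Variables (m n kap : R) (g : R -> R).
Hypotheses (m0 : m < 0) (n0 : 0 < n) (g_incr : increasing_pos g).
Local Notation mu := (@lebesgue_measure R).
Local Notation w0 := (fun s => s `^ (- m - 1) * g s).
Local Notation wy := (fun s => s `^ (- n - 1) * g s).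
Hypothesis i0 : forall x, 0 < x -> mu.-integrable `]0, x] (EFin \o w0).
Hypothesis iy : forall x, 0 < x -> mu.-integrable `]x, +oo[ (EFin \o wy).
Local Notation I0 := (int0 m g).
Local Notation Iy := (inty n g).

Lemma int0B x y : 0 < x -> x <= y ->
  I0 y - I0 x = \int[mu]_(s in `]x, y]) (s `^ (- m - 1) * g s).
Proof.
move=> x0 xy; rewrite /int0 Rintegral_itvB ?bnd_simp ?(ltW x0)//.
exact: i0 (lt_le_trans x0 xy).
Qed.

Lemma intyB x y : 0 < x -> x <= y ->
  Iy x - Iy y = \int[mu]_(s in `]x, y]) (s `^ (- n - 1) * g s).
Proof.
move=> x0 xy.
have h : Iy x - \int[mu]_(s in `]x, y]) (s `^ (- n - 1) * g s) = Iy y.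
  by apply: Rintegral_itvB; rewrite ?bnd_simp//; exact: iy.
by rewrite -h opprB addrC subrK.
Qed.

Let wseg p x y : 0 < x -> mu.-integrable `]x, y] (EFin \o (fun s => s `^ p * g s)).
Proof. exact: integrable_weighted_oc. Qed.

Lemma is_derive_int0 x : 0 < x -> {for x, continuous g} ->
  is_derive x 1 I0 (x `^ (- m - 1) * g x).
Proof.
move=> x0 cg; apply: (@is_derive_primitive _ I0 w0) => //.
- exact: int0B.
- by move=> u v u0; exact: wseg.
- by apply: cvgM => //; exact: continuous_powR.
Qed.

Lemma is_derive_inty x : 0 < x -> {for x, continuous g} ->
  is_derive x 1 Iy (- (x `^ (- n - 1) * g x)).
Proof.
move=> x0 cg; rewrite -[Iy]opprK; apply: is_deriveN.
apply: (@is_derive_primitive _ (- Iy) wy) => //.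
- move=> u v u0 uv; change (- Iy v - - Iy u = \int[mu]_(s in `]u, v]) wy s).
  by rewrite -intyB// opprK addrC.
- by move=> u v u0; exact: wseg.
- by apply: cvgM => //; exact: continuous_powR.
Qed.

(** The two halves of the kernel agree on the diagonal, so that moving the point
from one half to the other costs nothing at first order: the jumps of [g] do not
show before the second derivative. *)
Let is_derive_kernel (x : R) : 0 < x ->
  is_derive x 1 (fun y => y `^ m * (I0 y - I0 x) + y `^ n * (Iy y - Iy x)) 0.
Proof.
move=> x0.
have diag p : x `^ p * x `^ (- p - 1) = x^-1.
  by rewrite -powRDp// addrA subrr add0r powR_inv1// ltW.
pose K y s := y `^ m * (s `^ (- m - 1) * g s) - y `^ n * (s `^ (- n - 1) * g s).
have iK p q y u v : 0 < u ->
    mu.-integrable `]u, v] (EFin \o (fun s => y `^ p * (s `^ q * g s))).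
  move=> u0; rewrite (_ : _ \o _ = fun s => ((y `^ p)%:E * (s `^ q * g s)%:E)%E)//.
  by apply: integrableZl => //; exact: wseg.
have intK y u v : 0 < u -> u <= v -> \int[mu]_(s in `]u, v]) K y s =
    y `^ m * (I0 v - I0 u) + y `^ n * (Iy v - Iy u).
  move=> u0 uv; rewrite RintegralB//; [|exact: iK..].
  rewrite !RintegralZl//; [|exact: wseg..].
  by rewrite -int0B// -intyB//; ring.
apply: (@is_derive0_integral _ _ K) => //.
- by move=> y xy; rewrite intK.
- by move=> y y0 yx; rewrite intK//; ring.
- move=> y u v u0.
  rewrite (_ : _ \o _ = fun s => ((y `^ m * (s `^ (- m - 1) * g s))%:E -
    (y `^ n * (s `^ (- n - 1) * g s))%:E)%E)//.
  by apply: integrableB => //; exact: iK.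
- move=> e e0.
  pose M := `|g (x / 2)| + `|g (x + x)| + 1.
  have M0 : 0 < M by rewrite ltr_wpDl// addr_ge0.
  have eM : 0 < e / M by rewrite divr_gt0.
  have cp p q : z.1 `^ p * z.2 `^ q @[z --> (x, x)] --> x `^ p * x `^ q.
    apply: cvgM.
      by apply: (cvg_comp (@fst R R) (fun u => u `^ p)); [exact: cvg_fst|exact: continuous_powR].
    by apply: (cvg_comp (@snd R R) (fun u => u `^ q)); [exact: cvg_snd|exact: continuous_powR].
  have : (z.1 `^ m * z.2 `^ (- m - 1) - z.1 `^ n * z.2 `^ (- n - 1))
      @[z --> (x, x)] --> (0 : R).
    rewrite -(subrr x^-1) -{1}(diag m) -(diag n).
    by apply: cvgB; exact: cp.
  move=> /cvgr0Pnorm_le/(_ _ eM)[[A B] [/= /nbhs_ballP[d1 /= d10 hA] /nbhs_ballP[d2 /= d20 hB]] hAB].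
  exists (Num.min (Num.min d1 d2) (x / 2)); first by rewrite !lt_min d10 d20 divr_gt0.
  move=> y s; rewrite !lt_min => /andP[/andP[y1 _] _] /andP[/andP[_ s2] s3].
  have sx : x / 2 <= s <= x + x.
    by move: s3; rewrite ltr_norml => /andP[h1 h2]; apply/andP; split; lra.
  have s0 : 0 < s by have /andP[h _] := sx; apply: lt_le_trans h; rewrite divr_gt0.
  have gs : `|g s| <= M.
    have /andP[s1 s4] := sx.
    have g1 : g (x / 2) <= g s by apply: g_incr => //; rewrite divr_gt0.
    have g2 : g s <= g (x + x) by apply: g_incr.
    have a1 := ler_norm (g (x + x)); have a2 := ler_norm (- g (x / 2)).
    rewrite normrN in a2; have a3 := normr_ge0 (g (x + x)); have a4 := normr_ge0 (g (x / 2)).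
    by rewrite /M ler_norml; apply/andP; split; lra.
  have hk := hAB (y, s) (conj (hA y _) (hB s _)).
  rewrite /K !mulrA -mulrBl normrM.
  rewrite (le_trans (ler_pM _ _ (hk _ _) gs))//; rewrite /ball/= ?(distrC x)//.
  by rewrite divfK// gt_eqF.
Qed.

Lemma is_derive_resolvent (x : R) : 0 < x ->
  is_derive x 1 (resolvent m n kap g) (dresolvent m n kap g x).
Proof.
move=> x0.
pose psi y := y `^ m * (I0 y - I0 x) + y `^ n * (Iy y - Iy x).
have -> : resolvent m n kap g = kap \*: (psi + ((I0 x \*: (fun y => y `^ m)) + (Iy x \*: (fun y => y `^ n)))).
  apply/funext => y; change (resolvent m n kap g y =
    kap * (psi y + (I0 x * y `^ m + Iy x * y `^ n))).
  by rewrite /resolvent /psi; ring.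
have d1 := is_derive1_powR m x0; have d2 := is_derive1_powR n x0.
have d3 : is_derive x 1 psi 0 := is_derive_kernel x0.
have d4 := is_deriveD (is_deriveZ (I0 x) d1) (is_deriveZ (Iy x) d2).
have d5 := is_deriveZ kap (is_deriveD d3 d4).
have -> : dresolvent m n kap g x = kap *: (0 + (I0 x *: (m * x `^ (m - 1)) +
    Iy x *: (n * x `^ (n - 1)))).
  change (dresolvent m n kap g x = kap * (0 + (I0 x * (m * x `^ (m - 1)) +
    Iy x * (n * x `^ (n - 1))))).
  by rewrite /dresolvent; ring.
exact: d5.
Qed.

End resolvent.

(** * Bounds on the resolvent *)

Section power_integrals.
Context {R : realType}.
Local Notation mu := (@lebesgue_measure R).

Let ge0_integrable (D : set R) (f : R -> R) : measurable D ->
  measurable_fun D f -> (forall s, 0 <= f s) ->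
  (\int[mu]_(s in D) (f s)%:E < +oo)%E -> mu.-integrable D (EFin \o f).
Proof.
move=> mD mf f0 fi; apply/integrableP; split; first exact/measurable_EFinP.
by under eq_integral do rewrite /= ger0_norm//.
Qed.

Lemma integrable_powR_0 (p x : R) : 0 < p -> 0 < x ->
  mu.-integrable `]0, x] (EFin \o (fun s : R => s `^ (p - 1))).
Proof.
move=> p0 x0; apply: ge0_integrable => //.
- exact: measurable_powR_fun.
- by move=> s; exact: powR_ge0.
- by rewrite integral_powR_0// ltry.
Qed.

Lemma Rintegral_powR_0 (p x : R) : 0 < p -> 0 < x ->
  \int[mu]_(s in `]0, x]) (s `^ (p - 1)) = x `^ p / p.
Proof. by move=> p0 x0; rewrite /Rintegral integral_powR_0. Qed.

Let integral_powR_oy (q x : R) : 0 < q -> 0 < x ->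
  (\int[mu]_(s in `]x, +oo[) (s `^ (- q - 1))%:E = (x `^ (- q) / q)%:E)%E.
Proof.
move=> q0 x0; rewrite integral_itv_obnd_cbnd ?integral_powR_y//.
by apply/measurable_EFinP; exact: measurable_powR_fun.
Qed.

Lemma integrable_powR_y (q x : R) : 0 < q -> 0 < x ->
  mu.-integrable `]x, +oo[ (EFin \o (fun s : R => s `^ (- q - 1))).
Proof.
move=> q0 x0; apply: ge0_integrable => //.
- exact: measurable_powR_fun.
- by move=> s; exact: powR_ge0.
- by rewrite integral_powR_oy// ltry.
Qed.

Lemma Rintegral_powR_y (q x : R) : 0 < q -> 0 < x ->
  \int[mu]_(s in `]x, +oo[) (s `^ (- q - 1)) = x `^ (- q) / q.
Proof. by move=> q0 x0; rewrite /Rintegral integral_powR_oy. Qed.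

Lemma Rintegral_powR_oc (p x y : R) : p != 0 -> 0 < x -> x <= y ->
  \int[mu]_(s in `]x, y]) (s `^ (p - 1)) = (y `^ p - x `^ p) / p.
Proof.
move=> p0 x0 xy; rewrite /Rintegral integral_itv_obnd_cbnd ?integral_powR_segment//.
by apply/measurable_EFinP; exact: measurable_powR_fun.
Qed.

End power_integrals.

(** The total mass of the resolvent kernel. *)
Lemma resolvent_mass {R : realType} (m n kap r : R) : m < 0 -> 0 < n -> 0 < r ->
  kap * (n - m) * r = - (m * n) -> kap * (1 / - m + 1 / n) = r^-1.
Proof.
move=> m0 n0 r0 kapr.
apply: (mulIf (lt0r_neq0 r0)); rewrite mulVf ?gt_eqF//.
have -> : kap * (1 / - m + 1 / n) * r = kap * (n - m) * r / - (m * n).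
  by field; rewrite gt_eqF// lt_eqF.
by rewrite kapr divff // oppr_eq0 mulf_neq0 ?(lt_eqF m0) ?(gt_eqF n0).
Qed.

Section resolvent_bounds.
Context {R : realType}.
Variables (m n kap r : R) (g : R -> R).
Hypotheses (m0 : m < 0) (n0 : 0 < n) (kap0 : 0 < kap) (r0 : 0 < r).
Hypothesis kapr : kap * (n - m) * r = - (m * n).
Hypothesis g_incr : increasing_pos g.
Local Notation mu := (@lebesgue_measure R).
Local Notation w0 := (fun s => s `^ (- m - 1) * g s).
Local Notation wy := (fun s => s `^ (- n - 1) * g s).
Hypothesis i0 : forall x, 0 < x -> mu.-integrable `]0, x] (EFin \o w0).
Hypothesis iy : forall x, 0 < x -> mu.-integrable `]x, +oo[ (EFin \o wy).
Local Notation I0 := (int0 m g).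
Local Notation Iy := (inty n g).

Let Nm0 : 0 < - m. Proof. by rewrite oppr_gt0. Qed.

Let sub0 (x : R) : `]0, x] `<=` `]0, +oo[.
Proof. by apply: subset_itv; rewrite ?bnd_simp. Qed.

Let suby (x : R) : 0 < x -> `]x, +oo[ `<=` `]0, +oo[.
Proof. by move=> x0; apply: subset_itv; rewrite ?bnd_simp// ltW. Qed.

Let suboc (x y : R) : 0 < x -> `]x, y] `<=` `]0, +oo[.
Proof. by move=> x0; apply: subset_itv; rewrite ?bnd_simp// ltW. Qed.

Lemma int0_le x c : 0 < x -> (forall s, 0 < s -> s <= x -> g s <= c) ->
  I0 x <= c * (x `^ (- m) / - m).
Proof.
move=> x0 gc; rewrite -Rintegral_powR_0//; apply: Rintegral_weighted_le => //.
- exact: i0.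
- exact: integrable_powR_0.
- by move=> s /=; rewrite in_itv/= => /andP[]; exact: gc.
Qed.

Lemma int0_ge x c : 0 < x -> (forall s, 0 < s -> s <= x -> c <= g s) ->
  c * (x `^ (- m) / - m) <= I0 x.
Proof.
move=> x0 gc; rewrite -Rintegral_powR_0//; apply: Rintegral_weighted_ge => //.
- exact: i0.
- exact: integrable_powR_0.
- by move=> s /=; rewrite in_itv/= => /andP[]; exact: gc.
Qed.

Lemma inty_ge x c : 0 < x -> (forall s, x < s -> c <= g s) ->
  c * (x `^ (- n) / n) <= Iy x.
Proof.
move=> x0 gc; rewrite -Rintegral_powR_y//; apply: Rintegral_weighted_ge => //.
- exact: suby.
- exact: iy.
- exact: integrable_powR_y.
- by move=> s /=; rewrite in_itv/= andbT; exact: gc.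
Qed.

Lemma int0B_ge x y c : 0 < x -> x <= y -> (forall s, x < s -> s <= y -> c <= g s) ->
  c * ((y `^ (- m) - x `^ (- m)) / - m) <= I0 y - I0 x.
Proof.
move=> x0 xy gc; rewrite -Rintegral_powR_oc// ?gt_eqF// int0B//.
apply: Rintegral_weighted_ge => //.
- exact: suboc.
- exact: integrable_weighted_oc.
- exact: integrable_powR_oc.
- by move=> s /=; rewrite in_itv/= => /andP[]; exact: gc.
Qed.

Lemma int0B_le x y c : 0 < x -> x <= y -> (forall s, x < s -> s <= y -> g s <= c) ->
  I0 y - I0 x <= c * ((y `^ (- m) - x `^ (- m)) / - m).
Proof.
move=> x0 xy gc; rewrite -Rintegral_powR_oc// ?gt_eqF// int0B//.
apply: Rintegral_weighted_le => //.
- exact: suboc.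
- exact: integrable_weighted_oc.
- exact: integrable_powR_oc.
- by move=> s /=; rewrite in_itv/= => /andP[]; exact: gc.
Qed.

Let powNn x y : (y `^ (- n) - x `^ (- n)) / - n = (x `^ (- n) - y `^ (- n)) / n.
Proof. by rewrite invrN mulrN -mulNr opprB. Qed.

Lemma intyB_ge x y c : 0 < x -> x <= y -> (forall s, x < s -> s <= y -> c <= g s) ->
  c * ((x `^ (- n) - y `^ (- n)) / n) <= Iy x - Iy y.
Proof.
move=> x0 xy gc; rewrite -powNn -Rintegral_powR_oc// ?oppr_eq0 ?gt_eqF// intyB//.
apply: Rintegral_weighted_ge => //.
- exact: suboc.
- exact: integrable_weighted_oc.
- exact: integrable_powR_oc.
- by move=> s /=; rewrite in_itv/= => /andP[]; exact: gc.
Qed.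

Lemma intyB_le x y c : 0 < x -> x <= y -> (forall s, x < s -> s <= y -> g s <= c) ->
  Iy x - Iy y <= c * ((x `^ (- n) - y `^ (- n)) / n).
Proof.
move=> x0 xy gc; rewrite -powNn -Rintegral_powR_oc// ?oppr_eq0 ?gt_eqF// intyB//.
apply: Rintegral_weighted_le => //.
- exact: suboc.
- exact: integrable_weighted_oc.
- exact: integrable_powR_oc.
- by move=> s /=; rewrite in_itv/= => /andP[]; exact: gc.
Qed.

Let kaprE := resolvent_mass m0 n0 r0 kapr.

(** The resolvent of a constant [c] is [c / r], and the kernel is nonnegative. *)
Lemma resolvent_ge x c : 0 < x -> (forall s, 0 < s -> c <= g s) ->
  c / r <= resolvent m n kap g x.
Proof.
move=> x0 gc.
have a1 : c * (x `^ (- m) / - m) <= I0 x by apply: int0_ge => // s s0 _; exact: gc.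
have a2 : c * (x `^ (- n) / n) <= Iy x.
  by apply: inty_ge => // s xs; apply: gc; exact: lt_trans xs.
have -> : c / r = kap * (x `^ m * (c * (x `^ (- m) / - m)) +
    x `^ n * (c * (x `^ (- n) / n))).
  rewrite -kaprE; transitivity (kap * (x `^ m * x `^ (- m) * (c / - m) +
    x `^ n * x `^ (- n) * (c / n))); last by ring.
  by rewrite !powRxN//; ring.
by rewrite /resolvent ler_pM2l// lerD// ler_wpM2l ?powR_ge0.
Qed.

(** Near 0 the resolvent is governed by the values of [g] near 0. *)
Lemma resolvent_le_near0 d c : 0 < d -> (forall s, 0 < s -> s <= d -> g s <= c) ->
  exists M : R, forall x : R, 0 < x -> x <= d ->
    resolvent m n kap g x <= c / r + M * x `^ n.
Proof.
move=> d0 gc; exists (kap * (Iy d - c * (d `^ (- n) / n))) => x x0 xd.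
have a1 : I0 x <= c * (x `^ (- m) / - m).
  by apply: int0_le => // s s0 sx; apply: gc => //; exact: le_trans xd.
have a2 : Iy x <= c * ((x `^ (- n) - d `^ (- n)) / n) + Iy d.
  rewrite -lerBlDr; apply: intyB_le => // s xs; apply: gc; exact: lt_trans xs.
have -> : c / r + kap * (Iy d - c * (d `^ (- n) / n)) * x `^ n =
   kap * (x `^ m * (c * (x `^ (- m) / - m)) +
    x `^ n * (c * ((x `^ (- n) - d `^ (- n)) / n) + Iy d)).
  rewrite -kaprE; transitivity (kap * (x `^ m * x `^ (- m) * (c / - m) +
    x `^ n * x `^ (- n) * (c / n)) + kap * (Iy d - c * (d `^ (- n) / n)) * x `^ n); last by ring.
  by rewrite !powRxN//; ring.
by rewrite /resolvent ler_pM2l// lerD// ler_wpM2l ?powR_ge0.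
Qed.

(** The derivative vanishes for constant [g].  Compared with the constant [g x],
[g] is smaller to the left of [x], where the kernel of the derivative is
negative, and larger to the right, where it is positive. *)
Lemma dresolvent_ge0 x : 0 < x -> 0 <= dresolvent m n kap g x.
Proof.
move=> x0.
have a1 : I0 x <= g x * (x `^ (- m) / - m) by apply: int0_le => // s s0 sx; exact: g_incr.
have a2 : g x * (x `^ (- n) / n) <= Iy x.
  by apply: inty_ge => // s xs; apply: g_incr => //; exact: ltW.
rewrite /dresolvent; apply: mulr_ge0; first exact: ltW.
have -> : 0 = m * x `^ (m - 1) * (g x * (x `^ (- m) / - m)) +
    n * x `^ (n - 1) * (g x * (x `^ (- n) / n)).
  rewrite !powRB1//.
  transitivity (x^-1 * ((x `^ m * x `^ (- m)) * (m / - m) + x `^ n * x `^ (- n) * (n / n)) * g x); last by ring.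
  have em : m / - m = -1 by rewrite invrN mulrN divff// lt_eqF.
  by rewrite !powRxN// em divff ?gt_eqF//; ring.
apply: lerD.
  by rewrite ler_wnM2l// mulr_le0_ge0 ?powR_ge0// ltW.
by rewrite ler_wpM2l// mulr_ge0 ?powR_ge0// ltW.
Qed.

Lemma increasing_resolvent : increasing_pos (resolvent m n kap g).
Proof.
apply: (@nondecreasing_pos _ _ (dresolvent m n kap g)) => x x0.
  exact: is_derive_resolvent.
exact: dresolvent_ge0.
Qed.

End resolvent_bounds.

(** * Second derivatives and the differential equation *)

Lemma continuous_dominated {R : realType} (f u : R -> R) (x M : R) : 0 <= M ->
  (\forall y \near x, `|f y - f x| <= M * `|u y - u x|) ->
  {for x, continuous u} -> {for x, continuous f}.
Proof.
move=> M0 fu /cvgrPdist_lt cu; apply/cvgrPdist_lt => e e0.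
have M1 : 0 < M + 1 by rewrite ltr_wpDl.
have := cu (e / (M + 1)) (divr_gt0 e0 M1); apply: filterS2 fu => y fu h.
rewrite distrC; apply: le_lt_trans fu _; rewrite distrC in h.
apply: le_lt_trans (_ : (M + 1) * `|u y - u x| < e).
  by rewrite ler_wpM2r// lerDl.
by rewrite mulrC -ltr_pdivlMr.
Qed.

Section resolvent_smoothness.
Context {R : realType}.
Variables (m n kap : R) (g : R -> R).
Hypotheses (m0 : m < 0) (n0 : 0 < n) (g_incr : increasing_pos g).
Local Notation mu := (@lebesgue_measure R).
Hypothesis i0 : forall x, 0 < x ->
  mu.-integrable `]0, x] (EFin \o (fun s => s `^ (- m - 1) * g s)).
Hypothesis iy : forall x, 0 < x ->
  mu.-integrable `]x, +oo[ (EFin \o (fun s => s `^ (- n - 1) * g s)).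
Local Notation I0 := (int0 m g).
Local Notation Iy := (inty n g).

Let g_local_bound x : 0 < x -> exists2 M, 0 <= M &
  forall s, x / 2 <= s -> s <= x + x -> - M <= g s /\ g s <= M.
Proof.
move=> x0; exists (`|g (x / 2)| + `|g (x + x)|); first exact: addr_ge0.
move=> s s1 s2; have x2 : 0 < x / 2 by rewrite divr_gt0.
have g1 : g (x / 2) <= g s by apply: g_incr.
have g2 : g s <= g (x + x) by apply: g_incr => //; exact: lt_le_trans s1.
have a1 := ler_norm (g (x + x)); have a2 := ler_norm (- g (x / 2)).
rewrite normrN in a2; have a3 := normr_ge0 (g (x + x)).
by have a4 := normr_ge0 (g (x / 2)); split; lra.
Qed.

Lemma continuous_int0 x : 0 < x -> {for x, continuous I0}.
Proof.
move=> x0; have [M M0 gM] := g_local_bound x0.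
have cu : {for x, continuous (fun s : R => s `^ (- m) / - m)}.
  by apply: cvgMl; exact: continuous_powR.
apply: (continuous_dominated M0 _ cu).
have x2 : 0 < x / 2 by rewrite divr_gt0.
apply/nbhs_ballP; exists (x / 2) => //= y; rewrite /ball/= ltr_norml => /andP[y1 y2].
have bnd u v : x / 2 <= u -> u <= v -> v <= x + x ->
    `|I0 v - I0 u| <= M * `|v `^ (- m) / - m - u `^ (- m) / - m|.
  move=> xu uv vx; have u0 : 0 < u by exact: lt_le_trans xu.
  rewrite -mulrBl; apply: le_trans (ler_wpM2l M0 (ler_norm _)).
  rewrite ler_norml -mulNr; apply/andP; split.
    apply: int0B_ge => // s us sv.
    by apply: (gM s _ _).1; lra.
  apply: int0B_le => // s us sv.
  by apply: (gM s _ _).2; lra.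
have [xy|/ltW yx] := leP x y; first by apply: bnd => //; lra.
by rewrite distrC [X in _ * X]distrC; apply: bnd => //; lra.
Qed.

Lemma continuous_inty x : 0 < x -> {for x, continuous Iy}.
Proof.
move=> x0; have [M M0 gM] := g_local_bound x0.
have cu : {for x, continuous (fun s : R => s `^ (- n) / n)}.
  by apply: cvgMl; exact: continuous_powR.
apply: (continuous_dominated M0 _ cu).
have x2 : 0 < x / 2 by rewrite divr_gt0.
apply/nbhs_ballP; exists (x / 2) => //= y; rewrite /ball/= ltr_norml => /andP[y1 y2].
have bnd u v : x / 2 <= u -> u <= v -> v <= x + x ->
    `|Iy u - Iy v| <= M * `|u `^ (- n) / n - v `^ (- n) / n|.
  move=> xu uv vx; have u0 : 0 < u by exact: lt_le_trans xu.
  rewrite -mulrBl; apply: le_trans (ler_wpM2l M0 (ler_norm _)).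
  rewrite ler_norml -mulNr; apply/andP; split.
    apply: intyB_ge => // s us sv.
    by apply: (gM s _ _).1; lra.
  apply: intyB_le => // s us sv.
  by apply: (gM s _ _).2; lra.
have [/ltW xy|yx] := ltP x y; last by apply: bnd => //; lra.
by rewrite distrC [X in _ * X]distrC; apply: bnd => //; lra.
Qed.

Lemma continuous_scaler (c x : R) (f : R -> R) : {for x, continuous f} ->
  {for x, continuous (fun s => c * f s)}.
Proof. by move=> cf; apply: cvgMr. Qed.

Lemma continuous_dresolvent x : 0 < x ->
  {for x, continuous (dresolvent m n kap g)}.
Proof.
move=> x0; have cp c p : {for x, continuous (fun s : R => c * s `^ p)} :=
  @continuous_scaler c x _ (@continuous_powR R p x x0).
exact: (@continuous_scaler kap x _ (cvgD (cvgM (cp m (m - 1)) (continuous_int0 x0))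
                        (cvgM (cp n (n - 1)) (continuous_inty x0)))).
Qed.

Lemma continuous_d2resolvent x : 0 < x -> {for x, continuous g} ->
  {for x, continuous (d2resolvent m n kap g)}.
Proof.
move=> x0 cg; have cp c p : {for x, continuous (fun s : R => c * s `^ p)} :=
  @continuous_scaler c x _ (@continuous_powR R p x x0).
exact: (@continuous_scaler kap x _ (cvgB (cvgD
  (cvgM (@continuous_scaler m x _ (cp (m - 1) (m - 1 - 1))) (continuous_int0 x0))
  (cvgM (@continuous_scaler n x _ (cp (n - 1) (n - 1 - 1))) (continuous_inty x0)))
  (cvgM (cp (n - m) (- 1 - 1)) cg))).
Qed.

Lemma is_derive_dresolvent (x : R) : 0 < x -> {for x, continuous g} ->
  is_derive x 1 (dresolvent m n kap g) (d2resolvent m n kap g x).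
Proof.
move=> x0 cg.
have d1 := is_derive1_powR (m - 1) x0; have d2 := is_derive1_powR (n - 1) x0.
have e1 : is_derive x 1 I0 (x `^ (- m - 1) * g x) by exact: is_derive_int0.
have e2 : is_derive x 1 Iy (- (x `^ (- n - 1) * g x)) by exact: is_derive_inty.
have -> : dresolvent m n kap g =
   kap \*: (m \*: ((fun s => s `^ (m - 1)) * I0) + n \*: ((fun s => s `^ (n - 1)) * Iy)).
  apply/funext => y; change (dresolvent m n kap g y =
    kap * (m * (y `^ (m - 1) * I0 y) + n * (y `^ (n - 1) * Iy y))).
  by rewrite /dresolvent; ring.
have := is_deriveZ kap (is_deriveD (is_deriveZ m (is_deriveM d1 e1))
                                   (is_deriveZ n (is_deriveM d2 e2))).
set l := (X in is_derive _ _ _ X -> _); suff -> : d2resolvent m n kap g x = l by [].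
have diag p : x `^ (p - 1) * x `^ (- p - 1) = x `^ (- 1 - 1).
  by rewrite -powRDp//; congr (_ `^ _); ring.
transitivity (kap * (m * (x `^ (m - 1) * (x `^ (- m - 1) * g x) +
     I0 x * ((m - 1) * x `^ (m - 1 - 1))) +
   n * (x `^ (n - 1) * - (x `^ (- n - 1) * g x) +
     Iy x * ((n - 1) * x `^ (n - 1 - 1))))); last by [].
rewrite mulrN [x `^ (m - 1) * (_ * _)]mulrA [x `^ (n - 1) * (_ * _)]mulrA !diag.
by rewrite /d2resolvent; ring.
Qed.

End resolvent_smoothness.

(** The resolvent inverts the Euler operator with roots [m] and [n]. *)
Lemma resolvent_ode {R : realType} (m n kap a b r : R) (g : R -> R) (x : R) :
  0 < x -> a * m * (m - 1) + b * m = r -> a * n * (n - 1) + b * n = r ->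
  a * (kap * (n - m)) = 1 ->
  a * x ^+ 2 * d2resolvent m n kap g x + b * x * dresolvent m n kap g x
    - r * resolvent m n kap g x + g x = 0.
Proof.
move=> x0 hm hn hk.
have xx : x * x^-1 = 1 by rewrite divff// gt_eqF.
rewrite /d2resolvent /dresolvent /resolvent.
rewrite !powRB1// powR_inv1 ?(ltW x0)//.
set A := int0 _ _ _; set B := inty _ _ _; set u := x `^ m; set v := x `^ n.
transitivity (kap * u * A * ((x * x^-1) ^+ 2 * (a * m * (m - 1)) + (x * x^-1) * (b * m) - r)
   + kap * v * B * ((x * x^-1) ^+ 2 * (a * n * (n - 1)) + (x * x^-1) * (b * n) - r)
   + (1 - (x * x^-1) ^+ 2 * (a * (kap * (n - m)))) * g x); first by ring.
by rewrite xx expr1n !mul1r hm hn hk !subrr; ring.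
Qed.

Section smooth_functions.
Context {R : realType}.
Implicit Types (f g w dw d2w : R -> R) (A E : set R) (x : R).

Let within_continuous_eq A f g : (forall x, A x -> f x = g x) ->
  (forall x, A x -> {for x, continuous g}) -> {within A, continuous f}.
Proof.
move=> fg cg; apply/(subspace_continuousP A f) => x Ax.
have h : g y @[y --> within A (nbhs x)] --> f x.
  by rewrite (fg x Ax); exact: cvg_within_filter (cg x Ax).
apply: cvg_trans h.
apply: near_eq_cvg; apply: (filterS _ (withinT A (nbhs_filter x))) => y Ay.
exact/esym/fg.
Qed.

Lemma derive1_pos w dw x : (forall x, 0 < x -> is_derive x 1 w (dw x)) -> 0 < x ->
  (w^`())%classic x = dw x.
Proof. by move=> h x0; rewrite derive1E; exact: (@derive_val _ _ _ _ _ _ _ (h x x0)). Qed.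

Lemma C1_posI w dw : (forall x, 0 < x -> is_derive x 1 w (dw x)) ->
  (forall x, 0 < x -> {for x, continuous dw}) -> C1_pos w.
Proof.
move=> h c; split=> [x x0|]; first exact: (@ex_derive _ _ _ _ _ _ _ (h x x0)).
apply: (@within_continuous_eq _ _ dw) => x /=; rewrite in_itv/= andbT => x0.
  exact: derive1_pos.
exact: c.
Qed.

Lemma is_derive_derive1_pos w dw d2w x :
  (forall x, 0 < x -> is_derive x 1 w (dw x)) -> 0 < x ->
  is_derive x 1 dw (d2w x) -> is_derive x 1 (w^`())%classic (d2w x).
Proof.
move=> h x0; apply: near_eq_is_derive.
by near=> y; rewrite (derive1_pos h)//; near: y; exact: lt_nbhsr.
Unshelve. all: by end_near. Qed.

Lemma derive2_pos w dw d2w x :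
  (forall x, 0 < x -> is_derive x 1 w (dw x)) -> 0 < x ->
  is_derive x 1 dw (d2w x) -> (w^`(2))%classic x = d2w x.
Proof.
move=> h x0 h2; rewrite derive1nS derive1n1 derive1E.
exact: (@derive_val _ _ _ _ _ _ _ (is_derive_derive1_pos h x0 h2)).
Qed.

(** [E] may be dense; it is enough that [d2w], as a function on the whole half-line,
is continuous at the points outside [E]. *)
Lemma C2_pos_offI E w dw d2w : (forall x, 0 < x -> is_derive x 1 w (dw x)) ->
  (forall x, 0 < x -> ~ E x -> is_derive x 1 dw (d2w x)) ->
  (forall x, 0 < x -> ~ E x -> {for x, continuous d2w}) -> C2_pos_off E w.
Proof.
move=> h h2 c; split=> [x x0 Ex|].
  exact: (@ex_derive _ _ _ _ _ _ _ (is_derive_derive1_pos h x0 (h2 x x0 Ex))).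
apply: (@within_continuous_eq _ _ d2w) => x /= [].
  rewrite in_itv/= andbT => x0 Ex; exact: derive2_pos (h2 x x0 Ex).
by rewrite in_itv/= andbT; exact: c.
Qed.

End smooth_functions.

(** * The threshold *)

Section shift.
Context {R : realType}.
Variables (m n kap r c : R) (h : R -> R).
Hypotheses (m0 : m < 0) (n0 : 0 < n) (r0 : 0 < r).
Hypothesis kapr : kap * (n - m) * r = - (m * n).
Local Notation mu := (@lebesgue_measure R).
Local Notation g := (fun s => h s - c).

Let mulrB' p : (fun s => s `^ p * g s) = (fun s => s `^ p * h s - c * s `^ p).
Proof. by apply/funext => s; rewrite mulrBr [c * _]mulrC. Qed.

Let integrableZ (D : set R) p : measurable D -> mu.-integrable D (EFin \o (fun s => s `^ p)) ->
  mu.-integrable D (EFin \o (fun s => c * s `^ p)).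
Proof.
move=> mD ip; rewrite (_ : _ \o _ = fun s => (c%:E * (s `^ p)%:E)%E)//.
exact: integrableZl.
Qed.

Let integrable_shift (D : set R) p : measurable D ->
  mu.-integrable D (EFin \o (fun s => s `^ p)) ->
  mu.-integrable D (EFin \o (fun s => s `^ p * h s)) <->
  mu.-integrable D (EFin \o (fun s => s `^ p * g s)).
Proof.
move=> mD ip; have icp := integrableZ mD ip; split => ih.
  rewrite mulrB' (_ : _ \o _ = fun s => ((s `^ p * h s)%:E - (c * s `^ p)%:E)%E)//.
  exact: integrableB.
have -> : (fun s => s `^ p * h s) = (fun s => s `^ p * g s + c * s `^ p).
  by apply/funext => s; rewrite mulrBr [c * _]mulrC subrK.
rewrite (_ : _ \o _ = fun s => ((s `^ p * g s)%:E + (c * s `^ p)%:E)%E)//.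
exact: integrableD.
Qed.

Let Rintegral_shift (D : set R) p : measurable D ->
  mu.-integrable D (EFin \o (fun s => s `^ p)) ->
  mu.-integrable D (EFin \o (fun s => s `^ p * h s)) ->
  \int[mu]_(s in D) (s `^ p * g s) =
  \int[mu]_(s in D) (s `^ p * h s) - c * \int[mu]_(s in D) (s `^ p).
Proof.
move=> mD ip ih; have icp := integrableZ mD ip.
by rewrite mulrB' RintegralB// RintegralZl.
Qed.

Lemma integrable_shift0 x : 0 < x ->
  mu.-integrable `]0, x] (EFin \o (fun s => s `^ (- m - 1) * h s)) <->
  mu.-integrable `]0, x] (EFin \o (fun s => s `^ (- m - 1) * g s)).
Proof.
by move=> x0; apply: integrable_shift => //; apply: integrable_powR_0; rewrite ?oppr_gt0.
Qed.

Lemma integrable_shifty x : 0 < x ->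
  mu.-integrable `]x, +oo[ (EFin \o (fun s => s `^ (- n - 1) * h s)) <->
  mu.-integrable `]x, +oo[ (EFin \o (fun s => s `^ (- n - 1) * g s)).
Proof. by move=> x0; apply: integrable_shift => //; exact: integrable_powR_y. Qed.

Hypothesis i0 : forall x, 0 < x ->
  mu.-integrable `]0, x] (EFin \o (fun s => s `^ (- m - 1) * h s)).
Hypothesis iy : forall x, 0 < x ->
  mu.-integrable `]x, +oo[ (EFin \o (fun s => s `^ (- n - 1) * h s)).

Let int0_shift (x : R) : 0 < x -> int0 m g x = int0 m h x - c * (x `^ (- m) / - m).
Proof.
have Nm0 : 0 < - m by rewrite oppr_gt0.
move=> x0; rewrite /int0 Rintegral_shift ?Rintegral_powR_0//.
  exact: integrable_powR_0.
exact: i0.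
Qed.

Let inty_shift (x : R) : 0 < x -> inty n g x = inty n h x - c * (x `^ (- n) / n).
Proof.
move=> x0; rewrite /inty Rintegral_shift ?Rintegral_powR_y//.
  exact: integrable_powR_y.
exact: iy.
Qed.

(** [c / r] is the resolvent of [c]. *)
Lemma resolvent_shift (x : R) : 0 < x ->
  resolvent m n kap g x = resolvent m n kap h x - c / r.
Proof.
move=> x0; rewrite /resolvent int0_shift// inty_shift//.
have a := powRxN m x0; have b := powRxN n x0.
have e := resolvent_mass m0 n0 r0 kapr.
transitivity (kap * (x `^ m * int0 m h x + x `^ n * inty n h x) -
  c * (kap * (x `^ m * x `^ (- m) / - m + x `^ n * x `^ (- n) / n))); first by ring.
by rewrite a b e.
Qed.

End shift.

Section threshold.
Context {R : realType}.
Variables (m n kap r : R) (g : R -> R).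
Hypotheses (m0 : m < 0) (n0 : 0 < n) (kap0 : 0 < kap) (r0 : 0 < r).
Hypothesis kapr : kap * (n - m) * r = - (m * n).
Hypothesis g_incr : increasing_pos g.
Local Notation mu := (@lebesgue_measure R).
Hypothesis i0 : forall x, 0 < x ->
  mu.-integrable `]0, x] (EFin \o (fun s => s `^ (- m - 1) * g s)).
Hypothesis iy : forall x, 0 < x ->
  mu.-integrable `]x, +oo[ (EFin \o (fun s => s `^ (- n - 1) * g s)).
Local Notation I0 := (int0 m g).
Local Notation Iy := (inty n g).

Let Nm0 : 0 < - m. Proof. by rewrite oppr_gt0. Qed.

Let pow_lt p (x y : R) : 0 < p -> 0 < x -> x < y -> x `^ p < y `^ p.
Proof.
by move=> p0 x0 xy; rewrite gt0_ltr_powR// ?nnegrE ltW//; exact: lt_trans xy.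
Qed.

Lemma int0_nondecreasing x y : 0 < x -> x <= y -> 0 <= g x -> I0 x <= I0 y.
Proof.
move=> x0 xy gx; rewrite -subr_ge0.
have := @int0B_ge _ m g m0 g_incr i0 x y 0 x0 xy; rewrite mul0r; apply => s xs _.
by apply: le_trans gx _; apply: g_incr => //; exact: ltW.
Qed.

Lemma int0_lt0 x : 0 < x -> g x < 0 -> I0 x < 0.
Proof.
move=> x0 gx; apply: le_lt_trans (_ : g x * (x `^ (- m) / - m) < 0).
  by apply: int0_le => // s s0 sx; exact: g_incr.
by rewrite nmulr_rlt0// divr_gt0// powR_gt0.
Qed.

(** At a zero of the increasing weight's primitive the weight itself has become
positive, since it starts out negative. *)
Lemma gt0_at_root a : (exists2 x, 0 < x & g x < 0) -> 0 < a -> I0 a = 0 -> 0 < g a.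
Proof.
move=> [x x0 gx] a0 Ia; rewrite ltNge; apply/negP => ga.
have [ax|/ltW xa] := leP a x.
  by have := int0_lt0 a0 (le_lt_trans (g_incr a0 ax) gx); rewrite Ia ltxx.
have : I0 a - I0 x <= 0.
  have := @int0B_le _ m g m0 g_incr i0 x a 0 x0 xa; rewrite mul0r; apply => s xs sa.
  by apply: le_trans ga; apply: g_incr => //; exact: lt_trans xs.
by rewrite Ia sub0r oppr_le0 leNgt int0_lt0.
Qed.

(** Beyond a zero [g] is bounded below by a positive constant, and [int0] increases
strictly. *)
Lemma root_unique a a' : (exists2 x, 0 < x & g x < 0) ->
  0 < a -> I0 a = 0 -> 0 < a' -> I0 a' = 0 -> a' = a.
Proof.
move=> gneg.
have aux u v : 0 < u -> u < v -> I0 u = 0 -> I0 v <> 0.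
  move=> u0 uv Iu Iv; have gu := gt0_at_root gneg u0 Iu.
  have : g u * ((v `^ (- m) - u `^ (- m)) / - m) <= I0 v - I0 u.
    by apply: int0B_ge => //; [exact: ltW|move=> s us _; apply: g_incr => //; exact: ltW].
  by rewrite Iu Iv subrr leNgt mulr_gt0// divr_gt0// subr_gt0 pow_lt.
move=> a0 Ia a'0 Ia'; case: (ltgtP a' a) => // aa.
  by have := aux _ _ a'0 aa Ia'.
by have := aux _ _ a0 aa Ia.
Qed.

(** [int0] is negative where [g] is, and tends to infinity since [g] eventually
exceeds a positive constant. *)
Lemma root_exists : (exists2 x, 0 < x & g x < 0) -> (exists2 x, 0 < x & 0 < g x) ->
  exists2 a, 0 < a & I0 a = 0.
Proof.
move=> [x x0 gx] [z z0 gz].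
pose L := (- I0 z / (g z) * (- m)) + z `^ (- m).
pose y := Num.max (Num.max x z) (Num.max L 0 `^ (- m)^-1).
have zy : z <= y by rewrite !le_max lexx orbT.
have xy : x <= y by rewrite !le_max lexx.
have y0 : 0 < y by exact: lt_le_trans zy.
have Ly : L <= y `^ (- m).
  apply: le_trans (_ : (Num.max L 0 `^ (- m)^-1) `^ (- m) <= _).
    by rewrite -powRrM mulVf ?gt_eqF// powRr1 ?le_max ?lexx ?orbT.
  by rewrite ge0_ler_powR ?nnegrE ?powR_ge0 ?(ltW y0) ?(ltW Nm0)// le_max lexx orbT.
have Iy0 : 0 <= I0 y.
  have : g z * ((y `^ (- m) - z `^ (- m)) / - m) <= I0 y - I0 z.
    by apply: int0B_ge => // s zs _; apply: g_incr => //; exact: ltW.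
  have : - I0 z <= g z * ((y `^ (- m) - z `^ (- m)) / - m).
    by rewrite mulrC -ler_pdivrMr// ler_pdivlMr// lerBrDr.
  lra.
have Ix0 : I0 x <= 0 by exact/ltW/int0_lt0.
have cI : {within `[x, y], continuous I0}.
  apply: continuous_in_subspaceT => s /set_mem/=; rewrite in_itv/= => /andP[xs _].
  by apply: continuous_int0 => //; exact: lt_le_trans xs.
have [|c] := IVT xy cI (v := 0).
  by rewrite ge_min le_max Ix0 Iy0 orbT.
by rewrite in_itv/= => /andP[xc _] Ic; exists c => //; exact: lt_le_trans xc.
Qed.

Section at_root.
Variable a : R.
Hypotheses (gneg : exists2 x, 0 < x & g x < 0) (a0 : 0 < a) (Ia : I0 a = 0).
Local Notation B := (kap * Iy a).

Lemma int0_le0 x : 0 < x -> x <= a -> I0 x <= 0.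
Proof.
move=> x0 xa; have [gx|gx] := ltP (g x) 0; first exact/ltW/int0_lt0.
by rewrite -Ia; exact: int0_nondecreasing.
Qed.

Lemma inty_root_gt0 : 0 < B.
Proof.
apply: mulr_gt0 => //; apply: lt_le_trans (_ : g a * (a `^ (- n) / n) <= _).
  by rewrite mulr_gt0 ?(gt0_at_root gneg)// divr_gt0// powR_gt0.
by apply: inty_ge => // s sa; apply: g_incr => //; exact: ltW.
Qed.

Lemma resolvent_root : resolvent m n kap g a = B * a `^ n.
Proof. by rewrite /resolvent Ia; ring. Qed.

Lemma dresolvent_root : dresolvent m n kap g a = B * (n * a `^ (n - 1)).
Proof. by rewrite /dresolvent Ia; ring. Qed.

(** [resolvent x / x `^ n] is nondecreasing as long as [int0] stays nonpositive:
its derivative is a positive multiple of [- int0 x]. *)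
Lemma resolvent_le_root (x : R) : 0 < x -> x <= a -> resolvent m n kap g x <= B * x `^ n.
Proof.
move=> x0 xa.
pose q y := y `^ (- n) * resolvent m n kap g y.
pose dq y := kap * (m - n) * y `^ (m - n - 1) * I0 y.
have dqE (y : R) : 0 < y -> is_derive y 1 q (dq y).
  move=> y0; have d1 := is_derive1_powR (- n) y0.
  have d2 : is_derive y 1 (resolvent m n kap g) (dresolvent m n kap g y).
    exact: is_derive_resolvent.
  have := is_deriveM d1 d2.
  set l := (X in is_derive _ _ _ X -> _); suff -> : dq y = l by [].
  transitivity (y `^ (- n) * dresolvent m n kap g y +
    resolvent m n kap g y * (- n * y `^ (- n - 1))); last by [].
  rewrite /dresolvent /resolvent /dq.
  have e1 : y `^ (- n) * y `^ (m - 1) = y `^ (m - n - 1) by rewrite -powRDp//; congr (_ `^ _); ring.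
  have e2 : y `^ m * y `^ (- n - 1) = y `^ (m - n - 1) by rewrite -powRDp//; congr (_ `^ _); ring.
  have e3 : y `^ (- n) * y `^ (n - 1) = y `^ (- 1) by rewrite -powRDp//; congr (_ `^ _); ring.
  have e4 : y `^ n * y `^ (- n - 1) = y `^ (- 1) by rewrite -powRDp//; congr (_ `^ _); ring.
  transitivity (kap * (m * (y `^ (- n) * y `^ (m - 1)) * I0 y +
     n * (y `^ (- n) * y `^ (n - 1)) * Iy y) -
     kap * n * (y `^ m * y `^ (- n - 1) * I0 y + y `^ n * y `^ (- n - 1) * Iy y)); last by ring.
  by rewrite e1 e2 e3 e4; ring.
have : q x <= q a.
  have [] := @MVT_segment _ q dq x a xa.
  - by move=> z; rewrite in_itv/= => /andP[xz _]; apply: dqE; exact: lt_trans xz.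
  - apply: continuous_in_subspaceT => z /set_mem/=; rewrite in_itv/= => /andP[xz _].
    have h := dqE z (lt_le_trans x0 xz).
    by apply: (@differentiable_continuous _ R R); apply/derivable1_diffP/(@ex_derive _ _ _ _ _ _ _ h).
  - move=> z; rewrite in_itv/= => /andP[xz za] /eqP; rewrite subr_eq => /eqP ->.
    rewrite lerDr mulr_ge0 ?subr_ge0//.
    apply: mulr_le0; last by apply: int0_le0 => //; exact: lt_le_trans xz.
    rewrite mulr_le0_ge0 ?powR_ge0// pmulr_rle0// subr_le0 ltW//.
    exact: lt_trans n0.
rewrite {2}/q resolvent_root mulrCA [a `^ _ * _]mulrC powRxN// mulr1 /q => qB.
rewrite -(ler_pM2l (_ : 0 < x `^ (- n))) ?powR_gt0// (le_trans qB)//.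
by rewrite mulrCA [x `^ _ * _]mulrC powRxN// mulr1.
Qed.

(** The difference of the two functions is the integral of [g] against a nonnegative
kernel of mass at most [1 / r], and [c] is not positive. *)
Lemma resolvent_ge_root x c : 0 < x -> x <= a -> c <= 0 -> (forall s, 0 < s -> c <= g s) ->
  c / r + B * x `^ n <= resolvent m n kap g x.
Proof.
move=> x0 xa c0 gc.
have a1 : c * (x `^ (- m) / - m) <= I0 x by apply: int0_ge => // s s0 _; exact: gc.
have a2 : c * ((x `^ (- n) - a `^ (- n)) / n) <= Iy x - Iy a.
  by apply: intyB_ge => // s xs _; apply: gc; exact: lt_trans xs.
have a3 : c * (x `^ (- n) / n) <= Iy x - Iy a.
  apply: le_trans a2; rewrite ler_wnM2l// ler_pM2r ?invr_gt0//.
  by rewrite gerBl powR_ge0.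
have e := resolvent_mass m0 n0 r0 kapr.
have -> : c / r + B * x `^ n = kap * (x `^ m * (c * (x `^ (- m) / - m)) +
    x `^ n * (c * (x `^ (- n) / n) + Iy a)).
  rewrite -e; transitivity (kap * (x `^ m * x `^ (- m) * (c / - m) +
    x `^ n * x `^ (- n) * (c / n)) + B * x `^ n); last by ring.
  by rewrite !powRxN//; ring.
rewrite /resolvent ler_pM2l// lerD// ler_wpM2l ?powR_ge0//.
by rewrite -lerBrDr.
Qed.

End at_root.

End threshold.

(** * Behaviour at zero *)

Section at_zero.
Context {R : realType}.
Implicit Types h : R -> R.
Local Notation mu := (@lebesgue_measure R).

Let h_at0E h : increasing_pos h ->
  h_at0 h = ereal_inf [set (h x)%:E | x in `]0, +oo[].
Proof.
move=> hi; apply/cvg_lim => //.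
apply: (@nondecreasing_at_right_cvge _ (fun x => (h x)%:E) 0 +oo%O) => //.
by move=> x y; rewrite !in_itv/= !andbT => x0 _ xy; rewrite lee_fin hi.
Qed.

Lemma h_at0_le h x : increasing_pos h -> 0 < x -> (h_at0 h <= (h x)%:E)%E.
Proof.
move=> hi x0; rewrite h_at0E//; apply: ereal_inf_lbound.
by exists x => //=; rewrite in_itv/= x0.
Qed.

Lemma h_at0_ge h c : increasing_pos h -> (forall x, 0 < x -> (c <= (h x)%:E)%E) ->
  (c <= h_at0 h)%E.
Proof.
move=> hi hc; rewrite h_at0E//; apply: le_ereal_inf_tmp => _ [x /= x0 <-].
by apply: hc; move: x0; rewrite in_itv/= andbT.
Qed.

Lemma h_at0_lt h c : increasing_pos h -> (h_at0 h < c)%E ->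
  exists2 x, 0 < x & ((h x)%:E < c)%E.
Proof.
move=> hi hc; apply: contrapT => hx; move: hc; rewrite ltNge => /negP; apply.
apply: h_at0_ge => // x x0; rewrite leNgt; apply/negP => hxc.
by apply: hx; exists x.
Qed.

(** An increasing right-continuous function jumps at countably many points, so
that no interval consists of exceptional points only. *)
Lemma regular_point h (S : set R) (d : R) : increasing_pos h ->
  (forall x, 0 < x -> h y @[y --> x^'+] --> h x) -> finite_set S -> 0 < d ->
  exists x, [/\ 0 < x, x < d & ~ (S `|` discontinuities h) x].
Proof.
move=> hi hr Sfin d0; apply: contrapT => nox.
pose D : set R := [set x | x \in (`]d / 2, d[) /\ discontinuity h x].
have cD : countable D.
  apply: discontinuity_countable => x y; rewrite !in_itv/= => /andP[x0 _] _; apply: hi.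
  by apply: lt_le_trans x0; rewrite divr_gt0.
have sub : `]d / 2, d[%classic `<=` S `|` D.
  move=> x /= xd; have := xd; rewrite in_itv/= => /andP[x1 x2].
  have x0 : 0 < x by apply: lt_trans x1; rewrite divr_gt0.
  have [Sx|nSx] := pselect (S x); first by left.
  right; split => //.
  have nc : ~ {for x, continuous h}.
    by move=> cx; apply: nox; exists x; split => //; case=> [//|[_ ncx]]; exact: ncx.
  have cl : cvg (h y @[y --> x^'-]).
    apply: nondecreasing_at_left_is_cvgr.
      near=> z; have z0 : 0 < z by near: z; exact: nbhs_left_gt.
      move=> u v; rewrite !in_itv/= => /andP[zu _] _; apply: hi; exact: lt_trans zu.
    near=> z; have z0 : 0 < z by near: z; exact: nbhs_left_gt.
    exists (h x) => _ [y /= yi <-]; move: yi; rewrite in_itv/= => /andP[zy yx].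
    by apply: hi; [exact: lt_trans zy|exact: ltW].
  split => //; first by apply/cvg_ex; exists (h x); exact: hr.
  apply/eqP => e; apply: nc; apply/left_right_continuousP; split; last exact: hr.
  have rE : lim (h y @[y --> x^'+]) = h x by apply/cvg_lim => //; exact: hr.
  by rewrite rE in e; rewrite -e.
have mS : mu S = 0%E by apply/countable_lebesgue_measure0/finite_set_countable.
have mD : mu D = 0%E by exact: countable_lebesgue_measure0.
have msS : measurable S.
  by apply: countable_measurable => [t|]; [exact: measurable_set1|exact: finite_set_countable].
have msD : measurable D by apply: countable_measurable => // t; exact: measurable_set1.
pose I : set R := `]d / 2, d[%classic.
have : (mu I <= mu (S `|` D))%E.
  by apply: le_measure; rewrite ?inE//; [exact: measurable_itv|exact: measurableU].
apply/negP; rewrite -ltNge.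
rewrite (@le_lt_trans _ _ 0%E)//.
  have e := @measureU0 _ _ _ mu S D msS msD.
  have /e : mu D = 0%E := mD.
  by move=> ->; move: mS => /eqP; rewrite eq_le => /andP[].
have dd : d / 2 < d by rewrite ltr_pdivrMr// ltr_pMr// ltr1n.
by rewrite /I lebesgue_measure_itv/= lte_fin dd -EFinB lte_fin subr_gt0.
Unshelve. all: by end_near. Qed.

(** Exceptional points leave room to let [x] tend to 0 among the others. *)
Lemma le0_near0 (h : R -> R) (S : set R) (n a M d : R) : increasing_pos h ->
  (forall x, 0 < x -> h y @[y --> x^'+] --> h x) -> finite_set S -> 0 < n -> 0 < d ->
  (forall x, 0 < x -> x < d -> ~ (S `|` discontinuities h) x -> a <= M * x `^ n) ->
  a <= 0.
Proof.
move=> hi hr Sfin n0 d0 ha; rewrite leNgt; apply/negP => a0.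
have M1 : 0 < `|M| + 1 by rewrite ltr_wpDl.
have : \forall x \near 0^'+, x `^ n < a / (`|M| + 1).
  have /cvgrPdist_lt/(_ _ (divr_gt0 a0 M1)) := powR_cvg0 n0.
  by apply: filterS => x; rewrite sub0r normrN ger0_norm// powR_ge0.
move=> /nbhs_ballP[e /= e0 he].
have de0 : 0 < Num.min d e by rewrite lt_min d0.
have [x [x0 xde nx]] := regular_point hi hr Sfin de0.
move: xde; rewrite lt_min => /andP[xd xe].
have := ha x x0 xd nx; apply/negP; rewrite -ltNge.
have : x `^ n < a / (`|M| + 1).
  by apply: he => //; rewrite /ball/= sub0r normrN gtr0_norm.
rewrite ltr_pdivlMr// mulrC; apply: le_lt_trans.
by rewrite ler_wpM2r ?powR_ge0// (le_trans (ler_norm M))// lerDl.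
Qed.

End at_zero.

(** * The candidate solutions *)

(** The real-valued integral is 0 by convention as soon as the positive or the
negative part has infinite integral. *)
Lemma Rintegral_neq0_integrable {R : realType} (D : set R) (f : R -> R) :
  measurable D -> measurable_fun D f ->
  \int[@lebesgue_measure R]_(s in D) f s != 0 ->
  (@lebesgue_measure R).-integrable D (EFin \o f).
Proof.
set mu := @lebesgue_measure R => mD mf; apply: contraNP => nif.
have mF : measurable_fun D (EFin \o f) by apply/measurable_EFinP.
have mp := measurable_funepos mF; have mn := measurable_funeneg mF.
have Ip : (0 <= \int[mu]_(x in D) (EFin \o f)^\+%E x)%E by exact: integral_ge0.
have In : (0 <= \int[mu]_(x in D) (EFin \o f)^\-%E x)%E by exact: integral_ge0.
have : (\int[mu]_(x in D) `|(f x)%:E| = +oo)%E.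
  by apply/eqP; rewrite -leye_eq leNgt; apply/negP => fi; apply: nif; apply/integrableP.
have -> : (\int[mu]_(x in D) `|(f x)%:E| = \int[mu]_(x in D) (EFin \o f)^\+%E x +
    \int[mu]_(x in D) (EFin \o f)^\-%E x)%E.
  rewrite -ge0_integralD//; apply: eq_integral => x _.
  exact: (congr1 (fun F => F x) (fune_abse (EFin \o f))).
rewrite /Rintegral integralE.
by case: (\int[mu]_(x in D) _)%E Ip => [p| |] //; case: (\int[mu]_(x in D) _)%E In.
Qed.

Section gluing.
Context {R : realType}.
Variables (f g : R -> R) (a : R).
Local Notation glued := (fun y => if y < a then f y else g y).

Let near_lt x : x < a -> {near x, f =1 glued}.
Proof.
by move=> xa; near=> y; rewrite ifT//; near: y; exact: lt_nbhsl.
Unshelve. all: by end_near. Qed.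

Let near_gt x : a < x -> {near x, g =1 glued}.
Proof.
move=> ax; near=> y; rewrite ifF//; apply/negbTE; rewrite -leNgt ltW//.
by near: y; exact: lt_nbhsr.
Unshelve. all: by end_near. Qed.

Lemma is_derive_glue (x l : R) : (x <= a -> is_derive x 1 f l) ->
  (a <= x -> is_derive x 1 g l) -> (x = a -> f a = g a) -> is_derive x 1 glued l.
Proof.
case: (ltgtP x a) => [xa|ax|->] df dg fg.
- by apply: near_eq_is_derive (df _) => //; exact: near_lt.
- by apply: near_eq_is_derive (dg _) => //; exact: near_gt.
- by apply: is_derive_glue_at; [exact: fg|exact: df|exact: dg].
Qed.

Lemma continuous_glue (x : R) : (x <= a -> {for x, continuous f}) ->
  (a <= x -> {for x, continuous g}) -> (x = a -> f a = g a) ->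
  {for x, continuous glued}.
Proof.
case: (ltgtP x a) => [xa|ax|->] cf cg fg.
- apply: cvg_trans (near_eq_cvg (near_lt xa)) _; rewrite xa; exact: cf.
- apply: cvg_trans (near_eq_cvg (near_gt ax)) _; rewrite ltNge (ltW ax); exact: cg.
- by apply: continuous_glue_at; [exact: fg|exact: cf|exact: cg].
Qed.

End gluing.

Section candidates.
Context {R : realType}.
Variables (b sigma r : R) (h : R -> R) (K1 : R).
Hypotheses (sigma0 : sigma != 0) (r0 : 0 < r) (K10 : 0 < K1).
Hypothesis h_incr : increasing_pos h.
Local Notation mu := (@lebesgue_measure R).
Local Notation m := (exp_m b sigma r).
Local Notation n := (exp_n b sigma r).
Local Notation kap := ((sigma ^+ 2 * (n - m))^-1).
Local Notation g := (fun s => h s - r * K1).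

Let g_incr : increasing_pos g.
Proof. by move=> x y x0 xy; rewrite lerD2r; exact: h_incr. Qed.

Let int0o (k : R -> R) : increasing_pos k -> forall x,
  \int[mu]_(s in `]0, x[) (s `^ (- m - 1) * k s) = int0 m k x.
Proof.
move=> ki x; rewrite /int0 /Rintegral integral_itv_bndo_bndc//.
apply/measurable_EFinP; apply: measurable_weighted => //.
by apply: subset_itv; rewrite ?bnd_simp.
Qed.

(** An endpoint does not contribute to the integrals, integrable or not. *)
Lemma RhE : Rh b sigma r h = resolvent m n kap h.
Proof. by apply/funext => x; rewrite /Rh /resolvent -int0o. Qed.

Lemma alpha_equationE alpha : alpha_equation b sigma r h K1 alpha = (int0 m g alpha = 0).
Proof. by rewrite -int0o. Qed.

Hypothesis i0 : forall x, 0 < x ->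
  mu.-integrable `]0, x] (EFin \o (fun s => s `^ (- m - 1) * h s)).
Hypothesis iy : forall x, 0 < x ->
  mu.-integrable `]x, +oo[ (EFin \o (fun s => s `^ (- n - 1) * h s)).

Let m0 := exp_m_lt0 b sigma0 r0.
Let n0 := exp_n_gt0 b sigma0 r0.
Let kap0 := resolvent_coef_gt0 b sigma0 r0.
Let kapr := resolvent_coefE b sigma0 r0.

Let ig0 x : 0 < x -> mu.-integrable `]0, x] (EFin \o (fun s => s `^ (- m - 1) * g s)).
Proof. by move=> x0; apply/(@integrable_shift0 _ m (r * K1) h m0 x x0); exact: i0. Qed.

Let igy x : 0 < x -> mu.-integrable `]x, +oo[ (EFin \o (fun s => s `^ (- n - 1) * g s)).
Proof. by move=> x0; apply/(@integrable_shifty _ n (r * K1) h n0 x x0); exact: iy. Qed.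

Let shiftE x : 0 < x -> resolvent m n kap g x = Rh b sigma r h x - K1.
Proof.
move=> x0; rewrite RhE (@resolvent_shift _ m n kap r)//.
by rewrite [_ * K1]mulrC mulfK// gt_eqF.
Qed.

Let is_derive_Rh (x : R) : 0 < x ->
  is_derive x 1 (Rh b sigma r h) (dresolvent m n kap h x).
Proof. by move=> x0; rewrite RhE; exact: is_derive_resolvent. Qed.

Lemma increasing_Rh : increasing_pos (Rh b sigma r h).
Proof. by rewrite RhE; exact: (@increasing_resolvent _ m n kap h). Qed.

Section root.
Variable alpha : R.
Hypothesis gneg : exists2 x, 0 < x & h x < r * K1.
Hypotheses (alpha0 : 0 < alpha) (root : alpha_equation b sigma r h K1 alpha).
Local Notation B := (coef_B b sigma r h K1 alpha).

Let gneg' : exists2 x, 0 < x & g x < 0.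
Proof. by have [x x0 hx] := gneg; exists x => //; rewrite subr_lt0. Qed.

Let root' : int0 m g alpha = 0. Proof. by rewrite -alpha_equationE. Qed.

Lemma coef_B_gt0 : 0 < B.
Proof. exact: (inty_root_gt0 m0 n0 kap0 g_incr ig0 igy gneg' alpha0 root'). Qed.

Let V x := if x < alpha then B * x `^ n else resolvent m n kap g x.
Let dV x := if x < alpha then B * (n * x `^ (n - 1)) else dresolvent m n kap g x.
Let d2V x := if x < alpha then B * (n * ((n - 1) * x `^ (n - 1 - 1)))
             else d2resolvent m n kap g x.

Let candE : cand_w0 b sigma r h K1 alpha = V.
Proof.
apply/funext => x; rewrite /cand_w0 /V; case: ltP => // ax.
by rewrite shiftE// (lt_le_trans alpha0).
Qed.

Let dBpow p c (x : R) : 0 < x ->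
  is_derive x 1 (fun y => c * y `^ p) (c * (p * x `^ (p - 1))).
Proof. by move=> x0; exact: (is_deriveZ c (is_derive1_powR p x0)). Qed.

(** At [alpha] the two branches have the same value and the same derivative, since
the integral from 0 drops out of both. *)
Let is_derive_V (x : R) : 0 < x -> is_derive x 1 V (dV x).
Proof.
move=> x0; apply: is_derive_glue.
- move=> xa; suff -> : dV x = B * (n * x `^ (n - 1)) by exact: dBpow.
  rewrite /dV; case: ltP => // ax.
  have -> : x = alpha by apply/eqP; rewrite eq_le xa ax.
  by rewrite (dresolvent_root n kap root').
- move=> ax; rewrite /dV ltNge ax /=.
  exact: is_derive_resolvent.
- by move=> _; rewrite (resolvent_root n kap root').
Qed.

Let continuous_dV (x : R) : 0 < x -> {for x, continuous dV}.
Proof.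
move=> x0; apply: continuous_glue => _.
- exact: (@continuous_scaler _ B x _ (@continuous_scaler _ n x _ (@continuous_powR _ (n - 1) x x0))).
- exact: continuous_dresolvent.
- by rewrite (dresolvent_root n kap root').
Qed.

Let continuous_shift x : {for x, continuous h} -> {for x, continuous g}.
Proof. by move=> ch; apply: cvgB => //; exact: cvg_cst. Qed.

Let is_derive_dV (x : R) : 0 < x -> x <> alpha -> {for x, continuous h} ->
  is_derive x 1 dV (d2V x).
Proof.
move=> x0 xa ch; apply: is_derive_glue; last by [].
- rewrite le_eqVlt => /predU1P[//|xlt]; rewrite /d2V xlt.
  have d1 := dBpow (n - 1) n x0.
  exact: (is_deriveZ B d1).
- move=> ax; rewrite /d2V ltNge ax /=.
  by apply: is_derive_dresolvent => //; exact: continuous_shift.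
Qed.

Let continuous_d2V (x : R) : 0 < x -> x <> alpha -> {for x, continuous h} ->
  {for x, continuous d2V}.
Proof.
move=> x0 xa ch; apply: continuous_glue => // _.
- exact: (@continuous_scaler _ B x _ (@continuous_scaler _ n x _
    (@continuous_scaler _ (n - 1) x _ (@continuous_powR _ (n - 1 - 1) x x0)))).
- by apply: continuous_d2resolvent => //; exact: continuous_shift.
Qed.

Lemma increasing_cand_w0 : increasing_pos (cand_w0 b sigma r h K1 alpha).
Proof.
rewrite candE; apply: (nondecreasing_pos is_derive_V) => x x0; rewrite /dV.
case: ifP => _; last exact: (@dresolvent_ge0 _ m n kap g).
by rewrite mulr_ge0 ?(ltW coef_B_gt0)// mulr_ge0 ?powR_ge0// ltW.
Qed.

Let regular (S : set R) x : 0 < x -> ~ (S `|` discontinuities h) x ->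
  ~ S x /\ {for x, continuous h}.
Proof.
move=> x0 nE; split=> [Sx|]; first by apply: nE; left.
by apply: contrapT => nc; apply: nE; right.
Qed.

(** The differential equations hold with equality for [w1] everywhere and for [w0]
below [alpha]; above [alpha] the residue of the latter is [- g], which is
nonpositive there.  The bounds on [w1 - w0] below [alpha] are
[resolvent_le_root] and [resolvent_ge_root]. *)
Lemma hjb_candidates K0 K : 0 < K0 -> 0 <= K ->
  (forall x, 0 < x -> - (r * K0) <= h x) -> (forall x, 0 < x -> - (r * K) <= h x) ->
  hjb_solution b sigma r h K1 K0 K (Rh b sigma r h) (cand_w0 b sigma r h K1 alpha).
Proof.
move=> K00 K_ge0 hK0 hK; rewrite candE.
have d1R := is_derive_Rh; have d1V := is_derive_V.
have c1R (x : R) : 0 < x -> {for x, continuous (dresolvent m n kap h)}.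
  by move=> x0; exact: continuous_dresolvent.
have d2R (x : R) : 0 < x -> {for x, continuous h} ->
    is_derive x 1 (dresolvent m n kap h) (d2resolvent m n kap h x).
  by move=> x0 ch; exact: is_derive_dresolvent.
have E_alpha (x : R) : 0 < x -> ~ ([set alpha] `|` discontinuities h) x ->
    x <> alpha /\ {for x, continuous h} by exact: regular.
split; [exact: C1_posI d1R c1R|exact: C1_posI d1V continuous_dV|].
exists [set alpha]; split; first exact: finite_set1.
split.
- apply: (@C2_pos_offI _ _ _ _ (d2resolvent m n kap h) d1R) => x x0 /E_alpha-/(_ x0)[_ ch]; first exact: d2R.
  exact: continuous_d2resolvent.
- apply: (@C2_pos_offI _ _ _ _ d2V d1V) => x x0 /E_alpha-/(_ x0)[xa ch]; first exact: is_derive_dV.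
  exact: continuous_d2V.
move=> x x0 /E_alpha-/(_ x0)[xa ch].
rewrite (derive1_pos d1R x0) (derive1_pos d1V x0).
rewrite (derive2_pos d1R x0 (d2R x x0 ch)) (derive2_pos d1V x0 (is_derive_dV x0 xa ch)).
have mroot := exp_m_root b sigma0 r0; have nroot := exp_n_root b sigma0 r0.
have odeR : sigma ^+ 2 * x ^+ 2 * d2resolvent m n kap h x
    + b * x * dresolvent m n kap h x - r * Rh b sigma r h x + h x = 0.
  by rewrite RhE; apply: resolvent_ode => //; exact: resolvent_coefK.
have odeg : sigma ^+ 2 * x ^+ 2 * d2resolvent m n kap g x
    + b * x * dresolvent m n kap g x - r * resolvent m n kap g x + g x = 0.
  by apply: resolvent_ode => //; exact: resolvent_coefK.
have odeB : sigma ^+ 2 * x ^+ 2 * (B * (n * ((n - 1) * x `^ (n - 1 - 1))))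
    + b * x * (B * (n * x `^ (n - 1))) - r * (B * x `^ n) = 0.
  have xx : x * x^-1 = 1 by rewrite divff// gt_eqF.
  rewrite !powRB1//; transitivity (B * x `^ n * ((x * x^-1) ^+ 2 *
    (sigma ^+ 2 * n * (n - 1)) + x * x^-1 * (b * n) - r)); first by ring.
  by rewrite xx expr1n !mul1r nroot subrr mulr0.
have B0 := coef_B_gt0.
have rK : - (r * K) / r = - K by rewrite mulNr mulrC mulKf// gt_eqF.
have R_K : - K <= Rh b sigma r h x.
  by rewrite -rK RhE; apply: (@resolvent_ge _ m n kap r h).
have g_alpha : 0 < g alpha := gt0_at_root m0 g_incr ig0 gneg' alpha0 root'.
have V_lt : x < alpha -> V x = B * x `^ n by rewrite /V => ->.
have V_ge : alpha <= x -> V x = resolvent m n kap g x by rewrite /V ltNge => ->.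
have V_ge0 : 0 <= V x.
  have [ax|ax] := ltP x alpha; first by rewrite V_lt// mulr_ge0 ?powR_ge0// ltW.
  rewrite V_ge//.
  apply: le_trans (_ : resolvent m n kap g alpha <= _).
    by rewrite (resolvent_root n kap root') mulr_ge0 ?powR_ge0// ltW.
  exact: (@increasing_resolvent _ m n kap g).
have upper : V x - Rh b sigma r h x - K0 <= 0.
  have [ax|ax] := ltP x alpha; last by rewrite V_ge// shiftE//; move: K00 K10;
    set Rx := Rh _ _ _ _ _; lra.
  rewrite V_lt//; have gK0 s : 0 < s -> - (r * K0) - r * K1 <= g s by move=> s0; rewrite lerD2r hK0.
  have c0 : - (r * K0) - r * K1 <= 0 by rewrite -opprD oppr_le0 addr_ge0// mulr_ge0// ltW.
  have := resolvent_ge_root m0 n0 kap0 r0 kapr g_incr ig0 igy x0 (ltW ax) c0 gK0.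
  rewrite shiftE// (_ : (- (r * K0) - r * K1) / r = - K0 - K1).
    rewrite -/B; lra.
  by field; rewrite gt_eqF.
have lower : Rh b sigma r h x - V x - K1 <= 0.
  have [ax|ax] := ltP x alpha; last by rewrite V_ge// shiftE//; lra.
  rewrite V_lt//.
  have := resolvent_le_root m0 n0 kap0 g_incr ig0 igy alpha0 root' x0 (ltW ax).
  by rewrite shiftE// -/B; lra.
split.
  rewrite odeR (max_idPl upper); apply/max_idPl; lra.
rewrite /dV /d2V; case: ltP => ax.
  rewrite {1}V_lt// odeB (max_idPl lower); apply/max_idPl; lra.
have gx : 0 <= g x by apply: le_trans (ltW g_alpha) _; exact: g_incr.
have eqK1 : Rh b sigma r h x - V x - K1 = 0 by rewrite V_ge// shiftE//; ring.
rewrite eqK1 {1}V_ge// (@max_r _ _ _ 0).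
  by apply/max_idPl; lra.
by move: odeg; rewrite /=; lra.
Qed.

End root.

End candidates.

(** * Necessity of the conditions, and the equivalence *)

Section necessity.
Context {R : realType}.
Variables (b sigma r : R) (h : R -> R) (K1 K0 K : R).
Hypotheses (sigma0 : sigma != 0) (r0 : 0 < r).
Hypothesis h_incr : increasing_pos h.
Hypothesis h_rcont : forall x, 0 < x -> h y @[y --> x^'+] --> h x.
Local Notation mu := (@lebesgue_measure R).
Local Notation m := (exp_m b sigma r).
Local Notation n := (exp_n b sigma r).
Local Notation kap := ((sigma ^+ 2 * (n - m))^-1).
Local Notation g := (fun s => h s - r * K1).

Let g_incr : increasing_pos g.
Proof. by move=> x y x0 xy; rewrite lerD2r; exact: h_incr. Qed.

Let m0 := exp_m_lt0 b sigma0 r0.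
Let n0 := exp_n_gt0 b sigma0 r0.

Lemma max3_eq0_le (x y z : R) : Num.max (Num.max x y) z = 0 -> y <= 0 /\ z <= 0.
Proof. by move=> <-; rewrite !le_max !lexx !orbT. Qed.

(** The integral up to [alpha + 1] is not zero, hence it converges absolutely. *)
Lemma integrable_of_unique_root alpha : 0 < alpha ->
  (forall a, 0 < a -> alpha_equation b sigma r h K1 a -> a = alpha) ->
  forall x, 0 < x -> mu.-integrable `]0, x] (EFin \o (fun s => s `^ (- m - 1) * h s)).
Proof.
move=> a0 uniq x x0.
apply/(@integrable_shift0 _ m (r * K1) h m0 x x0).
have a1 : 0 < alpha + 1 by rewrite addr_gt0.
have i1 : mu.-integrable `]0, alpha + 1[ (EFin \o (fun s => s `^ (- m - 1) * g s)).
  apply: Rintegral_neq0_integrable => //.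
    by apply: measurable_weighted => //; apply: subset_itv; rewrite ?bnd_simp.
  apply/eqP => e; have := uniq _ a1 e => /eqP.
  by rewrite -subr_eq0 addrAC subrr add0r oner_eq0.
have i2 : mu.-integrable `]0, alpha] (EFin \o (fun s => s `^ (- m - 1) * g s)).
  by apply: integrableS i1 => //; apply: subset_itv; rewrite ?bnd_simp// ltrDl.
have : mu.-integrable (`]0, alpha] `|` `]alpha, x])
    (EFin \o (fun s => s `^ (- m - 1) * g s)).
  by apply: integrable_setU => //; exact: integrable_weighted_oc.
apply: integrableS => //; first by apply: measurableU; exact: measurable_itv.
move=> s /=; rewrite !in_itv/= => /andP[s0 sx].
by case: (leP s alpha) => sa; [left|right]; apply/andP.
Qed.

Lemma integrable_of_coef_B alpha : 0 < alpha -> 0 < coef_B b sigma r h K1 alpha ->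
  forall x, 0 < x -> mu.-integrable `]x, +oo[ (EFin \o (fun s => s `^ (- n - 1) * h s)).
Proof.
move=> a0 B0 x x0; apply/(@integrable_shifty _ n (r * K1) h n0 x x0).
have i1 : mu.-integrable `]alpha, +oo[ (EFin \o (fun s => s `^ (- n - 1) * g s)).
  apply: Rintegral_neq0_integrable => //.
    by apply: measurable_weighted => //; apply: subset_itv; rewrite ?bnd_simp// ltW.
  by apply: contraTneq B0; rewrite /coef_B => ->; rewrite mulr0 ltxx.
have : mu.-integrable (`]x, alpha] `|` `]alpha, +oo[)
    (EFin \o (fun s => s `^ (- n - 1) * g s)).
  by apply: integrable_setU => //; exact: integrable_weighted_oc.
apply: integrableS => //; first by apply: measurableU; exact: measurable_itv.
move=> s /=; rewrite !in_itv/= !andbT => xs.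
by case: (leP s alpha) => sa; [left; apply/andP|right].
Qed.

Hypothesis i0 : forall x, 0 < x ->
  mu.-integrable `]0, x] (EFin \o (fun s => s `^ (- m - 1) * h s)).
Hypothesis iy : forall x, 0 < x ->
  mu.-integrable `]x, +oo[ (EFin \o (fun s => s `^ (- n - 1) * h s)).
Variable alpha : R.
Hypotheses (alpha0 : 0 < alpha).

(** If [h] were nowhere below [r * K1], the integral in the equation would be
nondecreasing and nonnegative, and would vanish before [alpha] as well. *)
Lemma lt_of_unique_root : alpha_equation b sigma r h K1 alpha ->
  (forall a, 0 < a -> alpha_equation b sigma r h K1 a -> a = alpha) ->
  (h_at0 h < (r * K1)%:E)%E.
Proof.
rewrite alpha_equationE// => root uniq; rewrite ltNge; apply/negP => hK1.
have ge0g s : 0 < s -> 0 <= g s.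
  by move=> s0; rewrite subr_ge0 -lee_fin (le_trans hK1)// h_at0_le.
have ig0 x : 0 < x -> mu.-integrable `]0, x] (EFin \o (fun s => s `^ (- m - 1) * g s)).
  by move=> x0; apply/(@integrable_shift0 _ m (r * K1) h m0 x x0); exact: i0.
have a2 : 0 < alpha / 2 by rewrite divr_gt0.
have a2lt : alpha / 2 < alpha by rewrite ltr_pdivrMr// ltr_pMr// ltr1n.
have : alpha / 2 = alpha.
  apply: uniq => //; rewrite alpha_equationE//; apply/eqP; rewrite eq_le; apply/andP; split.
    rewrite -root; apply: (@int0_nondecreasing _ m g m0 g_incr ig0) => //.
      exact: ltW.
    exact: ge0g.
  have := @int0_ge _ m g m0 ig0 (alpha / 2) 0 a2; rewrite mul0r; apply => s s0 _.
  exact: ge0g.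
by move=> /eqP; rewrite lt_eqF.
Qed.

Hypothesis hjb : hjb_solution b sigma r h K1 K0 K
  (Rh b sigma r h) (cand_w0 b sigma r h K1 alpha).
Hypothesis B0 : 0 < coef_B b sigma r h K1 alpha.

Let hjb_ineq : exists2 S : set R, finite_set S & forall x, 0 < x ->
  ~ (S `|` discontinuities h) x ->
  [/\ cand_w0 b sigma r h K1 alpha x - Rh b sigma r h x <= K0,
      - K <= Rh b sigma r h x & - K <= cand_w0 b sigma r h K1 alpha x].
Proof.
case: hjb => _ _ [S [Sfin [_ _ hS]]]; exists S => // x x0 nE.
have [/max3_eq0_le[a1 a2] /max3_eq0_le[_ a3]] := hS x x0 nE.
split; [by rewrite -subr_le0| |]; rewrite -subr_le0; [move: a2|move: a3].
  by rewrite addrC.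
by rewrite addrC.
Qed.

(** [w0 = B * x `^ n] tends to 0 at 0. *)
Lemma hjb_K_ge0 : 0 <= K.
Proof.
have [S Sfin hS] := hjb_ineq; rewrite -oppr_le0.
apply: (@le0_near0 _ h S n _ (coef_B b sigma r h K1 alpha) alpha) => // x x0 xa nE.
by have [_ _] := hS x x0 nE; rewrite /cand_w0 xa.
Qed.

Let h_at0_ge_of (c : R) : (forall x, 0 < x -> c <= h x) -> (c%:E <= h_at0 h)%E.
Proof. by move=> hc; apply: h_at0_ge => // x x0; rewrite lee_fin hc. Qed.

(** [resolvent_le_near0] turns a lower bound on [w1] near 0 into one on [h]. *)
Let resolvent_near0 (L : R) (S : set R) : finite_set S ->
  (forall x, 0 < x -> x < alpha -> ~ (S `|` discontinuities h) x -> L <= Rh b sigma r h x) ->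
  ((r * L)%:E <= h_at0 h)%E.
Proof.
move=> Sfin hL; apply: h_at0_ge_of => d d0.
have hd s : 0 < s -> s <= d -> h s <= h d by move=> s0 sd; exact: h_incr.
have kap0 := resolvent_coef_gt0 b sigma0 r0; have kapr := resolvent_coefE b sigma0 r0.
have [M hM] : exists M : R, forall x : R, 0 < x -> x <= d ->
    resolvent m n kap h x <= h d / r + M * x `^ n.
  exact: (@resolvent_le_near0 _ m n kap r h).
rewrite mulrC -ler_pdivlMr// -subr_le0.
have da : 0 < Num.min d alpha by rewrite lt_min d0.
apply: (@le0_near0 _ h S n _ M (Num.min d alpha)) => // x x0.
rewrite lt_min => /andP[xd xa] nE; rewrite lerBlDr addrC.
by apply: le_trans (hL x x0 xa nE) _; rewrite RhE//; apply: hM => //; exact: ltW.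
Qed.

(** Near 0 the inequalities read [- K <= w1] and [- K0 <= w1 - B * x `^ n]. *)
Lemma hjb_h_at0_ge : ((Num.max (- (r * K0)) (- (r * K)))%:E <= h_at0 h)%E.
Proof.
have [S Sfin hS] := hjb_ineq.
have : ((- (r * K0))%:E <= h_at0 h)%E.
  rewrite -mulrN; apply: (@resolvent_near0 _ S) => // x x0 xa nE.
  have [+ _ _] := hS x x0 nE; rewrite /cand_w0 xa.
  have : 0 <= coef_B b sigma r h K1 alpha * x `^ n by rewrite mulr_ge0 ?powR_ge0// ltW.
  by move: (coef_B _ _ _ _ _ _ * _) (Rh _ _ _ _ _) => u v; lra.
have : ((- (r * K))%:E <= h_at0 h)%E.
  rewrite -mulrN; apply: (@resolvent_near0 _ S) => // x x0 xa nE.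
  by have [] := hS x x0 nE.
by case: (leP (- (r * K0)) (- (r * K))).
Qed.

End necessity.

Theorem lemma2 (R : realType) (d : measure_display) (T : measurableType d)
    (P : probability T R) (F : R -> set (set T)) (W : R -> T -> R)
    (b sigma r : R) (h : R -> R) (K1 K0 K : R)
    (hW : brownian_motion P F W)
    (hsigma : sigma != 0) (hr : 0 < r) (hK1 : 0 < K1) (hK0 : 0 < K0)
    (h_rcont : forall x, 0 < x -> h y @[y --> x^'+] --> h x)
    (h_incr : increasing_pos h)
    (h_infty : h x @[x --> +oo] --> +oo)
    (h_integrable : forall (x : R) (X : R -> T -> R), 0 < x ->
       solves_sde P b sigma F W x X ->
       (\int[P]_w \int[lebesgue_measure]_(t in `[0%R, +oo[)
          (expR (- (r * t)) * `|h (X t w)|)%:E < +oo)%E) :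
  (exists alpha : R,
     [/\ 0 < alpha, alpha_equation b sigma r h K1 alpha,
         (forall alpha', 0 < alpha' ->
            alpha_equation b sigma r h K1 alpha' -> alpha' = alpha) &
         [/\ 0 < coef_B b sigma r h K1 alpha,
             increasing_pos (Rh b sigma r h),
             increasing_pos (cand_w0 b sigma r h K1 alpha) &
             hjb_solution b sigma r h K1 K0 K
               (Rh b sigma r h) (cand_w0 b sigma r h K1 alpha)]])
  <->
  (0 <= K /\
   ((Num.max (- (r * K0)) (- (r * K)))%:E <= h_at0 h)%E /\
   (h_at0 h < (r * K1)%:E)%E).
Proof.
split=> [[alpha [a0 root uniq [B0 _ _ hjb]]]|[K_ge0 [h0_ge h0_lt]]].
  have i0 := integrable_of_unique_root hsigma hr h_incr a0 uniq.
  have iy := integrable_of_coef_B hsigma hr h_incr a0 B0.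
  split; first exact: (hjb_K_ge0 hsigma hr h_incr h_rcont a0 hjb).
  split; last exact: (lt_of_unique_root hsigma hr h_incr i0 a0 root uniq).
  exact: (hjb_h_at0_ge hsigma hr h_incr h_rcont i0 iy a0 hjb B0).
have m0 := exp_m_lt0 b hsigma hr; have n0 := exp_n_gt0 b hsigma hr.
have hL x : 0 < x -> Num.max (- (r * K0)) (- (r * K)) <= h x.
  by move=> x0; rewrite -lee_fin (le_trans h0_ge)// h_at0_le.
have hK0' x : 0 < x -> - (r * K0) <= h x.
  by move=> x0; apply: le_trans (hL x x0); rewrite le_max lexx.
have hK' x : 0 < x -> - (r * K) <= h x.
  by move=> x0; apply: le_trans (hL x x0); rewrite le_max lexx orbT.
have iy x : 0 < x -> lebesgue_measure.-integrable `]x, +oo[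
    (EFin \o (fun s => s `^ (- exp_n b sigma r - 1) * h s)).
  move=> x0; have := gbm_integrable_at_infinity hW hsigma hr h_incr h_infty
    (h_integrable 1 _ ltr01 (gbm_solves_sde b sigma hW)) x0.
  by apply: integrableS => //; apply: subset_itv; rewrite ?bnd_simp.
have i0 x : 0 < x -> lebesgue_measure.-integrable `]0, x]
    (EFin \o (fun s => s `^ (- exp_m b sigma r - 1) * h s)).
  move=> x0; pose M := r * K0 + `|h x|.
  have ip : lebesgue_measure.-integrable `]0, x]
      (fun s : R => (M%:E * (s `^ (- exp_m b sigma r - 1))%:E)%E).
    by apply: integrableZl => //; apply: integrable_powR_0; rewrite ?oppr_gt0.
  apply: le_integrable ip => //.
    apply/measurable_EFinP; apply: measurable_weighted => //.
    by apply: subset_itv; rewrite ?bnd_simp.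
  move=> s /=; rewrite in_itv/= => /andP[s0 sx].
  rewrite lee_fin !normrM mulrC ler_wpM2r// [leRHS]ger0_norm; last first.
    by rewrite addr_ge0// mulr_ge0// ltW.
  have h1 := hK0' s s0; have h2 := h_incr s x s0 sx; have h3 := ler_norm (h x).
  have h4 : 0 <= r * K0 by rewrite mulr_ge0// ltW.
  have h5 := normr_ge0 (h x).
  by rewrite ler_norml /M; move: h1 h2 h3 h4 h5; move: (r * K0) `|h x| => u v *; apply/andP; split; lra.
have g_incr : increasing_pos (fun s => h s - r * K1).
  by move=> x y x0 xy; rewrite lerD2r; exact: h_incr.
have gneg : exists2 x, 0 < x & h x < r * K1.
  by have [x x0 hx] := h_at0_lt h_incr h0_lt; exists x; rewrite // -lte_fin.
have gneg' : exists2 x, 0 < x & h x - r * K1 < 0.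
  by have [x x0 hx] := gneg; exists x => //; rewrite subr_lt0.
have gpos : exists2 x, 0 < x & 0 < h x - r * K1.
  have /cvgryPgt/(_ (r * K1)) [M [_ hM]] := h_infty.
  exists (Num.max M 0 + 1); first by rewrite ltr_wpDl// le_max lexx orbT.
  by rewrite subr_gt0; apply: hM; rewrite ltr_pwDr// le_max lexx.
have ig0 x : 0 < x -> lebesgue_measure.-integrable `]0, x]
    (EFin \o (fun s => s `^ (- exp_m b sigma r - 1) * (h s - r * K1))).
  by move=> x0; apply/(@integrable_shift0 _ _ (r * K1) h m0 x x0); exact: i0.
have [alpha a0 root] : exists2 a, 0 < a & int0 (exp_m b sigma r) (fun s => h s - r * K1) a = 0.
  exact: root_exists.
have root' : alpha_equation b sigma r h K1 alpha by rewrite alpha_equationE.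
exists alpha; split => //.
  move=> a' a'0; rewrite alpha_equationE// => root2.
  exact: (root_unique m0 g_incr ig0 gneg' a0 root a'0 root2).
split.
- exact: (coef_B_gt0 hsigma hr h_incr i0 iy gneg a0 root').
- exact: increasing_Rh.
- exact: increasing_cand_w0.
- exact: hjb_candidates.
Qed.
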